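(* Let $\Phi$ be an increasing positive function on the primes and let $H>0$. Then $$\lim_{N\to\infty}\ \min_{|a_p|\le\Phi(p)}\ \int_0^H\left|1+\sum_{\substack{p\text{ prime}\\ p\le N}}a_p p^{it-1}\right|^2dt>0$$ if and only if $$\sum_{p\text{ prime}}\frac{\log\Phi(p)}{p\log p}<\infty .$$
   Context: For each $N$ the minimum is taken over all complex numbers $a_p$, indexed by primes $p\le N$, with $|a_p|\le\Phi(p)$. *)

(* Defs.v *)
From HB Require Import structures.
From mathcomp Require Export all_boot all_order all_algebra.
From mathcomp Require Export all_classical all_reals all_analysis.
From mathcomp Require Export complex.
Import Order.TTheory GRing.Theory Num.Theory.
Import numFieldNormedType.Exports.

Set Implicit Arguments.
Unset Strict Implicit.
Unset Printing Implicit Defensive.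

Local Open Scope classical_set_scope.
Local Open Scope ring_scope.
Local Open Scope complex_scope.

Definition expC (R : realType) (z : R[i]) : R[i] :=
  (expR (complex.Re z))%:C * (cos (complex.Im z) +i* sin (complex.Im z)).

(* x `^ z with the real logarithm of x; only meant for x > 0. *)
Definition cpowR (R : realType) (x : R) (z : R[i]) : R[i] :=
  expC (z * (ln x)%:C).

Definition primeDirichlet (R : realType) (a : nat -> R[i]) (N : nat) (t : R)
    : R[i] :=
  1 + \sum_(p < N.+1 | prime p) a p * cpowR p%:R ((- 1) +i* t).

Definition sqnorm (R : realType) (H : R) (a : nat -> R[i]) (N : nat) : R :=
  \int[lebesgue_measure]_(t in `[0, H])
    (Normc.normc (primeDirichlet a N t) ^+ 2).

(* The values of a outside the primes p <= N are unconstrained, and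
   sqnorm H a N does not depend on them. *)
Definition admissible (R : realType) (Phi : nat -> R) (N : nat) :
    set (nat -> R[i]) :=
  [set a | forall p, prime p -> (p <= N)%N -> Normc.normc (a p) <= Phi p].

Definition is_min (R : realType) (A : set R) (m : R) : Prop :=
  A m /\ lbound A m.

(* Main.v *)
(* Write log+ for the positive part of the logarithm, and call
   A^m ln 64 < ln p <= A^(m+1) ln 64 the m-th block. By Chebyshev's estimates
   the sum of 1/(p ln p) over the m-th block has exact order A^-m; as Phi is
   increasing, the series converges iff sum_m w_m A^-m does, where w_m is the
   average of log+ Phi over the m-th block.

   Suppose that the minimum stays above d. The first-order conditions at a
   minimiser of the discretised integral give an exponential sum f with
   frequencies in [0, H] and total mass at most H such that
   d/2 + sum_p Phi(p)/p |f(ln p)| <= |f(0)|. So f is tiny at most of the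
   points ln p, and Lagrange interpolation at well-spaced ones gives
   |f| <= exp(-w_m/1024) on whole blocks. Since f(0) is not small, a maximum
   principle with weights concentrated on the blocks bounds sum_m w_m A^-m.

   Conversely, let the series converge. Put
   G(x) = Q(x) sinc(eta x)^d prod_m sinc(h_m x)^(n_m) with h_m of order 4^-m
   and n_m about w_(m+1) + 2^m, so that sum_m n_m h_m is as small as we like
   after dropping initial terms. The product makes the sum over the remaining
   primes of Phi(p)/p |G(ln p)| converge, and Q is a polynomial with Q(0) close
   to 1 that makes the whole sum at most 1/4. Multiplying the coefficients of
   an exponential sum by G(frequency) is bounded in sup norm, uniformly in N, up
   to shrinking the interval; it keeps the constant term and nearly kills the
   others, so the L2 norm on [0, H] is bounded below. Such a Q exists because
   powers of cos(s sqrt x), bounded by 1 for x >= 0, are limits of polynomials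
   in the weight exp(sqrt x). *)

(* With x = ln p the series is comparable to the integral of log+ Phi(e^x) / x^2, so the dichotomy
   is that of the logarithmic integral: how small the transform of a measure on a bounded interval
   can be.

   The integral is discretised because equally spaced frequencies j H / n turn f into a polynomial
   in cis (H x / n). The half-plane becomes the unit disc, where a maximum principle needs only
   finite Fourier inversion and powers. As n is chosen after N and the final bound depends on
   neither, the discretisation costs nothing.

   Interpolation needs an average w between 4 ln (k + 1) and k for k ln 64 <= ln p <= (k + 1) ln 64.
   Smaller averages add up to a convergent series; larger ones are capped at A^m, which does not
   affect divergence.

   A weight of modulus at most 1 on the whole circle cannot exceed 1 inside the disc, so a gain near
   f(0) must be paid for somewhere. Each weight is therefore allowed to be large on its own block,
   where f is known to be tiny, and is at most 1 elsewhere. *)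
Require Import Defs.
From mathcomp Require Import ring lra zify.
Import Order.TTheory GRing.Theory Num.Theory.
Import numFieldNormedType.Exports.
Import Normc.

Set Implicit Arguments.
Unset Strict Implicit.
Unset Printing Implicit Defensive.

Local Open Scope classical_set_scope.
Local Open Scope ring_scope.
Local Open Scope complex_scope.

(** * Modulus, real part and unit circle in [R[i]] *)

Section Cis.
Variable R : realType.
Implicit Types (x y t : R) (z : R[i]).

Lemma le_of_eq x y : x = y -> x <= y.
Proof. by move=> ->. Qed.

Definition cis x : R[i] := cos x +i* sin x.

Lemma cis0 : cis 0 = 1.
Proof. by rewrite /cis cos0 sin0. Qed.

Lemma cisD x y : cis (x + y) = cis x * cis y.
Proof.
by rewrite /cis cosD sinD; simpc; congr (_ +i* _); ring.
Qed.

Lemma conj_cis x : (cis x)^* = cis (- x).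
Proof. by rewrite /cis cosN sinN. Qed.

Lemma cisX x n : cis x ^+ n = cis (n%:R * x).
Proof.
elim: n => [|n IH]; first by rewrite expr0 mul0r cis0.
by rewrite exprS IH -cisD; congr cis; rewrite -natr1; ring.
Qed.

Lemma normcE_sqr z : normc z ^+ 2 = complex.Re z ^+ 2 + complex.Im z ^+ 2.
Proof. by case: z => a b /=; rewrite sqr_sqrtr // addr_ge0 ?sqr_ge0. Qed.

Lemma normc_ge0 z : 0 <= normc z.
Proof. by case: z => a b; exact: sqrtr_ge0. Qed.

Lemma normc_cis x : normc (cis x) = 1.
Proof. by rewrite /= cos2Dsin2 sqrtr1. Qed.

Lemma normc_real x : normc (x%:C) = `|x|.
Proof. by rewrite /= expr0n addr0 sqrtr_sqr. Qed.

Lemma normcX z n : normc (z ^+ n) = normc z ^+ n.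
Proof. by elim: n => [|n IH]; rewrite ?expr0 ?normc1 // !exprS normcM IH. Qed.

Lemma normc_conj z : normc z^* = normc z.
Proof. by case: z => a b /=; rewrite sqrrN. Qed.

Lemma normc_eq0 z : (normc z == 0) = (z == 0).
Proof. by apply/eqP/eqP => [/eq0_normc//|->]; rewrite normc0. Qed.

Lemma Re_le_normc z : complex.Re z <= normc z.
Proof.
case: z => a b /=; rewrite (le_trans (ler_norm a))// -sqrtr_sqr.
by rewrite ler_wsqrtr// lerDl sqr_ge0.
Qed.

Lemma normc_sum I (r : seq I) (P : pred I) (F : I -> R[i]) :
  normc (\sum_(i <- r | P i) F i) <= \sum_(i <- r | P i) normc (F i).
Proof.
elim/big_rec2: _ => [|i y z _ H]; first by rewrite normc0.
by rewrite (le_trans (le_normcD _ _))// lerD2l.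
Qed.

Lemma normc_prod I (r : seq I) (P : pred I) (F : I -> R[i]) :
  normc (\prod_(i <- r | P i) F i) = \prod_(i <- r | P i) normc (F i).
Proof. by elim/big_rec2: _ => [|i y z _ H]; rewrite ?normc1// normcM H. Qed.

Lemma le_normcB z1 z2 : normc z1 - normc z2 <= normc (z1 - z2).
Proof. by rewrite lerBlDr (le_trans _ (le_normcD _ _))// subrK. Qed.

Lemma ReM_real x z : complex.Re (x%:C * z) = x * complex.Re z.
Proof. by case: z => a b; simpc. Qed.
Lemma ImM_real x z : complex.Im (x%:C * z) = x * complex.Im z.
Proof. by case: z => a b; simpc. Qed.

Lemma mulc_conj z : z * z^* = (normc z ^+ 2)%:C.
Proof. rewrite normcE_sqr; case: z => a b; simpc; congr (_ +i* _); ring. Qed.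

(* Testing against all rotations turns real bounds into modulus bounds. *)
Lemma normc_rotate z : exists2 w : R[i], normc w = 1 & w * z = (normc z)%:C.
Proof.
have [->|z0] := eqVneq z 0; first by exists 1; rewrite ?normc1 ?mulr0 ?normc0.
have nz : normc z != 0 by rewrite normc_eq0.
exists (z^* * ((normc z)^-1)%:C).
  by rewrite normcM normc_conj normc_real ger0_norm ?invr_ge0 ?normc_ge0// mulfV.
rewrite mulrAC [_ * z]mulrC mulc_conj -rmorphM /=; congr (_%:C).
by rewrite expr2 mulfK.
Qed.

Lemma ReD z1 z2 : complex.Re (z1 + z2) = complex.Re z1 + complex.Re z2.
Proof. by case: z1; case: z2. Qed.
Lemma ImD z1 z2 : complex.Im (z1 + z2) = complex.Im z1 + complex.Im z2.
Proof. by case: z1; case: z2. Qed.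
Lemma Re_sum I (r : seq I) (P : pred I) (F : I -> R[i]) :
  complex.Re (\sum_(i <- r | P i) F i) = \sum_(i <- r | P i) complex.Re (F i).
Proof. by elim/big_rec2: _ => // i y1 y2 _ <-; rewrite ReD. Qed.
Lemma Im_sum I (r : seq I) (P : pred I) (F : I -> R[i]) :
  complex.Im (\sum_(i <- r | P i) F i) = \sum_(i <- r | P i) complex.Im (F i).
Proof. by elim/big_rec2: _ => // i y1 y2 _ <-; rewrite ImD. Qed.

End Cis.

(** * Chebyshev estimates *)

Section Theta.
Variable R : realType.

Lemma ln_prod (r : seq nat) : all (ltn 0) r ->
  ln ((\prod_(p <- r) p)%:R : R) = \sum_(p <- r) ln p%:R.
Proof.
elim: r => [|a r IH] /=; first by rewrite !big_nil ln1.
move=> /andP[a0 ar]; rewrite !big_cons natrM lnM ?IH// posrE ltr0n//.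
by rewrite big_seq prodn_cond_gt0// => i /(allP ar).
Qed.

Lemma prod_primes_dvd (r : seq nat) m : uniq r -> all prime r ->
  (forall p, p \in r -> p %| m)%N -> (\prod_(p <- r) p %| m)%N.
Proof.
elim: r => [|a r IH] /=; first by rewrite big_nil dvd1n.
move=> /andP[nar ur] /andP[pa pr] H; rewrite big_cons Gauss_dvd.
  rewrite H ?mem_head//= IH// => p pr'; apply: H; by rewrite in_cons pr' orbT.
rewrite big_seq; apply: (big_ind (fun x => coprime a x)).
- exact: coprimen1.
- by move=> x y ax ay; rewrite coprimeMr ax.
- move=> p pr'; rewrite prime_coprime// dvdn_prime2//; last exact: (allP pr).
  by apply: contraNN nar => /eqP ->.
Qed.

(** Increment of Chebyshev's theta function over the half-open interval (a, b], so that increments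
    add up. *)
Definition theta (a b : nat) : R :=
  \sum_(a.+1 <= p < b.+1 | prime p) ln (p%:R : R).

Lemma thetaE a b :
  theta a b = ln (\prod_(p <- [seq p <- index_iota a.+1 b.+1 | prime p]) p)%:R.
Proof.
rewrite ln_prod /theta ?big_filter//.
by apply/allP => p; rewrite mem_filter => /andP[/prime_gt0].
Qed.

Lemma theta_ge0 a b : 0 <= theta a b.
Proof.
apply: sumr_ge0 => p /prime_gt0 p0; apply: ln_ge0; by rewrite ler1n.
Qed.

Lemma theta_cat a b c : (a <= b <= c)%N -> theta a c = theta a b + theta b c.
Proof. by move=> /andP[ab bc]; rewrite /theta -big_cat_nat// ltnS. Qed.

(** The lower half of Stirling's formula; passing from k to k + 1 costs k ln (1 + 1/k) <= 1. *)
Lemma ln_fact_ge k : k%:R * ln (k%:R : R) - k%:R <= ln k`!%:R.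
Proof.
elim: k => [|k IH]; first by rewrite mul0r subr0; apply: ln_ge0; rewrite ler1n fact_gt0.
have [->|k0] := posnP k.
  apply: (@le_trans _ _ 0); last by apply: ln_ge0; rewrite ler1n fact_gt0.
  by rewrite ln1 mulr0; lra.
have kR : 0 < (k%:R : R) by rewrite ltr0n.
rewrite factS natrM lnM ?posrE ?ltr0n ?fact_gt0//.
have : ln (k.+1%:R : R) <= ln k%:R + k%:R^-1.
  have -> : (k.+1%:R : R) = k%:R * (1 + k%:R^-1).
    by rewrite mulrDr mulr1 mulfV ?gt_eqF// natr1.
  rewrite lnM ?posrE// ?lerD2l ?le_ln1Dx//.
  have : 0 < (k%:R : R)^-1 by rewrite invr_gt0.
  by rewrite ?posrE; lra.
rewrite -(ler_pM2l kR) mulrDr mulfV ?gt_eqF// => H.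
rewrite -{1}natr1 mulrDl mul1r -[X in _ - X]natr1.
by move: IH; lra.
Qed.

(** A prime in (n - k, n] divides the falling factorial n (n - 1) ... (n - k + 1) and, exceeding k,
    does not divide k!. The product of these primes thus divides C(n, k) <= n^k / k!, and Stirling
    bounds the latter. The loss is only ln (n / k), which matters for very short intervals. *)
Lemma theta_short n k : (0 < k)%N -> (k.*2 <= n)%N ->
  theta (n - k) n <= k%:R * (1 + ln (n%:R / k%:R)).
Proof.
move=> k0 kn; have n0 : (0 < n)%N by lia.
rewrite thetaE ln_div ?posrE ?ltr0n//.
set P := (\prod_(p <- _) p)%N.
have P0 : (0 < P)%N.
  rewrite /P big_seq prodn_cond_gt0// => p.
  by rewrite mem_filter => /andP[/prime_gt0].
have PC : (P %| 'C(n, k))%N.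
  apply: prod_primes_dvd.
  - by rewrite filter_uniq// iota_uniq.
  - exact: filter_all.
  - move=> p; rewrite mem_filter mem_index_iota => /andP[pp /andP[lp up]].
    suff : (p %| 'C(n, k) * k`!)%N.
      rewrite Euclid_dvdM// => /orP[//|]; rewrite fact_prod.
      rewrite Euclid_dvd_prod//= big_has => /hasP[j].
      rewrite mem_index_iota => /andP[i1 ik] /dvdn_leq; lia.
    rewrite bin_ffact ffact_prod.
    have pk : (n - p < k)%N by lia.
    rewrite (bigD1 (Ordinal pk))//= dvdn_mulr//.
    by rewrite subKn// -ltnS.
have C0 : (0 < 'C(n, k))%N by rewrite bin_gt0; lia.
have PCl : (P <= 'C(n, k))%N by exact: dvdn_leq.
have : ln (P%:R : R) <= ln ('C(n, k)%:R : R).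
  by rewrite ler_ln ?posrE ?ltr0n// ler_nat.
move=> /le_trans; apply.
have := ln_fact_ge k.
have : ln ('C(n, k)%:R : R) + ln k`!%:R <= k%:R * ln n%:R.
  rewrite -lnM ?posrE ?ltr0n ?fact_gt0// -natrM bin_ffact.
  rewrite mulr_natl -lnXn ?ltr0n// -natrX ler_ln ?posrE ?ltr0n ?expn_gt0 ?n0//.
    by rewrite ler_nat ffact_prod -[in leqRHS](card_ord k) -prod_nat_const leq_prod// => i _; exact: leq_subr.
  by rewrite ffact_gt0; lia.
set a := ln _; set b := ln _; set c := ln _; set d := ln k%:R.
lra.
Qed.

Lemma ln_le_sub1 (x : R) : 0 < x -> ln x <= x - 1.
Proof. by move=> x0; have := @le_ln1Dx R (x - 1); rewrite (_ : 1 + (x - 1) = x); [apply; lra | ring]. Qed.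

(** Halving: with k the integer half of n, the interval (n - k, n] contributes at most k (1 + 2),
    since n / k <= 3 and ln 3 <= 2; strong induction does the rest. *)
Lemma theta_le n : theta 0 n <= 3 * n%:R.
Proof.
elim/ltn_ind: n => n IH.
have [n2|n2] := ltnP n 2.
  rewrite /theta big_nat_cond big_pred0 ?mulr_ge0//.
  move=> p; apply/negP => /andP[] /andP[_ pn] /prime_gt1; lia.
pose k := n./2.
have kn : (k.*2 <= n)%N by rewrite /k; lia.
have k0 : (0 < k)%N by rewrite /k; lia.
rewrite (@theta_cat 0 (n - k)%N n) ?leq_subr//.
have := IH (n - k)%N; move=> /(_ ltac:(lia)) H.
have := theta_short k0 kn; move=> H2.
have H3 : (n%:R / k%:R : R) <= 3.
  rewrite ler_pdivrMr ?ltr0n// -natrM ler_nat /k; lia.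
have H4 : ln (n%:R / k%:R : R) <= 2.
  apply: le_trans (ln_le_sub1 _) _; first by rewrite divr_gt0// ltr0n; lia.
  lra.
have : k%:R * (1 + ln (n%:R / k%:R)) <= k%:R * 3 :> R.
  by apply: ler_wpM2l => //; lra.
move: H H2; rewrite natrB; last by lia.
by lra.
Qed.

Lemma exp2_le_bin n : (2 ^ n <= 'C(n.*2, n))%N.
Proof.
elim: n => // n IH; rewrite expnS doubleS.
have E : (n.+1 * 'C(n.*2.+2, n.+1) = 2 * ((n.*2.+1) * 'C(n.*2, n)))%N.
  have e1 := mul_bin_diag n.*2.+2 n.
  have e2 := mul_bin_diag n.*2.+1 n.
  have e3 : 'C(n.*2.+1, n.+1) = 'C(n.*2.+1, n).
    by rewrite -[LHS]bin_sub; [congr binomial; lia | lia].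
  rewrite e3 /= in e2; move: e1 e2 => /= e1 e2; rewrite -e1.
  have -> : n.*2.+2 = (2 * n.+1)%N by lia.
  by rewrite -mulnA -e2 mulnA.
have : (n.+1 * (2 * 2 ^ n) <= n.+1 * 'C(n.*2.+2, n.+1))%N.
  rewrite E mulnCA leq_mul2l /=; apply: leq_mul => //; lia.
by rewrite leq_mul2l.
Qed.

(** By Legendre's formula the exponent is the sum over j of floor (2n / p^j) - 2 floor (n / p^j).
    Each term is 0 or 1, and only the j with p^j <= 2n count. *)
Lemma pfactor_bin_le p n : prime p -> (0 < n)%N ->
  (p ^ logn p 'C(n.*2, n) <= n.*2)%N.
Proof.
move=> pp n0; set C := 'C(n.*2, n).
have C0 : (0 < C)%N by rewrite bin_gt0; lia.
have p1 := prime_gt1 pp.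
pose e := trunc_log p n.*2.
have /andP[e1 e2] : (p ^ e <= n.*2 < p ^ e.+1)%N by apply: trunc_log_bounds => //; lia.
suff : (logn p C <= e)%N by move=> H; rewrite (leq_trans _ e1)// leq_exp2l.
have := bin_fact (leq_addl n n); rewrite addnK addnn -/C => /(congr1 (logn p)).
rewrite !lognM ?fact_gt0 ?muln_gt0 ?C0 ?fact_gt0// !logn_fact//.
have cut (m N : nat) : (e <= N)%N -> (m <= n.*2)%N ->
   (\sum_(1 <= k < N.+1) m %/ p ^ k = \sum_(1 <= k < e.+1) m %/ p ^ k)%N.
  move=> eN mN; rewrite (@big_cat_nat _ _ _ e.+1)//=.
  rewrite [X in (_ + X)%N]big_nat_cond [X in (_ + X)%N]big1 ?addn0// => i /andP[/andP[ei _] _].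
  rewrite divn_small// (leq_ltn_trans mN)// (leq_trans e2)// leq_exp2l//.
have ee : (e <= n.*2)%N by rewrite (leq_trans _ e1)// ltnW// ltn_expl.
rewrite (cut n.*2 n.*2)//.
have en : (\sum_(1 <= k < n.+1) n %/ p ^ k = \sum_(1 <= k < e.+1) n %/ p ^ k)%N.
  have [en|ne] := leqP e n; first by rewrite cut//; lia.
  rewrite [RHS](@big_cat_nat _ _ _ n.+1)//=; last by lia.
  rewrite [X in (_ + X)%N]big_nat_cond [X in (_ + X)%N]big1 ?addn0// => i /andP[/andP[ei _] _].
  by rewrite divn_small// (leq_trans ei)// ltnW// ltn_expl.
rewrite en addnn -muln2 => H.
have : (logn p C + (\sum_(1 <= k < e.+1) n %/ p ^ k) * 2
   <= e + (\sum_(1 <= k < e.+1) n %/ p ^ k) * 2)%N; last by lia.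
rewrite H big_distrl /=.
have E1 : (\sum_(1 <= k < e.+1) 1 = e)%N by rewrite sum_nat_const_nat; lia.
rewrite -[X in (_ <= X + _)%N]E1.
rewrite -big_split /=; apply: leq_sum => k _.
have pk0 : (0 < p ^ k)%N by rewrite expn_gt0 prime_gt0.
rewrite -ltnS ltn_divLR//.
have := ltn_ceil n pk0; nia.
Qed.

End Theta.

(** * Two-sided bounds over windows (64^k, 64^(k+1)] and over blocks of windows *)

Section Chebyshev.
Variable R : realType.
Local Notation theta := (theta R).

Lemma ln2_ge : 1 / 2 <= ln (2 : R).
Proof.
have := @ln_le_sub1 R (2^-1) ltac:(lra).
rewrite lnV ?posrE//; lra.
Qed.

Lemma isqrt_exists m : exists s, (s ^ 2 <= m < s.+1 ^ 2)%N.
Proof.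
elim: m => [|m [s /andP[s1 s2]]]; first by exists 0%N.
have [H|H] := ltnP m.+1 (s.+1 ^ 2); first by exists s; rewrite H; lia.
by exists s.+1; rewrite H/=; nia.
Qed.

Lemma ln_bin_le n : (0 < n)%N ->
  ln ('C(n.*2, n)%:R : R) <= \sum_(1 <= p < n.*2.+1 | prime p) ln (n.*2%:R : R).
Proof.
move=> n0; set C := 'C(n.*2, n).
have C0 : (0 < C)%N by rewrite bin_gt0; lia.
pose m := (C + n.*2)%N.
have CE : C = (\prod_(1 <= p < n.*2.+1 | prime p) p ^ logn p C)%N.
  rewrite -[LHS]partnT// (@widen_partn m)// ?leq_addr//.
  rewrite big_ltn// ?logn0 /= lognE/= mul1n.
  rewrite [LHS](@big_cat_nat _ _ _ n.*2.+1)//=; last by rewrite /m; lia.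
  rewrite [X in (_ * X)%N]big_nat_cond [X in (_ * X)%N]big1 ?muln1.
    rewrite [RHS]big_mkcond/=; apply: eq_bigr => p _.
    by case: ifPn => // np; rewrite lognE (negbTE np).
  move=> p /andP[/andP[np _] _].
  have [pp|pp] := boolP (prime p); last by rewrite lognE (negbTE pp).
  have [->//|l0] := posnP (logn p C).
  have := pfactor_bin_le pp n0; rewrite -/C => H.
  have : (p ^ 1 <= p ^ logn p C)%N by rewrite leq_exp2l// prime_gt1.
  by rewrite expn1; lia.
rewrite {1}CE; elim/big_rec2: _ => [|p y x pp H]; first by rewrite ln1.
have l0 : 0 <= ln (n.*2%:R : R) by rewrite ln_ge0// ler1n; lia.
have [x00|x0] := posnP x.
  by move: H; rewrite x00 muln0; lra.
have pl : (0 < p ^ logn p C)%N by rewrite expn_gt0 prime_gt0.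
rewrite natrM lnM ?posrE ?ltr0n// lerD// ler_ln ?posrE ?ltr0n//; last by lia.
by rewrite ler_nat; exact: pfactor_bin_le.
Qed.

(** Here s is about (2n)^(1/2) and t about (2n)^(1/4). In ln C(2n, n) >= n / 2, primes up to s cost
    at most s ln (2n), while a prime p > s has ln (2n) <= 2 ln p and is paid by 2 theta. Since ln
    (2n) <= 4 t, the first cost is at most n / 4 once 16 s t <= n, which t >= 32 guarantees. *)
Lemma theta_lower n : (32 ^ 4 <= n.*2)%N -> n%:R / 8 <= theta 0 n.*2.
Proof.
move=> n32.
have n0 : (0 < n)%N by case: n n32 => //; rewrite leqNgt expn_gt0.
have [s /andP[s1 s2]] := isqrt_exists n.*2.
have [t /andP[t1 t2]] := isqrt_exists s.
have t32 : (32 <= t)%N.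
  rewrite leqNgt; apply/negP => t32.
  have : (s.+1 <= 32 ^ 2)%N by rewrite (leq_trans t2)// leq_exp2r.
  rewrite -(@leq_exp2r _ _ 2)// -expnM => H.
  by move: (leq_trans s2 H); rewrite ltnNge n32.
have H1 : n%:R * ln 2 <= ln ('C(n.*2, n)%:R : R).
  rewrite mulr_natl -lnXn// -natrX ler_ln ?posrE ?ltr0n ?expn_gt0//.
    by rewrite ler_nat exp2_le_bin.
  by rewrite bin_gt0; lia.
have H2 := ln_bin_le n0.
have l2n0 : 0 <= ln (n.*2%:R : R) by rewrite ln_ge0// ler1n; lia.
have H3 : \sum_(1 <= p < n.*2.+1 | prime p) ln (n.*2%:R : R)
    <= s%:R * ln (n.*2%:R : R) + 2 * theta 0 n.*2.
  have -> : s%:R * ln (n.*2%:R : R) = \sum_(1 <= p < s.+1) ln (n.*2%:R : R).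
    by rewrite sumr_const_nat subSS subn0 mulr_natl.
  have sn : (s <= n.*2)%N by nia.
  rewrite /theta mulr_sumr.
  rewrite (@big_cat_nat _ _ _ s.+1)//= [X in _ <= _ + X](@big_cat_nat _ _ _ s.+1)//= addrA lerD//.
    rewrite -[leLHS]addr0 lerD//.
      rewrite [leLHS]big_mkcond /=; apply: ler_sum => p _; by case: ifP.
    by apply: sumr_ge0 => p pp; rewrite mulr_ge0// ln_ge0// ler1n prime_gt0.
  rewrite big_nat_cond [leRHS]big_nat_cond; apply: ler_sum => p /andP[/andP[sp _] pp].
  have p0 := prime_gt0 pp.
  rewrite mulr_natl -lnXn ?ltr0n// -natrX ler_ln ?posrE ?ltr0n ?expn_gt0 ?p0//; last by lia.
  by rewrite ler_nat; apply: ltnW; rewrite (leq_trans s2)// leq_exp2r.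
have H4 : ln (n.*2%:R : R) <= 4 * t%:R.
  have tR : (0 : R) < t.+1%:R by rewrite ltr0n.
  have : ln (n.*2%:R : R) <= ln (t.+1%:R ^+ 4).
    rewrite ler_ln ?posrE ?exprn_gt0// ?ltr0n; last by lia.
    rewrite -natrX ler_nat; apply: ltnW; rewrite (leq_trans s2)//.
    by rewrite -[4%N]/(2 * 2)%N expnM leq_exp2r.
  move=> /le_trans; apply; rewrite lnXn// -[leLHS]mulr_natl; apply: ler_wpM2l => //.
  by apply: le_trans (ln_le_sub1 tR) _; rewrite -natr1 addrK.
have H5 : s%:R * ln (n.*2%:R : R) <= n%:R / 4.
  apply: (@le_trans _ _ (s%:R * (4 * t%:R))); first exact: ler_wpM2l.
  have : (16 * s * t <= n)%N by nia.
  by rewrite -(ler_nat R) !natrM; lra.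
have := ln2_ge => H6.
have : n%:R * (1 / 2) <= n%:R * ln 2 :> R by apply: ler_wpM2l.
lra.
Qed.

(** The ratio 64 makes the lower bound 32 y / 8 = 4 y at 64 y beat the upper bound 3 y at y. *)
Lemma theta_window y : (32 ^ 4 <= y)%N -> y%:R <= theta y (64 * y).
Proof.
move=> y0; have := @theta_lower (32 * y)%N.
have -> : (32 * y).*2 = (64 * y)%N by lia.
move=> /(_ ltac:(lia)); rewrite (@theta_cat R 0 y); last by lia.
have := theta_le R y; rewrite natrM; lra.
Qed.

Definition psum (a b : nat) : R :=
  \sum_(a.+1 <= p < b.+1 | prime p) (p%:R * ln (p%:R : R))^-1.

Lemma psum_cat a b c : (a <= b <= c)%N -> psum a c = psum a b + psum b c.
Proof. by move=> /andP[ab bc]; rewrite /psum -big_cat_nat// ltnS. Qed.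

Lemma psum_ge0 a b : 0 <= psum a b.
Proof.
apply: sumr_ge0 => p /prime_gt0 p0.
by rewrite invr_ge0 mulr_ge0// ln_ge0// ler1n.
Qed.

Definition L64 : R := ln 64.

Lemma L64_gt0 : 0 < L64. Proof. by apply: ln_gt0; rewrite ltr1n. Qed.

Lemma ln_pow64 k : ln ((64 ^ k)%:R : R) = k%:R * L64.
Proof. by rewrite natrX lnXn ?ltr0n// mulr_natl. Qed.

Lemma ln_window p k : (64 ^ k < p <= 64 ^ k.+1)%N ->
  k%:R * L64 <= ln (p%:R : R) <= k.+1%:R * L64.
Proof.
move=> /andP[p1 p2]; have p0 : (0 < p)%N by lia.
by rewrite -!ln_pow64 !ler_ln ?posrE ?ltr0n ?expn_gt0 ?ler_nat// (ltnW p1).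
Qed.

(** The weight 1 / (p ln p) is ln p divided by p (ln p)^2, and that divisor varies by a bounded
    factor over a window, so bounds for [theta] carry over; 192 is 3 times 64. *)
Lemma psum_window_le k : (0 < k)%N ->
  psum (64 ^ k) (64 ^ k.+1) <= 192 / L64 ^+ 2 / k%:R ^+ 2.
Proof.
move=> k0; have L0 := L64_gt0; have kR : (0 : R) < k%:R by rewrite ltr0n.
have yR : (0 : R) < (64 ^ k)%:R by rewrite ltr0n expn_gt0.
have X0 : 0 < (64 ^ k)%:R * (k%:R * L64) ^+ 2 by rewrite mulr_gt0// exprn_gt0// mulr_gt0.
apply: (@le_trans _ _ (theta (64 ^ k) (64 ^ k.+1) / ((64 ^ k)%:R * (k%:R * L64) ^+ 2))).
  rewrite /psum /theta mulr_suml big_nat_cond [leRHS]big_nat_cond.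
  apply: ler_sum => p /andP[/andP[p1 p2] pp].
  have /andP[l1 l2] := @ln_window p k ltac:(lia).
  have kL : 0 < k%:R * L64 by rewrite mulr_gt0.
  have lp : 0 < ln (p%:R : R) by lra.
  have pR : (0 : R) < p%:R by rewrite ltr0n prime_gt0.
  have yp : (64 ^ k)%:R <= p%:R :> R by rewrite ler_nat ltnW.
  rewrite ler_pdivlMr// mulrC ler_pdivrMr ?mulr_gt0//.
  have -> : ln p%:R * (p%:R * ln p%:R) = p%:R * ln p%:R ^+ 2 :> R by ring.
  apply: ler_pM => //; first by rewrite exprn_ge0 ?ltW// ?mulr_gt0.
  by rewrite ler_sqr ?nnegrE// ltW.
have : theta (64 ^ k) (64 ^ k.+1) <= 3 * (64 * (64 ^ k)%:R).
  have := theta_le R (64 ^ k.+1); rewrite (@theta_cat R 0 (64 ^ k)%N); last first.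
    by rewrite leq0n leq_exp2l /=.
  have := theta_ge0 R 0 (64 ^ k); rewrite {2}expnS natrM; lra.
move=> H; apply: (@le_trans _ _ (3 * (64 * (64 ^ k)%:R) / ((64 ^ k)%:R * (k%:R * L64) ^+ 2))).
  by apply: ler_wpM2r => //; rewrite invr_ge0 ltW.
by apply: le_of_eq; field; rewrite !gt_eqF.
Qed.

Lemma psum_window_ge k : (4 <= k)%N ->
  (64 * L64 ^+ 2)^-1 / k.+1%:R ^+ 2 <= psum (64 ^ k) (64 ^ k.+1).
Proof.
move=> k0; have L0 := L64_gt0; have kR : (0 : R) < k.+1%:R by rewrite ltr0n.
have yR : (0 : R) < (64 ^ k)%:R by rewrite ltr0n expn_gt0.
have y1R : (0 : R) < (64 ^ k.+1)%:R by rewrite ltr0n expn_gt0.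
have X0 : 0 < (64 ^ k.+1)%:R * (k.+1%:R * L64) ^+ 2 by rewrite mulr_gt0// exprn_gt0// mulr_gt0.
apply: (@le_trans _ _ (theta (64 ^ k) (64 ^ k.+1) / ((64 ^ k.+1)%:R * (k.+1%:R * L64) ^+ 2))); last first.
  rewrite /psum /theta mulr_suml big_nat_cond [leRHS]big_nat_cond.
  apply: ler_sum => p /andP[/andP[p1 p2] pp].
  have /andP[l1 l2] := @ln_window p k ltac:(lia).
  have lp : 0 < ln (p%:R : R) by apply: ln_gt0; rewrite ltr1n prime_gt1.
  have pR : (0 : R) < p%:R by rewrite ltr0n prime_gt0.
  have yp : p%:R <= (64 ^ k.+1)%:R :> R by rewrite ler_nat -ltnS.
  rewrite ler_pdivrMr// mulrC ler_pdivlMr ?mulr_gt0//.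
  have -> : ln p%:R * (p%:R * ln p%:R) = p%:R * ln p%:R ^+ 2 :> R by ring.
  apply: ler_pM => //; first by rewrite exprn_ge0 ?ltW// ?mulr_gt0.
  have kL : 0 < k.+1%:R * L64 by rewrite mulr_gt0.
  by rewrite ler_sqr ?nnegrE//; lra.
have : (64 ^ k)%:R <= theta (64 ^ k) (64 ^ k.+1).
  rewrite expnS; apply: theta_window.
  have h1 : (32 ^ 4 <= 64 ^ 4)%N by rewrite leq_exp2r.
  have h2 : (64 ^ 4 <= 64 ^ k)%N by rewrite leq_exp2l.
  exact: leq_trans h1 h2.
move=> H; apply: (@le_trans _ _ ((64 ^ k)%:R / ((64 ^ k.+1)%:R * (k.+1%:R * L64) ^+ 2))); last first.
  by apply: ler_wpM2r => //; rewrite invr_ge0 ltW.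
apply: le_of_eq; rewrite [in RHS]expnS natrM; field.
by rewrite !gt_eqF.
Qed.

Lemma psum_blockE A m : (0 < A)%N -> psum (64 ^ (A ^ m)) (64 ^ (A ^ m.+1)) =
  \sum_(A ^ m <= k < A ^ m.+1) psum (64 ^ k) (64 ^ k.+1).
Proof.
move=> A0; have : (A ^ m <= A ^ m.+1)%N by rewrite expnS leq_pmull.
move: (A ^ m)%N (A ^ m.+1)%N => a b.
elim: b => [|b IH]; rewrite ?leqn0 => ab.
  by rewrite (eqP ab) /psum !big_geq.
move: ab; rewrite leq_eqVlt => /predU1P[<-|]; first by rewrite /psum !big_geq.
rewrite ltnS => ab; rewrite big_nat_recr//= -IH// -psum_cat// !leq_exp2l//=.
by rewrite ab/=.
Qed.

(** Block m consists of A^m (A - 1) windows, each contributing about A^(-2m). From m = 2 on, its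
    windows have index at least 4, where [psum_window_ge] applies. *)
Lemma psum_block_bounds A : (1 < A)%N -> exists c C : R, [/\ 0 < c, 0 < C &
  forall m, (2 <= m)%N ->
   c / A%:R ^+ m <= psum (64 ^ (A ^ m)) (64 ^ (A ^ m.+1)) <= C / A%:R ^+ m].
Proof.
move=> A1; have L0 := L64_gt0.
have AR : (1 : R) < A%:R by rewrite ltr1n.
exists ((64 * L64 ^+ 2)^-1 * (A%:R - 1) / A%:R ^+ 2).
exists (192 / L64 ^+ 2 * (A%:R - 1)); split.
- by rewrite divr_gt0 ?exprn_gt0 ?mulr_gt0 ?invr_gt0 ?mulr_gt0 ?exprn_gt0 //; lra.
- by rewrite mulr_gt0 ?divr_gt0 ?exprn_gt0 //; lra.
move=> m m1; have A0 : (0 < A)%N by lia.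
have AmR : (0 : R) < A%:R ^+ m by rewrite exprn_gt0//; lra.
have num : (A ^ m.+1 - A ^ m)%:R = A%:R ^+ m * (A%:R - 1) :> R.
  by rewrite natrB ?leq_exp2l// !natrX exprS; ring.
have cst (x : R) : \sum_(A ^ m <= k < A ^ m.+1) x = x * (A%:R ^+ m * (A%:R - 1)).
  by rewrite sumr_const_nat -num mulr_natr.
have Am4 : (4 <= A ^ m)%N.
  apply: (@leq_trans (2 ^ 2)) => //; apply: (@leq_trans (A ^ 2)); first by rewrite leq_exp2r.
  by rewrite leq_exp2l.
rewrite psum_blockE//; apply/andP; split.
  apply: (@le_trans _ _ (\sum_(A ^ m <= k < A ^ m.+1) (64 * L64 ^+ 2)^-1 / (A%:R ^+ m.+1) ^+ 2)).
    rewrite cst; apply: le_of_eq; rewrite (exprS _ m); field.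
    by rewrite !gt_eqF//; lra.
  rewrite big_nat_cond [leRHS]big_nat_cond; apply: ler_sum => k /andP[/andP[k1 k2] _].
  apply: le_trans (psum_window_ge _); last by lia.
  apply: ler_wpM2l; first by rewrite invr_ge0 mulr_ge0// exprn_ge0// ltW.
  rewrite lef_pV2 ?posrE ?exprn_gt0 ?ltr0n//.
  by rewrite ler_sqr ?nnegrE ?exprn_ge0// -natrX ler_nat.
apply: (@le_trans _ _ (\sum_(A ^ m <= k < A ^ m.+1) 192 / L64 ^+ 2 / (A%:R ^+ m) ^+ 2)); last first.
  by rewrite cst; apply: le_of_eq; field; rewrite !gt_eqF.
rewrite big_nat_cond [leRHS]big_nat_cond; apply: ler_sum => k /andP[/andP[k1 k2] _].
apply: le_trans (psum_window_le _) _; first by lia.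
apply: ler_wpM2l; first by rewrite divr_ge0// exprn_ge0// ltW.
rewrite lef_pV2 ?posrE ?exprn_gt0 ?ltr0n//; last by lia.
by rewrite ler_sqr ?nnegrE ?exprn_ge0// -natrX ler_nat.
Qed.

End Chebyshev.

(** * A weighted maximum principle *)

Section MaxPrinciple.
Variable R : realType.
Implicit Types (P Q : {poly R[i]}) (r C : R).

Lemma cis_neq1 (x : R) : 0 < x < pi *+ 2 -> cis x != 1.
Proof.
move=> /andP[x0 x2]; apply/negP => /eqP; rewrite /cis => -[c1 _].
have s0 : 0 < sin (x / 2) by apply: sin_gt0_pi; move: x2; rewrite mulr2n; lra.
have xx : x = (x / 2) *+ 2 by rewrite mulr2n; field.
move: c1; rewrite {1}xx cos_mulr2n cos2sin2 mulr2n => c1.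
have := exprn_gt0 2 s0; lra.
Qed.

Lemma cis2pi : cis (pi *+ 2 : R) = 1.
Proof. by rewrite /cis cos2pi sin2pi. Qed.

Lemma root_unity_sum (N i j : nat) : (i < N)%N -> (j < N)%N ->
  \sum_(k < N) cis (pi *+ 2 / N%:R * k%:R : R) ^+ i * cis (- (pi *+ 2 / N%:R * k%:R)) ^+ j
  = (if i == j then N%:R else 0).
Proof.
move=> iN jN; have N0 : (0 : R) < N%:R by rewrite ltr0n; lia.
have [<-|ij] := eqVneq.
  rewrite (eq_bigr (fun=> 1)) ?sumr_const ?card_ord// => k _.
  by rewrite -exprMn -cisD addrN cis0 expr1n.
pose w : R[i] := cis (pi *+ 2 / N%:R * (i%:R - j%:R)).
rewrite (eq_bigr (fun k : 'I_N => w ^+ k)); last first.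
  by move=> k _; rewrite !cisX -cisD; congr cis; ring.
have wN : w ^+ N = 1.
  rewrite cisX; have -> : N%:R * (pi *+ 2 / N%:R * (i%:R - j%:R)) = (i%:R - j%:R) * pi *+ 2 :> R.
    by rewrite !mulr2n; field; rewrite gt_eqF.
  rewrite -mulrnAr mulrBl cisD -cisX cis2pi expr1n mul1r -conj_cis -cisX cis2pi expr1n.
  exact: conjc1.
have key (a b : nat) : (a < N)%N -> (b < a)%N ->
    cis (pi *+ 2 / N%:R * (a%:R - b%:R) : R) != 1.
  move=> aN ba; apply: cis_neq1.
  have abR : (0 : R) < a%:R - b%:R by rewrite subr_gt0 ltr_nat.
  have pi0 : (0 : R) < pi *+ 2 by rewrite mulr2n addr_gt0 ?pi_gt0.
  rewrite mulr_gt0 ?divr_gt0//= mulrAC ltr_pdivrMr// ltr_pM2l//.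
  have : (a%:R : R) < N%:R by rewrite ltr_nat.
  have : (0 : R) <= b%:R by [].
  lra.
have w1 : w != 1.
  have [ji|ji|/eqP] := ltngtP j i; [exact: key | | by rewrite eq_sym (negbTE ij)].
  have := key j i jN ji; apply: contraNN => /eqP w1.
  have -> : cis (pi *+ 2 / N%:R * (j%:R - i%:R)) = w^*.
    by rewrite conj_cis; congr cis; ring.
  by rewrite w1 conjc1.
apply/eqP; have := subrX1 w N; rewrite wN subrr => /esym/eqP.
by rewrite mulf_eq0 subr_eq0 (negbTE w1).
Qed.

(** Cauchy's estimate by discrete Fourier inversion: all exponents are below N = [size P], so
    averaging over the N-th roots of unity isolates one coefficient exactly. *)
Lemma coef_le_sup P C i : (forall t : R, normc P.[cis t] <= C) -> normc P`_i <= C.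
Proof.
move=> PC; have C0 : 0 <= C by rewrite (le_trans _ (PC 0))// normc_ge0.
have [iP|iP] := ltnP i (size P); last by rewrite nth_default// normc0.
set N := size P in iP *; have N0 : (0 : R) < N%:R by rewrite ltr0n; lia.
pose z (k : nat) : R := pi *+ 2 / N%:R * k%:R.
have E : P`_i * N%:R = \sum_(k < N) P.[cis (z k)] * cis (- z k) ^+ i.
  under eq_bigr do rewrite horner_coef mulr_suml.
  rewrite exchange_big /= -/N (bigD1 (Ordinal iP))//= [X in _ + X]big1 ?addr0.
    under eq_bigr do rewrite -mulrA.
    by rewrite -mulr_sumr root_unity_sum// eqxx.
  move=> j ji; under eq_bigr do rewrite -mulrA.
  rewrite -mulr_sumr root_unity_sum//; case: eqP => [ji'|]; last by rewrite mulr0.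
  by move: ji; rewrite -val_eqE /= ji' eqxx.
have := congr1 (@normc R) E; rewrite normcM.
have -> : normc (N%:R : R[i]) = N%:R.
  by rewrite -[N%:R]mulr1n -(rmorph_nat (real_complex R)) normc_real ger0_norm.
move=> H; rewrite -(ler_pM2r N0) H (le_trans (normc_sum _ _ _))//.
rewrite (@le_trans _ _ (\sum_(k < N) C))//; last by rewrite sumr_const card_ord mulr_natr.
apply: ler_sum => k _; rewrite normcM normcX normc_cis expr1n mulr1; exact: PC.
Qed.

Lemma bernoulli_le (x : R) n : 0 <= x -> 1 + n%:R * x <= (1 + x) ^+ n.
Proof.
move=> x0; elim: n => [|n IH]; first by rewrite expr0 mul0r addr0.
have n0 : (0 : R) <= n%:R by [].
rewrite exprS -natr1; apply: (@le_trans _ _ ((1 + x) * (1 + n%:R * x))).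
  have := mulr_ge0 n0 (mulr_ge0 x0 x0); lra.
by apply: ler_wpM2l => //; lra.
Qed.

(** Power trick: a factor independent of k disappears under k-th roots; by Bernoulli (x / y)^k would
    otherwise be unbounded. *)
Lemma le_of_pow_le (x y M : R) : 0 <= x -> 0 <= y ->
  (forall k, x ^+ k <= y ^+ k * M) -> x <= y.
Proof.
move=> x0 y0 H; rewrite leNgt; apply/negP => yx.
have [y00|y1] := eqVneq y 0.
  by have := H 1%N; rewrite y00 !expr1 mul0r; lra.
have yp : 0 < y by rewrite lt_def y1.
pose d := x / y - 1.
have d0 : 0 < d by rewrite subr_gt0 ltr_pdivlMr// mul1r.
have xE : x = y * (1 + d) by rewrite /d; field.
have M0 : 0 <= M by have := H 0%N; rewrite !expr0; lra.
pose k := (Num.truncn (M / d)).+1.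
have kd : M < k%:R * d by rewrite -ltr_pdivrMr// truncnS_gt.
have := H k; rewrite xE exprMn ler_pM2l ?exprn_gt0//.
have := @bernoulli_le d k (ltW d0); lra.
Qed.

(** The coefficient estimate for P^k gives |P(r)|^k <= C^k / (1 - r), and the power trick removes
    the factor 1 / (1 - r). *)
Lemma poly_max P C r : 0 <= r < 1 -> (forall t : R, normc P.[cis t] <= C) ->
  normc P.[r%:C] <= C.
Proof.
move=> /andP[r0 r1] PC.
have C0 : 0 <= C by rewrite (le_trans _ (PC 0))// normc_ge0.
apply: (@le_of_pow_le _ _ (1 - r)^-1); rewrite ?normc_ge0// => k.
rewrite -normcX -horner_exp horner_coef (le_trans (normc_sum _ _ _))//.
apply: (@le_trans _ _ (\sum_(i < size (P ^+ k)) C ^+ k * r ^+ i)).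
  apply: ler_sum => i _; rewrite normcM normcX normc_real ger0_norm//.
  apply: ler_wpM2r; first exact: exprn_ge0.
  apply: coef_le_sup => t; rewrite horner_exp normcX; apply: lerXn2r => //.
  by rewrite nnegrE normc_ge0.
rewrite -mulr_sumr; apply: ler_wpM2l; first exact: exprn_ge0.
have r1' : 0 < 1 - r by lra.
rewrite -(ler_pM2l r1') mulfV ?gt_eqF//.
have := subrX1 r (size (P ^+ k)) => E.
have : (1 - r) * \sum_(i < size (P ^+ k)) r ^+ i = 1 - r ^+ (size (P ^+ k)).
  by rewrite -[1 - r]opprB mulNr -E opprB.
by move=> ->; rewrite gerBl exprn_ge0.
Qed.

Lemma lim_pow_le (x y a b : R) : 0 <= a < 1 -> 0 <= b < 1 ->
  (forall k, x * (1 - a ^+ k) <= y * (1 + b ^+ k)) -> x <= y.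
Proof.
move=> /andP[a0 a1] /andP[b0 b1] H.
have ca : a ^+ k @[k --> \oo] --> 0 by apply: cvg_expr; rewrite ger0_norm.
have cb : b ^+ k @[k --> \oo] --> 0 by apply: cvg_expr; rewrite ger0_norm.
have cx : x * (1 - a ^+ k) @[k --> \oo] --> x.
  rewrite -[X in _ --> X]mulr1 -[X in _ * X](subr0 1).
  by apply: cvgMr; apply: cvgB => //; exact: cvg_cst.
have cy : y * (1 + b ^+ k) @[k --> \oo] --> y.
  rewrite -[X in _ --> X]mulr1 -[X in _ * X](addr0 1).
  by apply: cvgMr; apply: cvgD => //; exact: cvg_cst.
rewrite -(cvg_lim _ cx)// -(cvg_lim _ cy)//; apply: ler_lim.
- by apply/cvg_ex; exists x.
- by apply/cvg_ex; exists y.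
- by near=> k; exact: H.
Unshelve. all: by end_near. Qed.

(* Up to the factor 1 + k this is 1 - rho u with rho = k / (1 + k) < 1, so it
   has no zero in the closed unit disc. *)
Definition mfac (k : R) (u : R[i]) : R[i] := 1 + k%:C * (1 - u).

Lemma mfac_real k r : mfac k r%:C = (1 + k * (1 - r))%:C.
Proof. by rewrite /mfac rmorphD rmorphM rmorphB rmorph1. Qed.

(** Maximum principle for the quotient of P by the factors [mfac k]. One factor at a time is
    inverted by a truncated geometric series S K, so that only polynomials occur: [mfac a u] times S
    K is (1 + a) (1 - (rho u)^K), and the error dies out as K grows. *)
Lemma poly_max_div (s : seq R) P C r : 0 <= r < 1 -> (forall k, k \in s -> 0 <= k) ->
  (forall t : R, normc P.[cis t] <= C * \prod_(k <- s) normc (mfac k (cis t))) ->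
  normc P.[r%:C] <= C * \prod_(k <- s) (1 + k * (1 - r)).
Proof.
move=> r01; have /andP[r0 r1] := r01; elim: s P C => [|a s IH] P C s0 H.
  by rewrite big_nil mulr1; apply: poly_max => // t; have := H t; rewrite big_nil mulr1.
have a0 : 0 <= a by apply: s0; rewrite mem_head.
have s0' k : k \in s -> 0 <= k by move=> ks; apply: s0; rewrite in_cons ks orbT.
pose rho := a / (1 + a).
have a1 : 0 < 1 + a by lra.
have rho0 : 0 <= rho by rewrite divr_ge0// ltW.
have rho1 : rho < 1 by rewrite ltr_pdivrMr//; lra.
pose S K : {poly R[i]} := \sum_(i < K) (rho%:C *: 'X) ^+ i.
have SE K u : mfac a u * (S K).[u] = (1 + a)%:C * (1 - (rho%:C * u) ^+ K).
  rewrite horner_sum; under eq_bigr do rewrite horner_exp hornerZ hornerX.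
  have -> : mfac a u = (1 + a)%:C * (1 - rho%:C * u).
    have E : (1 + a) * rho = a by rewrite /rho mulrCA mulfV ?gt_eqF// mulr1.
    by rewrite [in RHS]mulrBr mulr1 mulrA -rmorphM /= E rmorphD rmorph1 /mfac; ring.
  rewrite -mulrA; congr (_ * _).
  by rewrite -[1 - _ * u]opprB mulNr -subrX1 opprB.
have pr : 0 <= \prod_(k <- s) (1 + k * (1 - r)).
  rewrite big_seq; apply: prodr_ge0 => k /s0' k0.
  by rewrite addr_ge0// mulr_ge0//; lra.
have rr : 0 < 1 - rho * r by have := ler_wpM2l rho0 (ltW r1); lra.
have rr0 : 0 <= rho * r by exact: mulr_ge0.
apply: (@lim_pow_le _ _ (rho * r) rho).
- by rewrite rr0; lra.
- by rewrite rho0.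
move=> K.
have := IH (P * S K) (C * (1 + a) * (1 + rho ^+ K)) s0' _.
have Hb (t : R) : normc (P * S K).[cis t] <= C * (1 + a) * (1 + rho ^+ K) * \prod_(k <- s) normc (mfac k (cis t)).
  rewrite hornerM normcM.
  have := H t; rewrite big_cons => Ht.
  apply: le_trans (ler_wpM2r (normc_ge0 _) Ht) _.
  set pi_s := \prod_(k <- s) _.
  have -> : C * (normc (mfac a (cis t)) * pi_s) * normc (S K).[cis t]
     = C * ((normc (mfac a (cis t)) * normc (S K).[cis t]) * pi_s) by ring.
  rewrite -normcM SE normcM normc_real ger0_norm; last exact: ltW.
  rewrite -!mulrA; have C0 : 0 <= C.
    have := le_trans (normc_ge0 _) (H 0).
    rewrite pmulr_lge0 // big_seq prodr_gt0// => k /s0 k0.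
    by rewrite cis0 /mfac subrr mulr0 addr0 normc1.
  apply: ler_wpM2l => //; apply: ler_wpM2l; first exact: ltW.
  apply: ler_wpM2r; first by rewrite /pi_s prodr_ge0// => k _; exact: normc_ge0.
  rewrite (le_trans (le_normcD _ _))// normc1 normcN normcX normcM normc_real normc_cis.
  by rewrite mulr1 ger0_norm.
move=> /(_ Hb); rewrite hornerM normcM => H1.
have m0 : 0 <= 1 + a * (1 - r) by rewrite addr_ge0// mulr_ge0//; lra.
have := ler_wpM2l m0 H1.
have -> : (1 + a * (1 - r)) * (normc P.[r%:C] * normc (S K).[r%:C]) =
    (1 + a) * (normc P.[r%:C] * (1 - (rho * r) ^+ K)).
  have := congr1 (@normc R) (SE K r%:C).
  rewrite mfac_real !normcM !normc_real -rmorphM -rmorphXn -(rmorph1 (real_complex R)) -rmorphB normc_real.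
  rewrite !ger0_norm//; [|by rewrite subr_ge0 exprn_ile1//; lra|lra].
  by move=> E; rewrite mulrCA E; ring.
rewrite big_cons => H2; rewrite -(ler_pM2l a1) (le_trans H2)//.
by apply: le_of_eq; ring.
Qed.

End MaxPrinciple.

(** * Weights that are at most 1 away from one scale and gain near the point 1 *)

Section Multiplier.
Variable R : realType.
Implicit Types (P : R) (t k : R).

Lemma normc_mfac k t : normc (mfac k (cis t)) ^+ 2 = 1 + k * (1 + k) * (2 - 2 * cos t).
Proof.
rewrite normcE_sqr /mfac /cis; simpc => /=.
rewrite ?(oppr0, addr0, subr0, mul0r, add0r, mulrN).
have := cos2Dsin2 t => E.
have -> : (- (k * sin t)) ^+ 2 = k ^+ 2 * (1 - cos t ^+ 2) by rewrite -E; ring.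
ring.
Qed.

(* The exponents make tmul k t at most 1 both for small t (8 * 2^2 < 2 * 4^2 + 7)
   and for large k t (8 < 2 + 7), whereas the same quotient of the factors
   1 + k (1 - r) exceeds 1 for r slightly below 1 (8 * 2 > 2 * 4 + 7). *)
Definition tmul k t : R :=
  normc (mfac (2 * k) (cis t)) ^+ 8 /
   (normc (mfac (4 * k) (cis t)) ^+ 2 * normc (mfac k (cis t)) ^+ 7).

Lemma normc_mfac_gt0 k t : 0 <= k -> 0 < normc (mfac k (cis t)).
Proof.
move=> k0; rewrite lt_def normc_ge0 andbT; apply/eqP => E.
have := normc_mfac k t; rewrite E expr0n /=.
have := cos_le1 t => c1.
have : 0 <= k * (1 + k) * (2 - 2 * cos t) by rewrite !mulr_ge0//; lra.
lra.
Qed.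

Lemma tmul_ge0 k t : 0 <= tmul k t.
Proof. by rewrite divr_ge0 ?mulr_ge0 ?exprn_ge0 ?normc_ge0. Qed.

(** In terms of P = k (1 + k) |1 - cis t|^2 the squared moduli of the factors for 2k, 4k and k are
    at most 1 + 4P, at least 1 + 15P, and exactly 1 + P. The second bound amounts to 4k + 16k^2 >=
    15 (k + k^2), that is k >= 11. *)
Lemma bump_ineq P C : 0 <= P -> (1 + 4 * P) ^+ 8 <= C * ((1 + 15 * P) ^+ 2 * (1 + P) ^+ 7) ->
  forall k t, 11 <= k -> P = k * (1 + k) * (2 - 2 * cos t) -> tmul k t ^+ 2 <= C.
Proof.
move=> P0 H k t k11 PE; have k0 : 0 <= k by lra.
have a0 := normc_mfac_gt0 t k0.
have b0 : 0 < normc (mfac (2 * k) (cis t)) by apply: normc_mfac_gt0; lra.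
have d0 : 0 < normc (mfac (4 * k) (cis t)) by apply: normc_mfac_gt0; lra.
rewrite /tmul expr_div_n ler_pdivrMr; last by rewrite exprn_gt0// mulr_gt0// exprn_gt0.
rewrite (exprAC _ 8 2) [X in C * X]exprMn (exprAC _ 2 2) (exprAC _ 7 2).
rewrite !normc_mfac -PE.
have c1 := cos_le1 t.
have S0 : 0 <= 2 - 2 * cos t by lra.
have kS : 0 <= k * (2 - 2 * cos t) by apply: mulr_ge0.
have kkS : 11 * (k * (2 - 2 * cos t)) <= k * (k * (2 - 2 * cos t)) by apply: ler_wpM2r.
have e1 : 2 * k * (1 + 2 * k) * (2 - 2 * cos t) <= 4 * P by rewrite PE; lra.
have e1' : 0 <= 2 * k * (1 + 2 * k) * (2 - 2 * cos t) by rewrite !mulr_ge0//; lra.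
have e2 : 15 * P <= 4 * k * (1 + 4 * k) * (2 - 2 * cos t) by rewrite PE; lra.
have C0 : 0 <= C.
  have : 0 < C * ((1 + 15 * P) ^+ 2 * (1 + P) ^+ 7).
    by rewrite (lt_le_trans _ H)// exprn_gt0//; lra.
  rewrite pmulr_lgt0 => [/ltW//|]; by rewrite mulr_gt0// exprn_gt0//; lra.
apply: (@le_trans _ _ ((1 + 4 * P) ^+ 8)).
  by apply: lerXn2r; rewrite ?nnegrE; lra.
apply: le_trans H _; apply: ler_wpM2l => //; apply: ler_wpM2r.
  by rewrite exprn_ge0//; lra.
by apply: lerXn2r; rewrite ?nnegrE; lra.
Qed.

(** From 1 + 4P <= 4 (1 + P): the square of the weight is at most 4^8 = 256^2. This is the price
    paid on the weight's own block. *)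
Lemma tmul_le k t : 11 <= k -> tmul k t <= 256.
Proof.
move=> k11; have c1 := cos_le1 t.
have P0 : 0 <= k * (1 + k) * (2 - 2 * cos t) by rewrite !mulr_ge0//; lra.
have : tmul k t ^+ 2 <= 4 ^+ 8.
  apply: (bump_ineq P0) => //; set P := k * _ * _ in P0 *.
  apply: (@le_trans _ _ (4 ^+ 8 * (1 + P) ^+ 8)).
    by rewrite -exprMn; apply: lerXn2r; rewrite ?nnegrE; lra.
  apply: ler_wpM2l; first by rewrite exprn_ge0.
  rewrite (exprS _ 7); apply: ler_wpM2r; first by rewrite exprn_ge0//; lra.
  by have := mulr_ge0 P0 P0; lra.
have -> : (4 : R) ^+ 8 = 256 ^+ 2 by ring.
by rewrite ler_sqr ?nnegrE ?tmul_ge0 ?ler0n.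
Qed.

Lemma sq_step (a c c' P : R) : 0 <= a -> 0 <= P -> P <= 1 / 256 -> a <= 1 + c * P ->
  2 * c + c ^+ 2 / 256 <= c' -> a ^+ 2 <= 1 + c' * P.
Proof.
move=> a0 P0 P1 ac cc.
have h : a ^+ 2 <= (1 + c * P) ^+ 2 by apply: lerXn2r; rewrite ?nnegrE//; exact: le_trans ac.
apply: le_trans h _.
have -> : (1 + c * P) ^+ 2 = 1 + (2 * c + c ^+ 2 * P) * P by ring.
rewrite lerD2l; apply: ler_wpM2r => //; apply: le_trans cc; rewrite lerD2l.
by have := ler_wpM2l (sqr_ge0 c) P1; lra.
Qed.

(** Three squarings raise the slope from 4 to 8 + 1/16, 17 and 37. The target 37 = 2 * 15 + 7 is the
    slope at 0 of (1 + 15P)^2 (1 + P)^7. *)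
Lemma small_ineq P : 0 <= P -> P <= 1 / 256 -> (1 + 4 * P) ^+ 8 <= 1 + 37 * P.
Proof.
move=> P0 P1.
have a0 : 0 <= 1 + 4 * P by rewrite addr_ge0// mulr_ge0.
have h2 : (1 + 4 * P) ^+ 2 <= 1 + (8 + 1 / 16) * P by apply: (sq_step a0 P0 P1 (lexx _)); lra.
have h4 : (1 + 4 * P) ^+ 2 ^+ 2 <= 1 + 17 * P by apply: (sq_step (exprn_ge0 2 a0) P0 P1 h2); lra.
have h8 : (1 + 4 * P) ^+ 2 ^+ 2 ^+ 2 <= 1 + 37 * P.
  by apply: (sq_step (exprn_ge0 2 (exprn_ge0 2 a0)) P0 P1 h4); lra.
by move: h8; rewrite -!exprM.
Qed.

(** For small P the slopes decide, as 37 P is available against (1 + 4P)^8. For large P the degrees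
    decide, 8 against 9: (5P)^8 <= (15P)^2 P^7 once 5^8 <= 225 P, which P >= 2048 ensures. *)
Lemma tmul_le1 k t : 11 <= k ->
  (k * (1 + k) * (2 - 2 * cos t) <= 1 / 256) || (2048 <= k * (1 + k) * (2 - 2 * cos t)) ->
  tmul k t <= 1.
Proof.
move=> k11 H; have c1 := cos_le1 t.
have P0 : 0 <= k * (1 + k) * (2 - 2 * cos t) by rewrite !mulr_ge0//; lra.
suff : tmul k t ^+ 2 <= 1 ^+ 2 by rewrite ler_sqr ?nnegrE ?tmul_ge0 ?ler0n.
rewrite expr1n; apply: (bump_ineq P0) => //; rewrite mul1r.
set P := k * _ * _ in P0 H *; case/orP: H => HP.
  apply: (le_trans (small_ineq P0 HP)).
  have b7 : 1 + 7 * P <= (1 + P) ^+ 7 by apply: bernoulli_le.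
  have b2 : 1 + 2%:R * (15 * P) <= (1 + 15 * P) ^+ 2 by apply: bernoulli_le; rewrite mulr_ge0.
  have PP := mulr_ge0 P0 P0.
  apply: (@le_trans _ _ ((1 + 2%:R * (15 * P)) * (1 + 7 * P))); first by clear b7 b2; lra.
  apply: ler_pM; [ | | exact: b2 | exact: b7]; first by clear b2 b7; lra.
  by clear b2 b7; lra.
apply: (@le_trans _ _ ((5 * P) ^+ 8)).
  by apply: lerXn2r; rewrite ?nnegrE; lra.
apply: (@le_trans _ _ ((15 * P) ^+ 2 * P ^+ 7)); last first.
  apply: ler_pM.
  - by apply: exprn_ge0; lra.
  - by apply: exprn_ge0; lra.
  - by apply: lerXn2r; rewrite ?nnegrE; lra.
  - by apply: lerXn2r; rewrite ?nnegrE; lra.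
have -> : (5 * P) ^+ 8 = P ^+ 8 * (625 * 625) by ring.
have -> : (15 * P) ^+ 2 * P ^+ 7 = P ^+ 8 * (225 * P) by ring.
by apply: ler_wpM2l; [rewrite exprn_ge0 | lra].
Qed.

(** At the real point 1 - eta, with q = k eta, the slopes are 16 against 2 * 4 + 7 = 15, so a gain
    of q / 4 can be kept. Half of the eighth power absorbs (1 + 4q)^2, the other half the remaining
    factors. *)
Lemma gain_ineq (q : R) : 0 <= q <= 1 / 8 ->
  (1 + q / 4) * ((1 + 4 * q) ^+ 2 * (1 + q) ^+ 7) <= (1 + 2 * q) ^+ 8.
Proof.
move=> /andP[q0 q8].
have q2 : 0 <= q ^+ 2 by rewrite exprn_ge0.
have h1 : (1 + 4 * q) ^+ 2 <= (1 + 2 * q) ^+ 4.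
  rewrite (exprM _ 2 2).
  have h : 1 + 4 * q <= (1 + 2 * q) ^+ 2.
    have -> : (1 + 2 * q) ^+ 2 = 1 + 4 * q + 4 * q ^+ 2 by ring.
    by lra.
  apply: lerXn2r; [by rewrite nnegrE; lra | | exact: h].
  by rewrite nnegrE exprn_ge0//; lra.
have h2 : (1 + q / 4) * (1 + q) ^+ 7 <= (1 + 2 * q) ^+ 4.
  have s n : 0 <= q ^+ n.+1 /\ q ^+ n.+2 <= q ^+ n.+1 / 8.
    split; first exact: exprn_ge0.
    rewrite (exprS _ n.+1); have := ler_wpM2r (exprn_ge0 n.+1 q0) q8; lra.
  rewrite -subr_ge0.
  have -> : (1 + 2 * q) ^+ 4 - (1 + q / 4) * (1 + q) ^+ 7 =
    3/4 * q + 5/4 * q ^+ 2 - 33/4 * q ^+ 3 - 111/4 * q ^+ 4 - 119/4 * q ^+ 5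
    - 49/4 * q ^+ 6 - 11/4 * q ^+ 7 - q ^+ 8 / 4.
    by field.
  have [_ s2] := s 0%N; have [_ s3] := s 1%N; have [_ s4] := s 2%N; have [_ s5] := s 3%N.
  have [_ s6] := s 4%N; have [_ s7] := s 5%N; have [s70 s8] := s 6%N.
  clear s h1 q8; rewrite expr1 in s2; lra.
have -> : (1 + 2 * q) ^+ 8 = (1 + 2 * q) ^+ 4 * (1 + 2 * q) ^+ 4 by ring.
rewrite mulrCA; apply: ler_pM => //; first by rewrite exprn_ge0//; lra.
by rewrite mulr_ge0 ?exprn_ge0//; lra.
Qed.

(** The numerators of the weights are polynomials and multiply Q; the denominators go through
    [poly_max_div]. The weights have modulus [tmul] on the circle and are at least 1 + k eta / 4 at
    1 - eta. *)
Lemma multiplier_principle (Q : {poly R[i]}) (ks : seq R) (B eta : R) :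
  0 < eta <= 1 -> (forall k, k \in ks -> 11 <= k /\ k * eta <= 1 / 8) ->
  (forall t, normc Q.[cis t] * \prod_(k <- ks) tmul k t <= B) ->
  normc Q.[(1 - eta)%:C] * \prod_(k <- ks) (1 + k * eta / 4) <= B.
Proof.
move=> /andP[e0 e1] ksP H.
have ks0 k : k \in ks -> 0 <= k by move=> /ksP[]; lra.
pose N : {poly R[i]} := \prod_(k <- ks) (1 + (2 * k)%:C *: (1 - 'X)) ^+ 8.
have NE u : N.[u] = \prod_(k <- ks) mfac (2 * k) u ^+ 8.
  rewrite /N horner_prod; apply: eq_bigr => k _; rewrite horner_exp.
  by rewrite hornerD hornerZ hornerD hornerN hornerX hornerC.
pose ds := flatten [seq nseq 2 (4 * k) ++ nseq 7 k | k <- ks].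
have dsE (f : R -> R) : \prod_(k <- ds) f k = \prod_(k <- ks) (f (4 * k) ^+ 2 * f k ^+ 7).
  rewrite /ds big_flatten big_map; apply: eq_bigr => k _.
  rewrite big_cat /=; congr (_ * _); first by rewrite !big_cons big_nil mulr1.
  by rewrite !big_cons big_nil !exprS expr0 !mulr1.
have ds0 k : k \in ds -> 0 <= k.
  move=> /flattenP[s /mapP[a /ks0 a0 ->]]; rewrite mem_cat !mem_nseq /= => /orP[] /eqP -> //.
  by rewrite mulr_ge0.
have re : 0 <= 1 - eta < 1 by lra.
have := @poly_max_div R ds (Q * N) B _ re ds0.
rewrite dsE => /(_ _) P.
have {P} : normc (Q * N).[(1 - eta)%:C] <= B * (\prod_(k <- ks)
     ((1 + 4 * k * (1 - (1 - eta))) ^+ 2 * (1 + k * (1 - (1 - eta))) ^+ 7)).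
  apply: P => t; rewrite dsE.
  have pos : 0 < \prod_(k <- ks) (normc (mfac (4 * k) (cis t)) ^+ 2 * normc (mfac k (cis t)) ^+ 7).
    rewrite big_seq prodr_gt0// => k /ks0 k0.
    by rewrite mulr_gt0 ?exprn_gt0// normc_mfac_gt0// mulr_ge0.
  apply: le_trans (ler_wpM2r (ltW pos) (H t)).
  rewrite hornerM normcM NE normc_prod -mulrA; apply: ler_wpM2l; first exact: normc_ge0.
  rewrite -big_split; apply: le_of_eq; rewrite big_seq [RHS]big_seq.
  apply: eq_bigr => k /ks0 k0; rewrite normcX; apply/esym; rewrite /tmul; apply: divfK; rewrite gt_eqF//.
  by rewrite mulr_gt0 ?exprn_gt0// normc_mfac_gt0// mulr_ge0.
rewrite hornerM normcM NE normc_prod subKr => H1.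
set D := \prod_(k <- ks) _ in H1 *.
set D' := \prod_(k <- ks) ((1 + 4 * k * eta) ^+ 2 * (1 + k * eta) ^+ 7) in H1 *.
have D0 : 0 < D'.
  rewrite /D' big_seq prodr_gt0// => k /ks0 k0.
  have f0 : 0 <= k * eta by rewrite mulr_ge0// ltW.
  by apply: mulr_gt0; apply: exprn_gt0; lra.
rewrite -(ler_pM2r D0) (le_trans _ H1)// -mulrA; apply: ler_wpM2l; first exact: normc_ge0.
rewrite /D' -big_split /D; rewrite big_seq [leRHS]big_seq; apply: ler_prod => k kks.
have [k11 ke] := ksP k kks; have k0 := ks0 k kks.
have ke0 : 0 <= k * eta by rewrite mulr_ge0// ltW.
apply/andP; split.
  have f0 : 0 <= 4 * k * eta by rewrite -mulrA mulr_ge0.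
  apply: mulr_ge0; first by rewrite addr_ge0// divr_ge0.
  by apply: mulr_ge0; apply: exprn_ge0; rewrite addr_ge0.
rewrite normcX mfac_real subKr normc_real ger0_norm.
  have := @gain_ineq (k * eta); rewrite ke0 ke => /(_ isT).
  have -> : 4 * k * eta = 4 * (k * eta) by ring.
  have -> : 2 * k * eta = 2 * (k * eta) by ring.
  by [].

by rewrite addr_ge0// !mulr_ge0// ltW.
Qed.

End Multiplier.

(** * Small values of exponential sums *)

Section Taylor.
Variable R : realType.
Implicit Types (x y a : R) (K n : nat).

Lemma exp_series_le a n : 0 <= a -> \sum_(k < n) a ^+ k / k`!%:R <= expR a.
Proof.
move=> a0; have := is_cvg_series_exp_coeff a => cv.
rewrite /expR.
have nd : nondecreasing_seq (series (exp_coeff a)).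
  by apply/nondecreasing_seqP => k; rewrite /series /= big_nat_recr//= lerDl exp_coeff_ge0.
have := nondecreasing_cvgn_le nd cv n; rewrite /series /= big_mkord.
by [].
Qed.

(** Rankin's trick: a^k <= (r a)^k / r^K for k >= K, then the tail is completed to a full
    exponential series. *)
Lemma exp_tail_le a (r : R) K n : 0 <= a -> 1 <= r -> (K <= n)%N ->
  \sum_(K <= k < n) a ^+ k / k`!%:R <= expR (r * a) / r ^+ K.
Proof.
move=> a0 r1 Kn; have r0 : 0 < r by lra.
have rK : 0 < r ^+ K by exact: exprn_gt0.
rewrite ler_pdivlMr//.
apply: le_trans (exp_series_le n (mulr_ge0 (ltW r0) a0)).
rewrite -(big_mkord predT (fun k => (r * a) ^+ k / k`!%:R)) [leRHS](@big_cat_nat _ _ _ K)//=.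
rewrite mulr_suml -[leLHS]add0r lerD//.
  by apply: sumr_ge0 => k _; rewrite divr_ge0// exprn_ge0// mulr_ge0// ltW.
apply: ler_sum_nat => k /andP[Kk _].
rewrite mulrAC; apply: ler_wpM2r; first by rewrite invr_ge0.
rewrite exprMn mulrC; apply: ler_wpM2r; first exact: exprn_ge0.
by apply: ler_weXn2l.
Qed.

(** This is i^k / k!, split by parity so that its parts match [cos_coeff] and [sin_coeff]. *)
Definition cis_coeff k : R[i] :=
  ((~~ odd k)%:R * (-1) ^+ k./2 / k`!%:R) +i* ((odd k)%:R * (-1) ^+ k.-1./2 / k`!%:R).

Lemma normc_cis_coeff k : normc (cis_coeff k) = k`!%:R^-1.
Proof.
rewrite /cis_coeff /=; case: (odd k) => /=.
  by rewrite !mul0r expr0n add0r sqrtr_sqr mul1r normrM normrX normrN1 expr1n mul1r ger0_norm// invr_ge0.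
by rewrite !mul0r expr0n addr0 sqrtr_sqr mul1r normrM normrX normrN1 expr1n mul1r ger0_norm// invr_ge0.
Qed.

Lemma Re_le_lim (w z : R[i]) (u v : R^nat) (b : R) K :
  u @ \oo --> complex.Re z -> v @ \oo --> complex.Im z ->
  (forall n, (K <= n)%N -> complex.Re (w * (u n +i* v n)) <= b) ->
  complex.Re (w * z) <= b.
Proof.
case: w z => w1 w2 [z1 z2] /= cu cv H.
have c : w1 * u n - w2 * v n @[n --> \oo] --> w1 * z1 - w2 * z2.
  by apply: cvgB; apply: cvgMr.
rewrite -(cvg_lim _ c)//; apply: limr_le; first by apply/cvg_ex; eexists; exact: c.
by exists K => // n /= Kn; have := H n Kn; simpc.
Qed.

(** After a rotation the modulus is a real part, so the convergence of the two real series for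
    cosine and sine suffices; the partial tails are bounded uniformly by Rankin's trick. *)
Lemma cis_taylor x K (r : R) : 1 <= r ->
  normc (cis x - \sum_(k < K) cis_coeff k * (x ^+ k)%:C) <= expR (r * `|x|) / r ^+ K.
Proof.
move=> r1; set T := \sum_(k < K) _.
have [w w1 wE] := normc_rotate (cis x - T).
have -> : normc (cis x - T) = complex.Re (w * (cis x - T)) by rewrite wE.
apply: (@Re_le_lim _ _ (fun n => series (cos_coeff x) n - complex.Re T)
  (fun n => series (sin_coeff x) n - complex.Im T) _ K).
- have -> : complex.Re (cis x - T) = cos x - complex.Re T by rewrite /cis; case: (T).
  by apply: cvgB; [rewrite cos.unlock; exact: is_cvg_series_cos_coeff | exact: cvg_cst].
- have -> : complex.Im (cis x - T) = sin x - complex.Im T by rewrite /cis; case: (T).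
  by apply: cvgB; [rewrite sin.unlock; exact: is_cvg_series_sin_coeff | exact: cvg_cst].
move=> n Kn; rewrite (le_trans (Re_le_normc _))// normcM w1 mul1r.
have -> : (series (cos_coeff x) n - complex.Re T) +i* (series (sin_coeff x) n - complex.Im T)
   = \sum_(K <= k < n) cis_coeff k * (x ^+ k)%:C.
  have -> : \sum_(K <= k < n) cis_coeff k * (x ^+ k)%:C
     = \sum_(0 <= k < n) cis_coeff k * (x ^+ k)%:C - T.
    by rewrite (@big_cat_nat _ _ _ K 0 n)//= /T big_mkord addrC addrK.
  have E : \sum_(0 <= k < n) cis_coeff k * (x ^+ k)%:C
      = series (cos_coeff x) n +i* series (sin_coeff x) n.
    apply/eqP; rewrite eq_complex Re_sum Im_sum; apply/andP; split; apply/eqP; rewrite [RHS]/= /series.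
      by apply: eq_bigr => k _; rewrite mulrC ReM_real /cis_coeff /cos_coeff /= -?exprnP; ring.
    by apply: eq_bigr => k _; rewrite mulrC ImM_real /cis_coeff /sin_coeff /= -?exprnP; ring.
  by rewrite E; case: (T).
apply: le_trans (exp_tail_le (normr_ge0 x) r1 Kn).
apply: le_trans (normc_sum _ _ _) _; apply: ler_sum => k _.
by rewrite normcM normc_real normc_cis_coeff normrX mulrC.
Qed.

End Taylor.

(** * Lagrange interpolation at separated nodes *)

Section Lagrange.
Variable R : realType.

Lemma lagrange_interp (F : fieldType) K (z : nat -> F) (P : {poly F}) (t : F) :
  (size P <= K.+1)%N ->
  (forall i j, (i < K.+1)%N -> (j < K.+1)%N -> z i = z j -> i = j) ->
  P.[t] = \sum_(i < K.+1) P.[z i] * \prod_(j < K.+1 | j != i) ((t - z j) / (z i - z j)).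
Proof.
move=> sP inj.
pose l (i : 'I_K.+1) : {poly F} := \prod_(j < K.+1 | j != i) ((z i - z j)^-1 *: ('X - (z j)%:P)).
have lE i s : (l i).[s] = \prod_(j < K.+1 | j != i) ((s - z j) / (z i - z j)).
  rewrite horner_prod; apply: eq_bigr => j _.
  by rewrite hornerZ hornerXsubC mulrC.
have sl i : (size (l i) <= K.+1)%N.
  apply: leq_trans (size_poly_prod_leq _ _) _.
  have : (\sum_(j < K.+1 | j != i) size ((z i - z j)^-1 *: ('X - (z j)%:P)) <= \sum_(j < K.+1 | j != i) 2)%N.
    apply: leq_sum => j _; apply: leq_trans (size_scale_leq _ _) _.
    by rewrite size_XsubC.
  have cardK : #|(fun j : 'I_K.+1 => j != i)| = K.
    by have := cardC1 i; rewrite card_ord /= => E; rewrite -[RHS]E; apply: eq_card => j.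
  by rewrite sum_nat_const cardK => H; rewrite leq_subLR; apply: leq_ltn_trans H _; lia.
pose D := P - \sum_(i < K.+1) P.[z i] *: l i.
have D0 : D = 0.
  apply: (@roots_geq_poly_eq0 _ D [seq z i | i <- iota 0 K.+1]).
  - apply/allP => y /mapP[m]; rewrite mem_iota /= add0n => iK ->{y}.
    apply/rootP; rewrite hornerD hornerN horner_sum (bigD1 (Ordinal iK))//= hornerZ lE.
    rewrite [X in P.[_] * X]big1 ?mulr1; last first.
      move=> j ji; rewrite divff// subr_eq0; apply: contraNN ji => /eqP E.
      by apply/eqP/val_inj; rewrite /= (inj _ _ iK _ E).
    rewrite big1 ?addr0 ?subrr// => j ji; rewrite hornerZ lE (bigD1 (Ordinal iK)) 1?eq_sym//=.
    by rewrite subrr !mul0r mulr0.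
  - rewrite map_inj_in_uniq ?iota_uniq// => i j; rewrite !mem_iota /= !add0n; exact: inj.
  - rewrite size_map size_iota; apply: leq_trans (size_polyD _ _) _.
    rewrite size_polyN geq_max sP /=; apply: leq_trans (size_sum _ _ _) _.
    apply/bigmax_leqP => i _; apply: leq_trans (size_scale_leq _ _) _; exact: sl.
have := congr1 (fun p : {poly F} => p.[t]) D0; rewrite hornerD hornerN horner0 horner_sum.
move=> /eqP; rewrite subr_eq0 => /eqP ->; apply: eq_bigr => i _.
by rewrite hornerZ lE.
Qed.

(** Nodes i and j are at least |i - j| d apart, so the denominators multiply to at least d^K i! (K -
    i)!, and 1 / (i! (K - i)!) = C(K, i) / K! <= 2^K / K!. *)
Lemma lagrange_basis_bound K (x : nat -> R) (L d t : R) (i : 'I_K.+1) :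
  0 < d -> 0 <= L ->
  (forall j, (j < K.+1)%N -> `|t - x j| <= L) ->
  (forall j k, (j < k < K.+1)%N -> (k - j)%:R * d <= x k - x j) ->
  \prod_(j < K.+1 | j != i) (`|t - x j| / `|x i - x j|) <= (2 * L / d) ^+ K / K`!%:R.
Proof.
move=> d0 L0 tL gap.
have gap' j k : (j < K.+1)%N -> (k < K.+1)%N -> (`|(j : int) - k|%N)%:R * d <= `|x j - x k|.
  move=> jK kK; have [jk|kj|->] := ltngtP j k.
  - rewrite distrC; apply: le_trans (ler_norm _); apply: le_trans (gap j k _); last by rewrite jk.
    by apply: le_of_eq; congr (_%:R * _); lia.
  - apply: le_trans (ler_norm _); apply: le_trans (gap k j _); last by rewrite kj.
    by apply: le_of_eq; congr (_%:R * _); lia.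
  - by rewrite !subrr /= normr0 mul0r.
apply: (@le_trans _ _ (\prod_(j < K.+1 | j != i) (L / (d * (`|(i : int) - j|%N)%:R)))).
  apply: ler_prod => j ji; rewrite divr_ge0//=.
  have p0 : (0 < (`|(i : int) - j|%N)%:R * d)%R.
    rewrite mulr_gt0// ltr0n; move: ji; rewrite -val_eqE /=; lia.
  apply: ler_pM => //; first exact: tL.
  rewrite lef_pV2 ?posrE; [by rewrite mulrC gap'| | by rewrite mulrC].
  by rewrite (lt_le_trans p0)// gap'.
have cardK : #|[pred j : 'I_K.+1 | j != i]| = K.
  by have := cardC1 i; rewrite card_ord /= => E; rewrite -[RHS]E; apply: eq_card => j.
have pe : \prod_(j < K.+1 | j != i) (L / (d * (`|(i : int) - j|%N)%:R))
   = (L / d) ^+ K / (\prod_(j < K.+1 | j != i) `|(i : int) - j|%N)%:R.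
  rewrite -[in X in X / _]cardK -prodr_const natr_prod -prodfV.
  rewrite -big_split /=; apply: eq_bigr => j _.
  by rewrite invfM mulrA.
have fe : (\prod_(j < K.+1 | j != i) `|(i : int) - j|)%N = (i`! * (K - i)`!)%N.
  rewrite -(big_mkord (fun j => j != i) (fun j => `|(i : int) - j|%N)).
  rewrite (@big_cat_nat _ _ _ i)//=; last by rewrite ltnW.
  rewrite [X in (_ * X)%N]big_ltn_cond// eqxx /=; congr (_ * _)%N.
    rewrite fact_prod big_add1 /= big_nat_rev /= add0n big_nat_cond [RHS]big_nat_cond.
    rewrite (eq_bigl (fun j => (0 <= j < i)%N)); last by move=> j; lia.
    rewrite [RHS](eq_bigl (fun j => (0 <= j < i)%N)); last by move=> j; lia.
    by apply: eq_bigr => j; lia.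
  rewrite fact_prod -{1}[i.+1]add0n big_addn.
  have -> : (K.+1 - i.+1 = K - i)%N by lia.
  rewrite big_add1 /= big_nat_cond [RHS]big_nat_cond.
  rewrite (eq_bigl (fun j => (0 <= j < K - i)%N)); last by move=> j; lia.
  rewrite [RHS](eq_bigl (fun j => (0 <= j < K - i)%N)); last by move=> j; lia.
  by apply: eq_bigr => j; lia.
rewrite pe fe.
have iK : (i <= K)%N by rewrite -ltnS.
have be := bin_fact iK.
have b2 : ('C(K, i) <= 2 ^ K)%N.
  have := expnDn 1 1 K; rewrite !addn1 => ->.
  rewrite (bigD1 (Ordinal (ltn_ord i)))//= !exp1n !muln1.
  exact: leq_addr.
have f0 : (0 : R) < (i`! * (K - i)`!)%:R by rewrite ltr0n muln_gt0 !fact_gt0.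
have -> : (2 * L / d) ^+ K = 2 ^+ K * (L / d) ^+ K by rewrite -exprMn mulrA.
have Ld : 0 <= (L / d) ^+ K by rewrite exprn_ge0// divr_ge0// ltW.
rewrite ler_pdivlMr ?ltr0n ?fact_gt0// -be [X in _ * X]natrM.
have E (a f c : R) : 0 < f -> a / f * (c * f) = c * a.
  by move=> f1; rewrite mulrCA mulfVK ?gt_eqF.
by rewrite E//; apply: ler_wpM2r => //; rewrite -natrX ler_nat.
Qed.

End Lagrange.

(** * Propagating smallness of an exponential sum from nodes to an interval *)

Section ExpSum.
Variable R : realType.

Definition expsum (n : nat) (c : nat -> R[i]) (mu : nat -> R) (t : R) : R[i] :=
  \sum_(j < n) c j * cis (mu j * t).

Lemma expsum_taylor n (c : nat -> R[i]) (mu : nat -> R) (H1 H L X r s : R) K :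
  \sum_(j < n) normc (c j) <= H1 -> (forall j, (j < n)%N -> 0 <= mu j <= H) ->
  1 <= r -> 0 <= s <= L ->
  normc (expsum n c mu (X + s) -
    (\sum_(j < n) (c j * cis (mu j * X)) *:
       \sum_(k < K.+1) (cis_coeff R k * (mu j ^+ k)%:C) *: 'X^k).[s%:C])
   <= H1 * (expR (r * (H * L)) / r ^+ K.+1).
Proof.
move=> cH muH r1 /andP[s0 sL].
rewrite horner_sum /expsum -sumrB.
apply: le_trans (normc_sum _ _ _) _.
have rK : 0 < r ^+ K.+1 by rewrite exprn_gt0//; lra.
have e0 : 0 <= expR (r * (H * L)) / r ^+ K.+1 by rewrite divr_ge0 ?expR_ge0// ltW.
apply: le_trans (ler_wpM2r e0 cH); rewrite mulr_suml; apply: ler_sum => j _.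
rewrite hornerZ horner_sum mulrDr cisD mulrA -mulrBr !normcM normc_cis mulr1.
apply: ler_wpM2l; first exact: normc_ge0.
have /andP[m0 mH] := muH j (ltn_ord j).
have -> : \sum_(k < K.+1) ((cis_coeff R k * (mu j ^+ k)%:C) *: 'X^k).[s%:C]
   = \sum_(k < K.+1) cis_coeff R k * ((mu j * s) ^+ k)%:C.
  by apply: eq_bigr => k _; rewrite hornerZ hornerXn exprMn rmorphM -mulrA -rmorphXn.
apply: le_trans (cis_taylor _ _ r1) _; rewrite ler_pM2r ?invr_gt0// ler_expR.
apply: ler_wpM2l; first lra.
by rewrite ger0_norm ?mulr_ge0//; apply: ler_pM.
Qed.

(** On [X, X + L] the sum is within tau of a Taylor polynomial of degree K about X. That polynomial
    is at most E + tau at the K + 1 nodes and is recovered from them by interpolation. *)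
Lemma expsum_interp n (c : nat -> R[i]) (mu : nat -> R) (H1 H L X r d E : R) K (x : nat -> R) :
  \sum_(j < n) normc (c j) <= H1 -> (forall j, (j < n)%N -> 0 <= mu j <= H) ->
  1 <= r -> 0 < d -> 0 <= L ->
  (forall i, (i < K.+1)%N -> X <= x i <= X + L) ->
  (forall j k, (j < k < K.+1)%N -> (k - j)%:R * d <= x k - x j) ->
  (forall i, (i < K.+1)%N -> normc (expsum n c mu (x i)) <= E) ->
  forall t, X <= t <= X + L ->
  let tau := H1 * (expR (r * (H * L)) / r ^+ K.+1) in
  normc (expsum n c mu t) <= tau + K.+1%:R * ((E + tau) * ((2 * L / d) ^+ K / K`!%:R)).
Proof.
move=> cH muH r1 d0 L0 xX gap xE t tX; cbv zeta; set tau := H1 * _.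
pose P : {poly R[i]} := \sum_(j < n) (c j * cis (mu j * X)) *:
       \sum_(k < K.+1) (cis_coeff R k * (mu j ^+ k)%:C) *: 'X^k.
have sP : (size P <= K.+1)%N.
  apply: leq_trans (size_sum _ _ _) _; apply/bigmax_leqP => j _.
  apply: leq_trans (size_scale_leq _ _) _.
  apply: leq_trans (size_sum _ _ _) _; apply/bigmax_leqP => k _.
  by apply: leq_trans (size_scale_leq _ _) _; rewrite size_polyXn.
have tay s : 0 <= s <= L -> normc (expsum n c mu (X + s) - P.[s%:C]) <= tau.
  exact: expsum_taylor.
have tL : 0 <= t - X <= L by lra.
have t1 := tay _ tL; rewrite [X + _]addrC subrK in t1.
have -> : expsum n c mu t = (expsum n c mu t - P.[(t - X)%:C]) + P.[(t - X)%:C] by rewrite subrK.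
apply: le_trans (le_normcD _ _) _; apply: lerD => //.
pose z i := (x i - X)%:C.
have zinj i j : (i < K.+1)%N -> (j < K.+1)%N -> z i = z j -> i = j.
  move=> iK jK /complexI xx; have {}xx : x i = x j by lra.
  have [ij|ji|//] := ltngtP i j; exfalso.
    have := gap i j; rewrite ij jK => /(_ isT); rewrite xx subrr.
    by apply/negP; rewrite -ltNge mulr_gt0// ltr0n subn_gt0.
  have := gap j i; rewrite ji iK => /(_ isT); rewrite xx subrr.
  by apply/negP; rewrite -ltNge mulr_gt0// ltr0n subn_gt0.
rewrite (lagrange_interp _ sP zinj).
apply: le_trans (normc_sum _ _ _) _.
apply: (@le_trans _ _ (\sum_(i < K.+1) ((E + tau) * ((2 * L / d) ^+ K / K`!%:R)))); last first.
  by rewrite sumr_const card_ord -[leLHS]mulr_natl.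
apply: ler_sum => i _; rewrite normcM; apply: ler_pM; rewrite ?normc_ge0//.
  have := tay (x i - X); have := xX i (ltn_ord i) => xi.
  move=> /(_ ltac:(lra)); rewrite [X + _]addrC subrK => H2.
  have := xE i (ltn_ord i) => H3.
  have -> : P.[z i] = expsum n c mu (x i) - (expsum n c mu (x i) - P.[(x i - X)%:C]).
    by rewrite opprB addrC subrK.
  apply: le_trans (le_normcD _ _) _; rewrite normcN; exact: lerD.
rewrite normc_prod.
apply: le_trans _ (@lagrange_basis_bound R K (fun j => x j - X) L d (t - X) i d0 L0 _ _).
- apply: le_of_eq; apply: eq_bigr => j _; rewrite /z -!rmorphB normcM normcV !normc_real.
  by [].
- by move=> j jK; have := xX j jK; rewrite ler_norml; lra.
- by move=> j k jk; have := gap j k jk; lra.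
Qed.

Lemma fact_ge_pow K : (K%:R / expR 1) ^+ K <= K`!%:R :> R.
Proof.
have [->|K0] := posnP K; first by rewrite expr0 fact0.
have KR : (0 : R) < K%:R by rewrite ltr0n.
rewrite -ler_ln ?posrE ?ltr0n ?fact_gt0 ?exprn_gt0 ?divr_gt0 ?expR_gt0//.
have := ln_fact_ge R K; rewrite lnXn ?divr_gt0 ?expR_gt0// ln_div ?posrE ?expR_gt0// expRK.
by rewrite -[X in _ -> X <= _]mulr_natl mulrBr mulr1.
Qed.

Lemma leq_pow3 m : (0 < m)%N -> (m.+2 <= 3 ^ m)%N.
Proof. by case: m => // m _; elim: m => // m IH; rewrite expnS; lia. Qed.

(** Take K = r = N^4. The Taylor tail is of size (C / N^4)^K, while spacing of order N^-6 and K! >=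
    (N^4 / e)^K bound the Lagrange basis by (C N^2)^K. The product (C / N^2)^K is below N^-K for
    large N; the nodal values N^(-16 K) are smaller than the tail. *)
Lemma expsum_interp_asymp (H L H1 c1 : R) : 0 <= H -> 0 < L -> 0 < H1 -> 0 < c1 ->
  exists N0 : nat, forall N : nat, (N0 <= N)%N ->
  forall n (c : nat -> R[i]) (mu : nat -> R) (X : R) (x : nat -> R),
  \sum_(j < n) normc (c j) <= H1 -> (forall j, (j < n)%N -> 0 <= mu j <= H) ->
  (forall i, (i < (N ^ 4).+1)%N -> X <= x i <= X + L) ->
  (forall j k, (j < k < (N ^ 4).+1)%N -> (k - j)%:R * (c1 * N%:R ^+ 6)^-1 <= x k - x j) ->
  (forall i, (i < (N ^ 4).+1)%N -> normc (expsum n c mu (x i)) <= (N%:R ^- 16) ^+ (N ^ 4)) ->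
  forall t, X <= t <= X + L -> normc (expsum n c mu t) <= N%:R ^- 1 ^+ (N ^ 4).
Proof.
move=> H0 L0 H10 c10.
pose G := (1 + H1) * expR (H * L); pose G' := 1 + 2 * L * c1 * expR 1.
have G1 : 1 <= G.
  have h1 : 1 <= 1 + H1 by rewrite lerDl ltW.
  have h2 : 1 <= expR (H * L) by rewrite -expR0 ler_expR mulr_ge0// ltW.
  by have := ler_pM ler01 ler01 h1 h2; rewrite mulr1.
have G'1 : 1 <= G' by rewrite lerDl !mulr_ge0 ?expR_ge0// ltW.
(* G and G' are the constants of the tail and of the basis; 6 = 3 * 2 absorbs the number of nodes, K
   + 2 <= 3^K, and the sum of nodal value and tail, at most 2^K times the tail. *)
exists (Num.truncn (6 * G * G')).+2 => N NN0 n c mu X x cH muH xX gap xE t tX.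
have NG : 6 * G * G' <= N%:R.
  have := truncnS_gt (6 * G * G') => h; apply: le_trans (ltW h) _.
  by rewrite ler_nat (leq_trans _ NN0).
have N1 : 1 <= N%:R :> R by rewrite ler1n (leq_trans _ NN0).
have N0 : 0 < N%:R :> R by lra.
have N0n : (0 < N)%N by rewrite -(ler1n R).
pose K := (N ^ 4)%N.
have K1 : (1 <= K)%N by rewrite expn_gt0 N0n.
have KE : K%:R = N%:R ^+ 4 :> R by rewrite natrX.
have r1 : 1 <= N%:R ^+ 4 :> R by rewrite -natrX ler1n.
have r0 : 0 < N%:R ^+ 4 :> R by lra.
have d0 : 0 < (c1 * N%:R ^+ 6)^-1 by rewrite invr_gt0 mulr_gt0// exprn_gt0.
have := @expsum_interp n c mu H1 H L X (N%:R ^+ 4) _ _ K x cH muH r1 d0 (ltW L0) xX gap xE t tX.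
set tau := H1 * _ => /= /le_trans; apply.
set Q := (_ ^+ K / _).
have tauE : tau <= (G / N%:R ^+ 4) ^+ K.
  have -> : (G / N%:R ^+ 4) ^+ K = (1 + H1) ^+ K * expR (H * L) ^+ K / (N%:R ^+ 4) ^+ K.
    by rewrite expr_div_n /G exprMn.
  rewrite /tau (exprS _ K) invfM.
  have -> : expR (N%:R ^+ 4 * (H * L)) = expR (H * L) ^+ K by rewrite -KE expRM_natl.
  have a : H1 <= (1 + H1) ^+ K.
    have h1 : 1 <= 1 + H1 by rewrite lerDl ltW.
    have := ler_eXnr K1 h1; lra.
  rewrite mulrA; apply: ler_pM.
  - by rewrite mulr_ge0 ?exprn_ge0 ?expR_ge0// ltW.
  - by rewrite -invfM invr_ge0 mulr_ge0 ?exprn_ge0// ltW.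
  - by apply: ler_wpM2r => //; rewrite exprn_ge0 ?expR_ge0.
  - rewrite -[leRHS]mul1r; apply: ler_wpM2r; first by rewrite invr_ge0 exprn_ge0// ltW.
    by rewrite invf_le1.
have tau0 : 0 <= tau by rewrite mulr_ge0 ?divr_ge0 ?expR_ge0 ?exprn_ge0// ltW.
have e1 := expR_gt0 (1 : R).
have QE : Q <= (G' * N%:R ^+ 2) ^+ K.
  have KK0 : 0 < (K%:R / expR 1) ^+ K :> R by rewrite exprn_gt0// divr_gt0// ltr0n.
  apply: (@le_trans _ _ ((2 * L / (c1 * N%:R ^+ 6)^-1) ^+ K / (K%:R / expR 1) ^+ K)).
    apply: ler_wpM2l; first by rewrite exprn_ge0// divr_ge0 ?mulr_ge0// ltW.
    by rewrite lef_pV2 ?posrE ?fact_ge_pow ?ltr0n ?fact_gt0.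
  rewrite -expr_div_n; apply: lerXn2r; rewrite ?nnegrE.
  - by rewrite divr_ge0// divr_ge0// ?mulr_ge0// ltW.
  - by rewrite mulr_ge0 ?exprn_ge0//; lra.
  rewrite KE.
  have -> : 2 * L / (c1 * N%:R ^+ 6)^-1 / (N%:R ^+ 4 / expR 1) = (2 * L * c1 * expR 1) * N%:R ^+ 2.
    by field; rewrite !gt_eqF.
  by apply: ler_wpM2r; rewrite ?exprn_ge0// /G'; lra.
have Q0 : 0 <= Q by rewrite divr_ge0// exprn_ge0// divr_ge0 ?mulr_ge0// ltW.
have B1 : 1 <= (G' * N%:R ^+ 2) ^+ K.
  apply: exprn_ege1; rewrite -[leLHS]mul1r; apply: ler_pM => //; exact: exprn_ege1.
set B := (G' * N%:R ^+ 2) ^+ K in QE B1.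
set T := (G / N%:R ^+ 4) ^+ K in tauE.
set E := _ ^+ (N ^ 4).
have E0 : 0 <= E by rewrite exprn_ge0// invr_ge0 exprn_ge0.
have step : tau + K.+1%:R * ((E + tau) * Q) <= (3 ^+ K) * ((E + T) * B).
  have k3 : K.+2%:R <= 3 ^+ K :> R.
    by rewrite -natrX ler_nat leq_pow3.
  apply: (@le_trans _ _ (K.+2%:R * ((E + T) * B))); last first.
    by apply: ler_wpM2r => //; rewrite mulr_ge0 ?addr_ge0 ?exprn_ge0 ?divr_ge0 ?mulr_ge0 ?exprn_ge0//; lra.
  rewrite -[K.+2%:R]natr1 [leRHS]mulrDl [leRHS]addrC [X in _ <= X + _]mul1r; apply: lerD.
    rewrite -[leLHS]mulr1; apply: ler_pM => //.
    by apply: le_trans tauE _; rewrite lerDr.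
  apply: ler_wpM2l => //; apply: ler_pM => //; first exact: addr_ge0.
  exact: lerD.
apply: le_trans step _.
have ET : E <= T.
  have G0 : 0 <= G by lra.
  apply: lerXn2r; first by rewrite nnegrE invr_ge0 exprn_ge0// ltW.
    by rewrite nnegrE divr_ge0// ltW.
  apply: (@le_trans _ _ (N%:R ^- 4)).
    by rewrite lef_pV2 ?posrE ?exprn_gt0//; apply: ler_weXn2l.
  rewrite -[leLHS]mul1r; apply: ler_wpM2r => //; by rewrite invr_ge0 exprn_ge0.
have T0 : 0 <= T by exact: le_trans ET.
apply: (@le_trans _ _ (3 ^+ K * (2 ^+ K * T * B))).
  apply: ler_wpM2l; first exact: exprn_ge0.
  apply: ler_wpM2r; first lra.
  apply: (@le_trans _ _ (2 * T)); first lra.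
  by apply: ler_wpM2r => //; apply: ler_eXnr => //; lra.
rewrite /T /B -!exprMn; apply: lerXn2r; rewrite ?nnegrE.
- by rewrite !mulr_ge0 ?divr_ge0 ?exprn_ge0//; lra.
- by rewrite expr1 invr_ge0.
rewrite expr1.
have -> : 3 * (2 * (G / N%:R ^+ 4) * (G' * N%:R ^+ 2)) = (6 * G * G') / N%:R * N%:R^-1.
  by field; rewrite gt_eqF.
rewrite -[leRHS]mul1r; apply: ler_wpM2r; first by rewrite invr_ge0.
by rewrite ler_pdivrMr// mul1r.
Qed.

End ExpSum.

(** * Finding good primes in one window and interpolating there *)

Section Window.
Variable R : realType.

(** Greedy choice: take the least good point and discard the g integers from it on, which carry mass
    at most m. A total above K m survives K such removals. *)
Lemma greedy_points (G : pred nat) (w : nat -> R) (g hi : nat) (m : R) K lo :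
  0 <= m -> (forall p, G p -> 0 <= w p) ->
  (forall a, (lo <= a)%N -> (a < hi)%N -> \sum_(a <= p < a + g | G p) w p <= m) ->
  K%:R * m < \sum_(lo <= p < hi | G p) w p ->
  exists x : nat -> nat,
    (forall i, (i < K.+1)%N -> G (x i) /\ (lo <= x i < hi)%N) /\
    (forall j k, (j < k < K.+1)%N -> (x j + (k - j) * g <= x k)%N).
Proof.
move=> m0 w0; elim: K lo => [|K IH] lo cell tot.
  have : has (fun p => G p && (lo <= p < hi)%N) (index_iota lo hi).
    apply: contraPT tot => /hasPn H; apply/negP; rewrite -leNgt mul0r.
    rewrite big_nat_cond big1// => p /andP[pl gp].
    by have := H p; rewrite mem_index_iota pl gp => /(_ isT).
  move=> /hasP [p _ /andP[gp pl]]; exists (fun=> p); split => // j k; lia.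
have : exists p, G p && (lo <= p < hi)%N.
  have : has (fun p => G p && (lo <= p < hi)%N) (index_iota lo hi).
    apply: contraPT tot => /hasPn H; apply/negP; rewrite -leNgt.
    rewrite big_nat_cond big1 ?mulr_ge0// => p /andP[pl gp].
    by have := H p; rewrite mem_index_iota pl gp => /(_ isT).
  by move=> /hasP [p _ H]; exists p.
move=> /ex_minnP [p /andP[gp /andP[lp ph]] pmin].
have S1 : \sum_(lo <= q < hi | G q) w q = \sum_(p <= q < hi | G q) w q.
  rewrite (@big_cat_nat _ _ _ p)//=; last exact: ltnW.
  rewrite [X in X + _]big_nat_cond [X in X + _]big1 ?add0r// => q /andP[/andP[lq qp] gq].
  by have := pmin q; rewrite gq lq (ltn_trans qp ph) => /(_ isT); lia.
have S2 : \sum_(p <= q < hi | G q) w q <= m + \sum_(p + g <= q < hi | G q) w q.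
  have [pgh|hpg] := leqP (p + g)%N hi.
    rewrite (@big_cat_nat _ _ _ (p + g)%N)//=; last exact: leq_addr.
    by rewrite lerD2r; exact: cell.
  rewrite [X in _ + X]big_geq; last exact: ltnW.
  rewrite addr0; apply: le_trans (cell p lp ph).
  rewrite [leRHS](@big_cat_nat _ _ _ hi)//=; [|exact: ltnW|exact: ltnW].
  by rewrite lerDl sumr_ge0.
have [||x [xG xgap]] := IH (p + g)%N.
- by move=> a a1 a2; apply: cell => //; lia.
- by move: tot S2; rewrite S1 -natr1 mulrDl mul1r; lra.
exists (fun i => if i is i'.+1 then x i' else p); split.
  case=> [|i] iK; first by rewrite lp ph.
  have [gx xl] := xG i iK; split => //; lia.
move=> [|j] [|k] jk //; last by rewrite subSS; apply: xgap.
have [_ x0] := xG 0%N isT.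
rewrite subn0; case: k jk => [|k] jk; first by rewrite mul1n; lia.
have := xgap 0%N k.+1; rewrite subn0 => /(_ ltac:(lia)); lia.
Qed.

(** [theta_short] on an interval of length about y / N^6: its logarithmic loss is at most ln (2^8
    N^6) <= 8 + 6 N. *)
Lemma cell_mass (y N a : nat) : (1 <= N)%N -> (4 <= N ^ 6)%N -> (N ^ 6 <= y)%N -> (y < a)%N -> (a <= 64 * y)%N ->
  \sum_(a <= p < a + y %/ N ^ 6 | prime p) ln (p%:R : R)
     <= y%:R / N%:R ^+ 6 * (9 + 6 * N%:R).
Proof.
move=> N1 N6 Ny ya a64; set g := (y %/ N ^ 6)%N.
have N60 : (0 < N ^ 6)%N by lia.
have g0 : (0 < g)%N by rewrite divn_gt0.
have gy : (g * N ^ 6 <= y)%N by exact: leq_divM.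
have yg : (y < g.+1 * N ^ 6)%N by exact: ltn_ceil.
have NR : (1 : R) <= N%:R by rewrite ler1n.
have N0R : (0 : R) < N%:R by lra.
have N6R : (0 : R) < N%:R ^+ 6 by rewrite exprn_gt0.
have g4 : (4 * g <= y)%N by rewrite (leq_trans _ gy)// mulnC leq_mul2l N6 orbT.
have := @theta_short R (a + g).-1 g g0; move=> /(_ ltac:(lia)).
rewrite /theta; have -> : ((a + g).-1 - g).+1 = a by lia.
have -> : (a + g).-1.+1 = (a + g)%N by lia.
move=> /le_trans; apply.
have gR : (0 : R) < g%:R by rewrite ltr0n.
have gle : g%:R <= y%:R / N%:R ^+ 6 :> R.
  by rewrite ler_pdivlMr// -natrX -natrM ler_nat.
have l256 : ln (((a + g).-1)%:R / g%:R) <= 8 + 6 * N%:R :> R.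
  have h : ((a + g).-1)%:R / g%:R <= 256 * N%:R ^+ 6 :> R.
    rewrite ler_pdivrMr// -natrX -!natrM ler_nat.
    have : (y <= 2 * (g * N ^ 6))%N by nia.
    set z := (N ^ 6)%N in N6 Ny gy yg *; nia.
  have pos : 0 < ((a + g).-1)%:R / g%:R :> R by rewrite divr_gt0// ltr0n; lia.
  apply: (@le_trans _ _ (ln (2 ^+ 8 * N%:R ^+ 6))).
    have pos2 : (0 : R) < 2 ^+ 8 * N%:R ^+ 6 by rewrite mulr_gt0// exprn_gt0.
    rewrite ler_ln ?posrE//; apply: le_trans h _.
    by apply: ler_wpM2r; [exact: ltW | rewrite -natrX ler_nat].
  rewrite lnM ?posrE ?exprn_gt0// !lnXn// -[X in X + _ <= _]mulr_natl -[X in _ + X <= _]mulr_natl.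
  apply: lerD.
    by have := @ln_le_sub1 R 2 ltac:(lra); lra.
  apply: ler_wpM2l => //; have := ln_le_sub1 N0R; lra.
apply: ler_pM => //; last by lra.
have : 0 <= ln (((a + g).-1)%:R / g%:R : R); last by lra.
by apply: ln_ge0; rewrite ler_pdivlMr// mul1r ler_nat; lia.
Qed.

Lemma last_below (u : nat -> R) (w : R) N0 : u N0 <= w ->
  (forall M, (N0 <= M)%N -> M%:R <= u M) ->
  exists N, [/\ (N0 <= N)%N, u N <= w & w < u N.+1].
Proof.
move=> u0 ub.
have ex : exists M, w < u (N0 + M)%N.
  exists (Num.truncn w).+1; apply: lt_le_trans (ub _ _); last by lia.
  apply: lt_le_trans (truncnS_gt w) _; by rewrite ler_nat leq_addl.
have [[|M] wM Mmin] := ex_minnP ex; first by move: wM; rewrite addn0; lra.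
exists (N0 + M)%N; split; first exact: leq_addr; last by rewrite -addnS.
rewrite leNgt; apply/negP => /Mmin; lia.
Qed.

Lemma pow4_ln_ge M : (2 <= M)%N -> M%:R <= 32 * M%:R ^+ 4 * ln (M%:R : R).
Proof.
move=> M2; have MR : (1 : R) <= M%:R by rewrite ler1n ltnW.
have l2 : 1 / 2 <= ln (M%:R : R).
  apply: le_trans (ln2_ge R) _; rewrite ler_ln ?posrE ?ltr0n ?ler_nat//.
  exact: ltnW.
have M4 : M%:R <= M%:R ^+ 4 :> R by apply: ler_eXnr.
apply: (@le_trans _ _ (32 * M%:R * (1 / 2))); first lra.
apply: ler_pM; [by rewrite mulr_ge0 | lra | by apply: ler_wpM2l | exact: l2].
Qed.

(* With N^4 ln N of order w, the window contains N^4 + 1 primes, spaced by about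
   64^k / N^6, at which the sum is at most exp (- w / 2); interpolate there. *)
Lemma window_bound (H H1 : R) : 0 <= H -> 0 < H1 ->
  exists k0 : nat, forall (k : nat) (w : R), (k0 <= k)%N ->
  4 * ln k.+1%:R <= w -> w <= k%:R ->
  forall n (c : nat -> R[i]) (mu : nat -> R) (Phi : nat -> R),
  \sum_(j < n) normc (c j) <= H1 -> (forall j, (j < n)%N -> 0 <= mu j <= H) ->
  (forall p, prime p -> (64 ^ k < p <= 64 ^ k.+1)%N -> expR w <= Phi p) ->
  \sum_((64 ^ k).+1 <= p < (64 ^ k.+1).+1 | prime p)
     Phi p / p%:R * normc (expsum n c mu (ln p%:R)) <= H1 ->
  forall t, k%:R * L64 R <= t <= k.+1%:R * L64 R ->
  normc (expsum n c mu t) <= expR (- (w / 1024)).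
Proof.
move=> H0 H10; have L0 := L64_gt0 R.
have [N1 interp] := expsum_interp_asymp H0 L0 H10 (ltr0n R 128 : (0 : R) < 128).
pose N2 := (N1 + 100)%N.
(* 32 = 2 * 16: the condition u N <= w says exp (- w / 2) <= N^(-16 N^4), the nodal bound required
   for interpolation. *)
pose u (N : nat) : R := 32 * N%:R ^+ 4 * ln N%:R.
pose k0 := (4 + Num.truncn (128 * L64 R * H1) + Num.truncn (expR (u N2)))%N.
exists k0 => k w kk wlo whi n c mu Phi cH muH PhiE sumH t tk.
pose f := expsum n c mu.
have k4 : (4 <= k)%N by apply: leq_trans kk; rewrite /k0 -addnA leq_addr.
have kR : (0 : R) < k.+1%:R by [].
have lnk : 0 <= ln (k.+1%:R : R) by apply: ln_ge0; rewrite ler1n.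
have w0 : 0 <= w by apply: le_trans wlo; rewrite mulr_ge0.
have kH : 128 * L64 R * H1 <= k.+1%:R.
  apply: le_trans (ltW (truncnS_gt _)) _; rewrite ler_nat ltnS; apply: leq_trans kk.
  by rewrite /k0 -addnA addnCA leq_addr.
have uN2 : u N2 <= w.
  apply: le_trans wlo; apply: (@le_trans _ _ (ln k.+1%:R)); last by lra.
  rewrite -ler_expR lnK ?posrE//.
  apply: le_trans (ltW (truncnS_gt _)) _; rewrite ler_nat ltnS; apply: leq_trans kk.
  by rewrite /k0 leq_addl.
have ub (M : nat) : (N2 <= M)%N -> M%:R <= u M.
  by move=> M2; apply: pow4_ln_ge; rewrite (leq_trans _ M2)// /N2 (leq_trans _ (leq_addl _ _)).
have [N [NN2 uN uN1]] := last_below uN2 ub.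
have NN1 : (N1 <= N)%N by apply: leq_trans NN2; rewrite leq_addr.
have N100 : (100 <= N)%N by apply: leq_trans NN2; rewrite leq_addl.
clear kk uN2 ub NN2; clear k0; clear N2.
have NR : (100 : R) <= N%:R by rewrite ler_nat.
have N0R : (0 : R) < N%:R by lra.
have N6R : (0 : R) < N%:R ^+ 6 by rewrite exprn_gt0.
have lnN : 1 / 2 <= ln (N%:R : R).
  apply: le_trans (ln2_ge R) _; rewrite ler_ln ?posrE//; lra.
have N4w : N%:R ^+ 4 <= w.
  apply: le_trans uN; rewrite /u.
  have := ler_wpM2l (exprn_ge0 4 (ltW N0R)) lnN; have := exprn_ge0 4 (ltW N0R); lra.
have N4k : (N ^ 4 <= k)%N by rewrite -(ler_nat R) natrX (le_trans N4w).
have y0 : (0 < 64 ^ k)%N by rewrite expn_gt0.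
have yR : (0 : R) < (64 ^ k)%:R by rewrite ltr0n.
have k2 : (k ^ 2 <= 64 ^ k)%N.
  have h : (k <= 2 ^ k)%N by apply: ltnW; exact: ltn_expl.
  apply: (@leq_trans ((2 ^ k) ^ 2)); first by rewrite leq_exp2r.
  by rewrite -expnM mulnC expnM leq_exp2r// (leq_trans _ k4).
have N0n : (0 < N)%N by rewrite (leq_trans _ N100).
have N6y : (N ^ 6 <= 64 ^ k)%N.
  apply: leq_trans k2; apply: (@leq_trans ((N ^ 4) ^ 2)); last by rewrite leq_exp2r.
  by rewrite -expnM leq_exp2l// (leq_trans _ N100).
have N64 : (4 <= N ^ 6)%N.
  apply: (@leq_trans (N ^ 1)); first by rewrite expn1 (leq_trans _ N100).
  by rewrite leq_exp2l// (leq_trans _ N100).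
have lnw p : (64 ^ k < p <= 64 * 64 ^ k)%N -> k%:R * L64 R <= ln p%:R <= k.+1%:R * L64 R.
  by rewrite -expnS; exact: ln_window.
have thw : (64 ^ k)%:R <= theta R (64 ^ k) (64 * 64 ^ k).
  apply: theta_window; have h1 : (32 ^ 4 <= 64 ^ 4)%N by rewrite leq_exp2r.
  have h2 : (64 ^ 4 <= 64 ^ k)%N by rewrite leq_exp2l.
  exact: leq_trans h1 h2.
rewrite expnS in PhiE sumH; clear k2.
move: (64 ^ k)%N y0 yR N6y lnw thw PhiE sumH => y y0 yR N6y lnw thw PhiE sumH.
pose E : R := expR (- (w / 2)).
have EN : E <= (N%:R ^- 16) ^+ (N ^ 4).
  rewrite -[X in X ^- 16]lnK ?posrE// -expRM_natl -expRN -expRM_natl ler_expR natrX.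
  by move: uN; rewrite /u; lra.
pose G p := prime p && (normc (f (ln p%:R)) <= E).
pose m : R := y%:R / N%:R ^+ 6 * (9 + 6 * N%:R).
have m0 : 0 <= m by rewrite mulr_ge0 ?divr_ge0//; lra.
(* Markov's inequality: a prime with |f| > exp (- w / 2) has Phi p |f| >= exp (w / 2), so such
   primes carry mass at most of order k y exp (- w / 2). By w >= 4 ln (k + 1) and the size of k this
   is at most y / 2, half of the mass that the window is known to have. *)
have badsum : \sum_(y.+1 <= p < (64 * y).+1 | prime p && ~~ (normc (f (ln p%:R)) <= E)) ln (p%:R : R) <= y%:R / 2.
  apply: (@le_trans _ _ (\sum_(y.+1 <= p < (64 * y).+1 | prime p)
      (k.+1%:R * L64 R * (64 * y%:R) * expR (- (w / 2))) * (Phi p / p%:R * normc (f (ln p%:R))))).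
    rewrite big_mkcondr /= big_nat_cond [leRHS]big_nat_cond; apply: ler_sum => p /andP[/andP[p1 p2] pp].
    have pk : (y < p <= 64 * y)%N by rewrite p1 -ltnS p2.
    have pR : (0 : R) < p%:R by rewrite ltr0n prime_gt0.
    have Phi0 : 0 <= Phi p by apply: le_trans (PhiE p pp pk); exact: expR_ge0.
    have L1 : 0 <= k.+1%:R * L64 R * (64 * y%:R) * expR (- (w / 2)).
      by rewrite !mulr_ge0 ?expR_ge0// ltW.
    case: ifPn; last by rewrite !mulr_ge0 ?divr_ge0 ?normc_ge0 ?expR_ge0// ltW.
    rewrite -ltNge => fE.
    have /andP[_ lp] := lnw p pk.
    have kL0 : 0 <= k.+1%:R * L64 R by rewrite mulr_ge0// ltW.
    have yp : 1 <= 64 * y%:R / p%:R :> R.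
      by rewrite ler_pdivlMr// mul1r -natrM ler_nat -ltnS.
    have e1 : 1 <= expR (- (w / 2)) * (Phi p * normc (f (ln p%:R))).
      apply: (@le_trans _ _ (expR (- (w / 2)) * (expR w * E))).
        rewrite /E -!expRD (_ : - (w / 2) + (w - w / 2) = 0) ?expR0//; by field.
      apply: ler_wpM2l; first exact: expR_ge0.
      by apply: ler_pM; rewrite ?expR_ge0 ?PhiE// ltW.
    have -> : k.+1%:R * L64 R * (64 * y%:R) * expR (- (w / 2)) * (Phi p / p%:R * normc (f (ln p%:R)))
      = (k.+1%:R * L64 R) * ((64 * y%:R / p%:R) * (expR (- (w / 2)) * (Phi p * normc (f (ln p%:R))))) by ring.
    apply: le_trans lp _; rewrite -[leLHS]mulr1; apply: ler_wpM2l => //.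
    by have := ler_pM ler01 ler01 yp e1; rewrite mulr1.
  rewrite -mulr_sumr; apply: (@le_trans _ _ (k.+1%:R * L64 R * (64 * y%:R) * expR (- (w / 2)) * H1)).
    by apply: ler_wpM2l; [rewrite !mulr_ge0 ?expR_ge0// ltW | ].
  have ew : expR (- (w / 2)) <= k.+1%:R ^- 2.
    rewrite -[X in X ^- 2]lnK ?posrE// -expRM_natl -expRN ler_expR; lra.
  apply: (@le_trans _ _ (k.+1%:R * L64 R * (64 * y%:R) * k.+1%:R ^- 2 * H1)).
    apply: ler_wpM2r; first exact: ltW.
    by apply: ler_wpM2l => //; rewrite !mulr_ge0// ltW.
  have -> : k.+1%:R * L64 R * (64 * y%:R) * k.+1%:R ^- 2 * H1 =
     (128 * L64 R * H1) * (y%:R / 2 / k.+1%:R) by field; rewrite nat1r gt_eqF.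
  have := ler_wpM2r (_ : 0 <= y%:R / 2 / k.+1%:R) kH => /(_ _)/le_trans; apply.
    by rewrite !divr_ge0.
  by apply: le_of_eq; field; rewrite nat1r gt_eqF.
have goodsum : y%:R / 2 <= \sum_(y.+1 <= p < (64 * y).+1 | G p) ln (p%:R : R).
  move: thw.
  rewrite /theta (bigID (fun p => normc (f (ln p%:R)) <= E)) /= /G; lra.
(* N^4 cells account for mass y (9 + 6 N) / N^2, which is below y / 2 because N >= 100. *)
have [|||x [xG xgap]] := @greedy_points G (fun p => ln p%:R) (y %/ N ^ 6)%N (64 * y).+1 m (N ^ 4)%N y.+1 m0.
- by move=> p /andP[/prime_gt0 p0 _]; rewrite ln_ge0// ler1n.
- move=> a a1 a2.
  apply: le_trans (@cell_mass y N a _ N64 N6y a1 _); [|exact: N0n|by rewrite -ltnS].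
  rewrite [leLHS]big_mkcond [leRHS]big_mkcond /=; apply: ler_sum => p _; rewrite /G.
  case: (boolP (prime p)) => //= /prime_gt0 p0; case: ifP => // _.
  by rewrite ln_ge0// ler1n.
- apply: lt_le_trans goodsum; rewrite /m natrX.
  have -> : N%:R ^+ 4 * (y%:R / N%:R ^+ 6 * (9 + 6 * N%:R)) = y%:R * ((9 + 6 * N%:R) / N%:R ^+ 2) :> R.
    by field; rewrite gt_eqF.
  rewrite ltr_pM2l// ltr_pdivrMr ?exprn_gt0// expr2.
  have := ler_wpM2r (ltW N0R) NR; lra.
have xb i : (i < (N ^ 4).+1)%N -> (y < x i <= 64 * y)%N.
  by move=> iN; have [_ /andP[xl xh]] := xG i iN; rewrite xl.
have S1 : k.+1%:R * L64 R = k%:R * L64 R + L64 R by rewrite -natr1 mulrDl mul1r.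
have := interp N NN1 n c mu (k%:R * L64 R) (fun i => ln (x i)%:R) cH muH.
move=> /(_ _ _ _ t _) I.
apply: le_trans (I _ _ _ _) _.
- by move=> i iN; rewrite -S1; apply: lnw; exact: xb.
- move=> j l jl; have xl := xgap j l jl.
  have /andP[jl1 jl2] := jl.
  have /andP[xj1 xj2] := xb j (ltn_trans jl1 jl2); have /andP[xl1 xl2] := xb l jl2.
  have xj0 : (0 : R) < (x j)%:R by rewrite ltr0n (leq_ltn_trans _ xj1).
  have xl0 : (0 : R) < (x l)%:R by rewrite ltr0n (leq_ltn_trans _ xl1).
  have lnd : ((x l)%:R - (x j)%:R) / (x l)%:R <= ln (x l)%:R - ln (x j)%:R :> R.
    have := @ln_le_sub1 R ((x j)%:R / (x l)%:R) ltac:(by rewrite divr_gt0).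
    by rewrite ln_div ?posrE// mulrBl divff ?gt_eqF// => h; rewrite -lerN2 !opprB.
  apply: le_trans lnd.
  (* Rounding the cell length down loses a factor 2, and the logarithm has slope at least 1 / (64 y)
     on the window: this is the constant 128 = 2 * 64. *)
  have gr : (y %/ N ^ 6)%:R >= y%:R / (2 * N%:R ^+ 6) :> R.
    rewrite ler_pdivrMr ?mulr_gt0// -natrX -natrM -natrM ler_nat.
    have N60 : (0 < N ^ 6)%N by rewrite (leq_trans _ N64).
    have := ltn_ceil y N60.
    have : (0 < y %/ N ^ 6)%N by rewrite divn_gt0.
    move: (y %/ N ^ 6)%N (N ^ 6)%N; clear; nia.
  have d1 : (l - j)%:R * (y %/ N ^ 6)%:R <= (x l)%:R - (x j)%:R :> R.
    by rewrite -natrM lerBrDr -natrD ler_nat addnC.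
  have x64 : (x l)%:R <= 64 * y%:R :> R by rewrite -natrM ler_nat.
  have lj0 : 0 <= (l - j)%:R :> R by [].
  apply: (@le_trans _ _ (((l - j)%:R * (y%:R / (2 * N%:R ^+ 6))) / (64 * y%:R))).
    by apply: le_of_eq; field; rewrite !gt_eqF.
  apply: ler_pM.
  - by rewrite mulr_ge0// divr_ge0// mulr_ge0// ltW.
  - by rewrite invr_ge0 mulr_ge0.
  - by apply: le_trans d1; apply: ler_wpM2l.
  - by rewrite lef_pV2 ?posrE// mulr_gt0.
- by move=> i iN; have [/andP[_ fx] _] := xG i iN; apply: le_trans EN.
- by rewrite -S1.
rewrite -[X in X ^- 1]lnK ?posrE// expr1 -expRN -expRM_natl ler_expR natrX.
(* N is the last index with u N <= w, so w < u (N + 1) <= 32 * 16 * 2 N^4 ln N; this is the constant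
   1024. *)
have lnN1 : ln (N.+1%:R : R) <= 2 * ln N%:R.
  rewrite mulr_natl -lnXn// ler_ln ?posrE ?exprn_gt0//.
  by rewrite -natr1 expr2; have := ler_wpM2r (ltW N0R) NR; lra.
have N14 : N.+1%:R ^+ 4 <= 16 * N%:R ^+ 4 :> R.
  have N2 : N.+1%:R <= 2 * N%:R :> R.
    by rewrite -natrM ler_nat mul2n -addnn -addn1 leq_add2l -(ltr0n R).
  have -> : (16 : R) = 2 ^+ 4 by ring.
  by rewrite -exprMn; apply: lerXn2r; rewrite ?nnegrE ?mulr_ge0.
have : u N.+1 <= 1024 * (N%:R ^+ 4 * ln N%:R).
  rewrite /u; apply: (@le_trans _ _ (32 * (16 * N%:R ^+ 4) * (2 * ln N%:R))); last by apply: le_of_eq; ring.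
  apply: ler_pM; [by rewrite mulr_ge0 ?exprn_ge0 | by apply: ln_ge0; rewrite ler1n | | exact: lnN1].
  by apply: ler_wpM2l.
lra.
Qed.

End Window.

(** * The quadratic form and its minimiser *)

Section Calculus.
Variable R : realType.
Implicit Types (t x y mu : R).

Lemma is_derive_sin_scale mu t : is_derive t 1 (fun s => sin (mu * s)) (mu * cos (mu * t)).
Proof.
have d : is_derive t 1 (fun s : R => mu * s) mu.
  by apply: is_derive_eq; rewrite /GRing.scale /= mulr1.
apply: is_derive_eq (@is_derive1_comp R sin (fun s => mu * s) t _ _ (is_derive_sin _) d) _.
by rewrite mulrC.
Qed.

Lemma is_derive_cos_scale mu t : is_derive t 1 (fun s => cos (mu * s)) (- (mu * sin (mu * t))).
Proof.
have d : is_derive t 1 (fun s : R => mu * s) mu.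
  by apply: is_derive_eq; rewrite /GRing.scale /= mulr1.
apply: is_derive_eq (@is_derive1_comp R cos (fun s => mu * s) t _ _ (is_derive_cos _) d) _.
by rewrite mulNr mulrC.
Qed.

Lemma is_derive_bigsum n (h : 'I_n -> R -> R) (dh : 'I_n -> R) t :
  (forall i, is_derive t 1 (h i) (dh i)) ->
  is_derive t 1 (fun s => \sum_(i < n) h i s) (\sum_(i < n) dh i).
Proof.
move=> H; have -> : (fun s => \sum_(i < n) h i s) = \sum_(i < n) h i.
  by apply/funext => s; rewrite fct_sumE.
exact: is_derive_sum.
Qed.

Lemma is_derive_mulc c (h : R -> R) dh t : is_derive t 1 h dh ->
  is_derive t 1 (fun s => c * h s) (c * dh).
Proof. by move=> H; have := @is_deriveZ R R R h c t 1 dh H. Qed.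

Lemma derive_within (G g : R -> R) (i : interval R) : (forall x, is_derive x 1 G (g x)) ->
  {within [set` i], continuous G}.
Proof. by move=> H; apply: derivable_within_continuous => x _; have [] := H x. Qed.

Lemma mvt_bound (G g : R -> R) (M a b : R) : (forall x, is_derive x 1 G (g x)) ->
  a <= b -> (forall x, a <= x <= b -> `|g x| <= M) -> `|G b - G a| <= M * (b - a).
Proof.
move=> dG ab gM.
have [|c cab ->] := MVT_segment ab (fun x _ => dG x); first exact: derive_within.
rewrite normrM [X in _ * X]ger0_norm ?subr_ge0//; apply: ler_wpM2r; first by rewrite subr_ge0.
by apply: gM; move: cab; rewrite in_itv.
Qed.

Lemma mvt_le (G g : R -> R) (a b : R) : (forall x, is_derive x 1 G (g x)) ->
  a <= b -> (forall x, a <= x <= b -> g x <= 0) -> G b <= G a.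
Proof.
move=> dG ab g0.
have [|c cab E] := MVT_segment ab (fun x _ => dG x); first exact: derive_within.
rewrite -subr_le0 E; apply: mulr_le0_ge0; last by rewrite subr_ge0.
by apply: g0; move: cab; rewrite in_itv.
Qed.

(** Antiderivatives of cos (mu t) and sin (mu t) that vanish at t = 0; frequency 0 is the diagonal
    of the quadratic form below. *)
Definition icos mu t : R := if mu == 0 then t else sin (mu * t) / mu.
Definition isin mu t : R := if mu == 0 then 0 else (1 - cos (mu * t)) / mu.

Lemma icos0 mu : icos mu 0 = 0.
Proof. by rewrite /icos; case: ifP => // _; rewrite mulr0 sin0 mul0r. Qed.
Lemma isin0 mu : isin mu 0 = 0.
Proof. by rewrite /isin; case: ifP => // _; rewrite mulr0 cos0 subrr mul0r. Qed.

Lemma is_derive_icos mu t : is_derive t 1 (icos mu) (cos (mu * t)).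
Proof.
rewrite /icos; have [->|m0] := eqVneq mu 0.
  by rewrite mul0r cos0; exact: is_derive_id.
have -> : (fun s => sin (mu * s) / mu) = (fun s => mu^-1 * sin (mu * s)).
  by apply/funext => s; rewrite mulrC.
have := is_derive_mulc mu^-1 (is_derive_sin_scale mu t).
by rewrite mulKf.
Qed.

Lemma is_derive_isin mu t : is_derive t 1 (isin mu) (sin (mu * t)).
Proof.
rewrite /isin; have [->|m0] := eqVneq mu 0.
  by rewrite mul0r sin0; exact: is_derive_cst.
have d : is_derive t 1 (fun s => 1 - cos (mu * s)) (0 - - (mu * sin (mu * t))).
  have := @is_deriveB R R R (cst 1) (fun s => cos (mu * s)) t 1 _ _ (is_derive_cst _ _ _) (is_derive_cos_scale mu t).
  exact.
have -> : (fun s => (1 - cos (mu * s)) / mu) = (fun s => mu^-1 * (1 - cos (mu * s))).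
  by apply/funext => s; rewrite mulrC.
have := is_derive_mulc mu^-1 d.
by rewrite sub0r opprK mulKf.
Qed.

(** On each cell, G minus its tangent at the left node has derivative at most M tau, so a cell costs
    M tau^2. *)
Lemma riemann_error (G g : R -> R) (M tau : R) n : (forall x, is_derive x 1 G (g x)) ->
  0 <= tau -> 0 <= M -> (forall x y, `|g x - g y| <= M * `|x - y|) ->
  `|G (tau *+ n) - G 0 - tau * \sum_(j < n) g (tau *+ j)| <= n%:R * (M * tau ^+ 2).
Proof.
move=> dG tau0 M0 lip; elim: n => [|n IH].
  by rewrite mulr0n subrr big_ord0 mulr0 subrr normr0 mul0r.
rewrite big_ord_recr /= -natr1 mulrDl mul1r.
have -> : G (tau *+ n.+1) - G 0 - tau * (\sum_(i < n) g (tau *+ i) + g (tau *+ n)) =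
  (G (tau *+ n) - G 0 - tau * \sum_(i < n) g (tau *+ i)) +
  ((G (tau *+ n.+1) - tau *+ n.+1 * g (tau *+ n)) - (G (tau *+ n) - tau *+ n * g (tau *+ n))).
  by rewrite mulrS; ring.
apply: le_trans (ler_normD _ _) _; apply: lerD => //.
pose c := g (tau *+ n).
have d x : is_derive x 1 (fun s => G s - s * c) (g x - c).
  have e : (fun s => G s - s * c) = G - (fun s => c * s) by apply/funext => s; rewrite mulrC.
  rewrite e; have := @is_deriveB R R R G (fun s => c * s) x 1 (g x) (c * 1) (dG x) _.
  rewrite mulr1; apply; rewrite -[X in is_derive _ _ _ X]mulr1.
  by apply: is_derive_mulc; exact: is_derive_id.
have h : tau *+ n <= tau *+ n.+1 by rewrite mulrS lerDr.
have := mvt_bound d h (M := M * tau).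
have -> : tau *+ n.+1 - tau *+ n = tau by rewrite mulrS addrK.
rewrite expr2 mulrA; apply => x /andP[x1 x2].
apply: le_trans (lip _ _) _; apply: ler_wpM2l => //.
by rewrite ger0_norm; move: x2; rewrite ?mulrS; lra.
Qed.

Lemma lip_cos mu x y : `|cos (mu * x) - cos (mu * y)| <= `|mu| * `|x - y|.
Proof.
wlog yx : x y / y <= x.
  move=> W; have [yx|/ltW xy] := leP y x; first exact: W.
  by rewrite distrC (distrC x y); exact: W.
have := mvt_bound (is_derive_cos_scale mu) yx (M := `|mu|).
rewrite [X in _ -> _ <= _ * X]ger0_norm ?subr_ge0//; apply => z _.
by rewrite normrN normrM -[leRHS]mulr1; apply: ler_wpM2l => //; exact: sin_max.
Qed.

Lemma lip_sin mu x y : `|sin (mu * x) - sin (mu * y)| <= `|mu| * `|x - y|.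
Proof.
wlog yx : x y / y <= x.
  move=> W; have [yx|/ltW xy] := leP y x; first exact: W.
  by rewrite distrC (distrC x y); exact: W.
have := mvt_bound (is_derive_sin_scale mu) yx (M := `|mu|).
rewrite [X in _ -> _ <= _ * X]ger0_norm ?subr_ge0//; apply => z _.
by rewrite normrM -[leRHS]mulr1; apply: ler_wpM2l => //; exact: cos_max.
Qed.

(** Real part of the sesquilinear form with matrix C + i S. The squared modulus, its integral and
    its Riemann sums all have this shape and differ only in the matrix. *)
Definition gram n (C S : nat -> nat -> R) (b : nat -> R[i]) : R :=
  \sum_(k < n) \sum_(l < n)
    (complex.Re (b k * (b l)^*) * C k l - complex.Im (b k * (b l)^*) * S k l).

Lemma normc_expsum_sqr n b lam t : normc (expsum n b lam t) ^+ 2 =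
  gram n (fun k l => cos ((lam k - lam l) * t)) (fun k l => sin ((lam k - lam l) * t)) b.
Proof.
have E : normc (expsum n b lam t) ^+ 2 =
    complex.Re (expsum n b lam t * (expsum n b lam t)^*) by rewrite mulc_conj.
have E2 : (\sum_(j < n) b j * cis (lam j * t))^* = \sum_(j < n) (b j)^* * cis (- (lam j * t)).
  rewrite (rmorph_sum (@conjc R)); apply: eq_bigr => j _.
  by rewrite -conj_cis; exact: (rmorphM (@conjc R)).
rewrite E; apply: etrans (congr1 (fun w => complex.Re (expsum n b lam t * w)) E2) _.
rewrite /expsum mulr_suml Re_sum; apply: eq_bigr => k _.
rewrite mulr_sumr Re_sum; apply: eq_bigr => l _.
rewrite mulrACA -cisD.
have -> : lam k * t + - (lam l * t) = (lam k - lam l) * t by ring.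
by rewrite /cis; case: (b k * (b l)^*) => u v /=; rewrite mulrC [v * _]mulrC.
Qed.

Lemma is_derive_gram n b lam t :
  is_derive t 1 (fun s => gram n (fun k l => icos (lam k - lam l) s)
       (fun k l => isin (lam k - lam l) s) b) (normc (expsum n b lam t) ^+ 2).
Proof.
rewrite normc_expsum_sqr; apply: is_derive_bigsum => k; apply: is_derive_bigsum => l.
apply: (@is_deriveB R R R (fun s => complex.Re (b k * (b l)^*) * icos (lam k - lam l) s)
   (fun s => complex.Im (b k * (b l)^*) * isin (lam k - lam l) s)).
  by apply: is_derive_mulc; exact: is_derive_icos.
by apply: is_derive_mulc; exact: is_derive_isin.
Qed.

Lemma gram0 n b lam : gram n (fun k l => icos (lam k - lam l) 0)
       (fun k l => isin (lam k - lam l) 0) b = 0.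
Proof.
rewrite /gram big1// => k _; rewrite big1// => l _.
by rewrite icos0 isin0 !mulr0 subrr.
Qed.

Lemma gram_scale n c (C S : nat -> nat -> R) b :
  c * gram n C S b = gram n (fun k l => c * C k l) (fun k l => c * S k l) b.
Proof.
rewrite /gram mulr_sumr; apply: eq_bigr => k _; rewrite mulr_sumr; apply: eq_bigr => l _.
ring.
Qed.

Lemma gram_sum n m (C S : nat -> nat -> nat -> R) b :
  \sum_(j < m) gram n (C j) (S j) b =
  gram n (fun k l => \sum_(j < m) C j k l) (fun k l => \sum_(j < m) S j k l) b.
Proof.
rewrite /gram exchange_big; apply: eq_bigr => k _; rewrite exchange_big; apply: eq_bigr => l _.
by rewrite sumrB !mulr_sumr.
Qed.

Lemma gram_diff_le n (C S C' S' : nat -> nat -> R) b (B e : R) :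
  (forall k, (k < n)%N -> normc (b k) <= B) ->
  (forall k l, (k < n)%N -> (l < n)%N -> `|C k l - C' k l| <= e /\ `|S k l - S' k l| <= e) ->
  `|gram n C S b - gram n C' S' b| <= n%:R ^+ 2 * (2 * B ^+ 2 * e).
Proof.
move=> bB ce; rewrite /gram -sumrB.
have cst (x : R) : \sum_(k < n) \sum_(l < n) x = n%:R ^+ 2 * x.
  by rewrite !sumr_const !card_ord -mulrnA -[LHS]mulr_natl natrM expr2.
rewrite -cst; apply: le_trans (ler_norm_sum _ _ _) _; apply: ler_sum => k _.
rewrite -sumrB; apply: le_trans (ler_norm_sum _ _ _) _; apply: ler_sum => l _.
have [c1 s1] := ce k l (ltn_ord k) (ltn_ord l).
set z := b k * _.
have zB : normc z <= B ^+ 2.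
  by rewrite normcM normc_conj expr2; apply: ler_pM; rewrite ?normc_ge0// bB.
have rz : `|complex.Re z| <= B ^+ 2.
  apply: le_trans zB; rewrite ler_norml Re_le_normc andbT lerNl -normcN.
  by apply: le_trans (Re_le_normc _); case: (z).
have iz : `|complex.Im z| <= B ^+ 2.
  apply: le_trans zB; have <- : normc (- 'i%C * z) = normc z.
    by rewrite normcM normcN /= expr0n expr1n add0r sqrtr1 mul1r.
  have -> : complex.Im z = complex.Re (- 'i%C * z) by case: (z) => u v; simpc.
  set z' := _ * z; rewrite ler_norml Re_le_normc andbT lerNl -normcN.
  by apply: le_trans (Re_le_normc _); case: (z').
have -> : complex.Re z * C k l - complex.Im z * S k l - (complex.Re z * C' k l - complex.Im z * S' k l)
   = complex.Re z * (C k l - C' k l) - complex.Im z * (S k l - S' k l) by ring.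
apply: le_trans (ler_normB _ _) _; rewrite !normrM.
have := ler_pM (normr_ge0 _) (normr_ge0 _) rz c1.
have := ler_pM (normr_ge0 _) (normr_ge0 _) iz s1.
lra.
Qed.

Lemma FTC_everywhere (G g : R -> R) (H : R) : 0 < H -> (forall x, is_derive x 1 G (g x)) ->
  (forall x, {for x, continuous g}) ->
  (\int[lebesgue_measure]_(t in `[0, H]) g t)%R = G H - G 0.
Proof.
move=> H0 dG cg; rewrite /Rintegral.
have dd x : derivable G x 1 by have [] := dG x.
have cG x : {for x, continuous G}.
  by apply/differentiable_continuous/derivable1_diffP.
rewrite (@continuous_FTC2 R g G 0 H H0)//.
- by apply: continuous_subspaceT => x; exact: cg.
- split; first by move=> x _; exact: dd.
    by apply: cvg_at_right_filter; exact: cG.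
  by apply: cvg_at_left_filter; exact: cG.
- by move=> x _; rewrite derive1E; have [_ ->] := dG x.
Qed.

End Calculus.

(** * The norm as a quadratic form in finitely many coefficients *)

Section Dirichlet.
Variable R : realType.
Implicit Types (a b : nat -> R[i]) (Phi : nat -> R) (H t : R).

Definition lnn (k : nat) : R := ln k%:R.

(* Index 0 carries the constant term: lnn 0 = 0 because ln vanishes at 0. *)
Definition coef a (k : nat) : R[i] :=
  if k == 0%N then 1 else if prime k then a k * (k%:R^-1)%:C else 0.

Lemma lnn0 : lnn 0 = 0. Proof. by rewrite /lnn ln0. Qed.

Lemma lnn_ge0 k : 0 <= lnn k.
Proof. by case: k => [|k]; rewrite ?lnn0// ln_ge0// ler1n. Qed.

Lemma cpowR_prime p t : prime p -> cpowR p%:R ((- 1) +i* t) = (p%:R^-1)%:C * cis (lnn p * t).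
Proof.
move=> pp; have p0 : (0 : R) < p%:R by rewrite ltr0n prime_gt0.
rewrite /cpowR /expC /cis /lnn /real_complex_def /=.
rewrite !(mulr0, mul0r, subr0, add0r, addr0) mulN1r expRN lnK ?posrE//.
by rewrite [t * _]mulrC.
Qed.

Lemma primeDirichletE a N t : primeDirichlet a N t = expsum N.+1 (coef a) lnn t.
Proof.
rewrite /primeDirichlet /expsum big_mkcond /= big_ord_recl /= add0r [RHS]big_ord_recl.
rewrite lnn0 mul0r cis0 /coef /= mulr1; congr (_ + _); apply: eq_bigr => i _.
rewrite /bump /= add1n; case: ifPn => pp; last by rewrite mul0r.
by rewrite cpowR_prime// mulrA.
Qed.

Definition icos_mx H k l : R := icos (lnn k - lnn l) H.
Definition isin_mx H k l : R := isin (lnn k - lnn l) H.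

Lemma sqnormE H a N : 0 < H ->
  sqnorm H a N = gram N.+1 (icos_mx H) (isin_mx H) (coef a).
Proof.
move=> H0; rewrite /sqnorm.
have -> : (fun t => normc (primeDirichlet a N t) ^+ 2) = (fun t => normc (expsum N.+1 (coef a) lnn t) ^+ 2).
  by apply/funext => t; rewrite primeDirichletE.
rewrite (FTC_everywhere H0 (@is_derive_gram R N.+1 (coef a) lnn)).
  by rewrite gram0 subr0.
move=> x.
have -> : (fun t => normc (expsum N.+1 (coef a) lnn t) ^+ 2) =
   (fun t => gram N.+1 (fun k l => cos ((lnn k - lnn l) * t)) (fun k l => sin ((lnn k - lnn l) * t)) (coef a)).
  by apply/funext => t; rewrite normc_expsum_sqr.
apply/differentiable_continuous/derivable1_diffP.
have [] // : is_derive x 1 (fun t => gram N.+1 (fun k l => cos ((lnn k - lnn l) * t)) (fun k l => sin ((lnn k - lnn l) * t)) (coef a))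
  (\sum_(k < N.+1) \sum_(l < N.+1) (complex.Re (coef a k * (coef a l)^*) * (- ((lnn k - lnn l) * sin ((lnn k - lnn l) * x)))
    - complex.Im (coef a k * (coef a l)^*) * ((lnn k - lnn l) * cos ((lnn k - lnn l) * x)))).
apply: is_derive_bigsum => k; apply: is_derive_bigsum => l.
apply: (@is_deriveB R R R (fun s => complex.Re (coef a k * (coef a l)^*) * cos ((lnn k - lnn l) * s))
   (fun s => complex.Im (coef a k * (coef a l)^*) * sin ((lnn k - lnn l) * s))).
  by apply: is_derive_mulc; exact: is_derive_cos_scale.
by apply: is_derive_mulc; exact: is_derive_sin_scale.
Qed.

Lemma continuous_bigsum (T : topologicalType) (I : Type) (r : seq I) (h : I -> T -> R) :
  (forall i, continuous (h i)) -> continuous (fun v => \sum_(i <- r) h i v).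
Proof.
move=> ch; elim: r => [|i r IH].
  have -> : (fun v : T => \sum_(i <- [::]) h i v) = cst 0 by apply/funext => v; rewrite big_nil.
  by move=> v; exact: cvg_cst.
have -> : (fun v : T => \sum_(i <- i :: r) h i v) = (fun v => h i v + \sum_(i <- r) h i v).
  by apply/funext => v; rewrite big_cons.
by move=> v; apply: cvgD; [exact: ch | exact: IH].
Qed.

Lemma contD (T : topologicalType) (f g : T -> R) : continuous f -> continuous g ->
  continuous (fun v => f v + g v).
Proof. by move=> cf cg v; exact: cvgD (cf v) (cg v). Qed.

Lemma contB (T : topologicalType) (f g : T -> R) : continuous f -> continuous g ->
  continuous (fun v => f v - g v).
Proof. by move=> cf cg v; exact: cvgB (cf v) (cg v). Qed.

Lemma contM (T : topologicalType) (f g : T -> R) : continuous f -> continuous g ->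
  continuous (fun v => f v * g v).
Proof. by move=> cf cg v; exact: cvgM (cf v) (cg v). Qed.

Lemma cont_cst (T : topologicalType) (x : R) : continuous (fun _ : T => x).
Proof. by move=> v; exact: cvg_cst. Qed.

(** Extreme value theorem on real row vectors whose first half holds real parts and whose second
    half holds imaginary parts; coordinates off the primes are forced to 0. With C and S arbitrary,
    it serves the integral and its Riemann sums alike. *)
Lemma gram_min N (C S : nat -> nat -> R) Phi : (forall p, prime p -> 0 < Phi p) ->
  exists2 a, admissible Phi N a & forall a', admissible Phi N a' ->
    gram N.+1 C S (coef a) <= gram N.+1 C S (coef a').
Proof.
move=> Phi0.
pose V := 'rV[R]_(N.+1 + N.+1).
pose re (v : V) k : R := v ord0 (lshift N.+1 (inord k)).
pose im (v : V) k : R := v ord0 (rshift N.+1 (inord k)).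
pose aof (v : V) k : R[i] := re v k +i* im v k.
pose B (k : nat) : R := if prime k then Phi k else 0.
have B0 k : 0 <= B k by rewrite /B; case: ifP => // /Phi0/ltW.
pose M : R := \sum_(k < N.+1) B k.
have BM k : (k < N.+1)%N -> B k <= M.
  by move=> kN; rewrite /M (bigD1 (Ordinal kN))//= lerDl sumr_ge0.
pose box : set V := [set v | forall i, v ord0 i \in `[- M, M]].
pose disc (k : 'I_N.+1) : set V := [set v | re v k ^+ 2 + im v k ^+ 2 <= B k ^+ 2].
pose A : set V := box `&` \bigcap_(k in setT) disc k.
have cbox : compact box.
  apply: (@rV_compact _ _ (fun=> `[- M, M]%classic)) => _; exact: segment_compact.
have cre k : continuous (fun v : V => re v k) by exact: coord_continuous.
have cim k : continuous (fun v : V => im v k) by exact: coord_continuous.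
have cA : compact A.
  apply: (subclosed_compact _ cbox); last by move=> v [].
  apply: closedI; first exact: compact_closed.
  apply: closed_bigI => k _.
  have -> : disc k = (fun v : V => re v k ^+ 2 + im v k ^+ 2) @^-1` [set x | x <= B k ^+ 2] by [].
  apply: preimage_closed; last exact: closed_le.
  move=> v _; have -> : (fun v : V => re v k ^+ 2 + im v k ^+ 2) = (fun v => re v k * re v k + im v k * im v k).
    by apply/funext => u; rewrite !expr2.
  exact: (contD (contM (cre k) (cre k)) (contM (cim k) (cim k))).
have A0 : A !=set0.
  exists 0; split.
    move=> i /=; rewrite mxE in_itv /=; have M0 : 0 <= M by exact: sumr_ge0.
    by rewrite oppr_le0 M0.
  by move=> k _; rewrite /disc /= /re /im !mxE expr0n addr0 exprn_ge0.
pose f (v : V) : R := gram N.+1 C S (coef (aof v)).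
have cf : continuous f.
  have cr j : continuous (fun v => complex.Re (coef (aof v) j)).
    rewrite /coef; case: (j == 0%N); first exact: cont_cst.
    case: (prime j); last exact: cont_cst.
    have -> : (fun v => complex.Re (aof v j * (j%:R^-1)%:C)) = (fun v => re v j * j%:R^-1).
      by apply/funext => w; rewrite mulrC ReM_real mulrC.
    exact: (contM (cre j) (@cont_cst _ _)).
  have ci j : continuous (fun v => complex.Im (coef (aof v) j)).
    rewrite /coef; case: (j == 0%N); first exact: cont_cst.
    case: (prime j); last exact: cont_cst.
    have -> : (fun v => complex.Im (aof v j * (j%:R^-1)%:C)) = (fun v => im v j * j%:R^-1).
      by apply/funext => w; rewrite mulrC ImM_real mulrC.
    exact: (contM (cim j) (@cont_cst _ _)).
  have ckl (k l : nat) : continuous (fun v => complex.Re (coef (aof v) k * (coef (aof v) l)^*) * C k l -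
    complex.Im (coef (aof v) k * (coef (aof v) l)^*) * S k l).
    have -> : (fun v => complex.Re (coef (aof v) k * (coef (aof v) l)^*) * C k l -
    complex.Im (coef (aof v) k * (coef (aof v) l)^*) * S k l) =
   (fun v => (complex.Re (coef (aof v) k) * complex.Re (coef (aof v) l) + complex.Im (coef (aof v) k) * complex.Im (coef (aof v) l)) * C k l
     - (complex.Im (coef (aof v) k) * complex.Re (coef (aof v) l) - complex.Re (coef (aof v) k) * complex.Im (coef (aof v) l)) * S k l).
      by apply/funext => w; case: (coef _ k) => x1 y1; case: (coef _ l) => x2 y2; simpc => /=; ring.
    exact: (contB (contM (contD (contM (cr k) (cr l)) (contM (ci k) (ci l))) (@cont_cst _ _))
      (contM (contB (contM (ci k) (cr l)) (contM (cr k) (ci l))) (@cont_cst _ _))).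
  exact: (continuous_bigsum (h := fun (k : 'I_N.+1) v => \sum_(l < N.+1) _)
    (fun k => continuous_bigsum (h := fun (l : 'I_N.+1) v => _) (fun l => ckl k l))).
have [v vA vmin] := EVT_min_rV A0 cA (continuous_subspaceT cf).
exists (aof v).
  move=> p pp pN; move: vA; rewrite inE => -[_ /(_ (inord p) I)].
  rewrite /disc /= inordK ?ltnS// /B pp => h.
  have : normc (aof v p) ^+ 2 <= Phi p ^+ 2 by rewrite normcE_sqr.
  by rewrite ler_sqr ?nnegrE ?normc_ge0//; exact/ltW/Phi0.
move=> a' adm.
pose w : V := row_mx (\row_k (if prime (k : 'I_N.+1) then complex.Re (a' k) else 0))
                     (\row_k (if prime (k : 'I_N.+1) then complex.Im (a' k) else 0)).
have rew k : (k < N.+1)%N -> re w k = if prime k then complex.Re (a' k) else 0.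
  by move=> kN; rewrite /re /w row_mxEl mxE inordK.
have imw k : (k < N.+1)%N -> im w k = if prime k then complex.Im (a' k) else 0.
  by move=> kN; rewrite /im /w row_mxEr mxE inordK.
have dw (k : 'I_N.+1) : disc k w.
  rewrite /disc /= rew// imw// /B; case: ifPn => pp; last by rewrite expr0n addr0.
  rewrite -normcE_sqr ler_sqr ?nnegrE ?normc_ge0//; last exact/ltW/Phi0.
  by apply: adm => //; rewrite -ltnS.
have wA : w \in A.
  rewrite inE; split; last by move=> k _; exact: dw.
  have sq (k : 'I_N.+1) : `|re w k| <= M /\ `|im w k| <= M.
    have := dw k; rewrite /disc /= => h; have M0 : 0 <= M by exact: sumr_ge0.
    have bm := BM k (ltn_ord k).
    have r2 := sqr_ge0 (re w k); have i2 := sqr_ge0 (im w k).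
    by split; apply: le_trans bm; rewrite -ler_sqr ?nnegrE// real_normK ?num_real//; lra.
  move=> i; rewrite in_itv /= -ler_norml; case: (splitP i) => j ij.
    by have [h _] := sq j; move: h; rewrite /re inord_val; congr (`|w _ _| <= _); apply: val_inj.
  by have [_ h] := sq j; move: h; rewrite /im inord_val; congr (`|w _ _| <= _); apply: val_inj.
have -> : gram N.+1 C S (coef a') = f w; last exact: vmin.
rewrite /f /gram; apply: eq_bigr => k _; apply: eq_bigr => l _.
have ce j : (j < N.+1)%N -> coef a' j = coef (aof w) j.
  move=> jN; rewrite /coef; case: ifP => // _; case: ifPn => // pj.
  by rewrite /aof rew// imw// pj; case: (a' j).
by rewrite !ce.
Qed.

Definition riemann_norm H n N a : R :=
  H / n%:R * \sum_(j < n) normc (expsum N.+1 (coef a) lnn (H / n%:R *+ j)) ^+ 2.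

Lemma riemann_normE H n N a : riemann_norm H n N a =
  gram N.+1 (fun k l => H / n%:R * \sum_(j < n) cos ((lnn k - lnn l) * (H / n%:R *+ j)))
    (fun k l => H / n%:R * \sum_(j < n) sin ((lnn k - lnn l) * (H / n%:R *+ j))) (coef a).
Proof.
rewrite /riemann_norm; under eq_bigr do rewrite normc_expsum_sqr.
by rewrite (@gram_sum R N.+1 n (fun j k l => cos ((lnn k - lnn l) * (H / n%:R *+ j)))
    (fun j k l => sin ((lnn k - lnn l) * (H / n%:R *+ j)))) gram_scale.
Qed.

(** Admissible coefficients are uniformly bounded, and each matrix entry is a Riemann sum of a
    function with Lipschitz constant at most ln (N + 1). That K depends on N is harmless, since n is
    chosen after N. *)
Lemma riemann_norm_cvg H N Phi : 0 < H -> (forall p, prime p -> 0 < Phi p) ->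
  exists2 K : R, 0 <= K & forall n a, (0 < n)%N -> admissible Phi N a ->
   `|sqnorm H a N - riemann_norm H n N a| <= K / n%:R.
Proof.
move=> H0 Phi0.
pose B : R := 1 + \sum_(p < N.+1 | prime p) Phi p.
have BB : 0 <= \sum_(p < N.+1 | prime p) Phi p by apply: sumr_ge0 => p /Phi0/ltW.
pose L := lnn N.+1; have L0 : 0 <= L by exact: lnn_ge0.
pose K := N.+1%:R ^+ 2 * (2 * B ^+ 2 * (L * H ^+ 2)).
have B0 : 0 <= B by rewrite addr_ge0.
exists K.
  apply: mulr_ge0; first exact: exprn_ge0.
  apply: mulr_ge0; first by apply: mulr_ge0 => //; exact: exprn_ge0.
  by apply: mulr_ge0 => //; apply: exprn_ge0; exact: ltW.
move=> n a n0 adm; have nR : (0 : R) < n%:R by rewrite ltr0n.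
rewrite sqnormE// riemann_normE.
have -> : K / n%:R = N.+1%:R ^+ 2 * (2 * B ^+ 2 * (L * H ^+ 2 / n%:R)) by rewrite /K !mulrA.
apply: gram_diff_le.
  move=> k kN; rewrite /coef; case: ifPn => k0; first by rewrite normc1 /B lerDl.
  case: ifPn => pk; last by rewrite normc0 addr_ge0.
  rewrite normcM normc_real ger0_norm ?invr_ge0//.
  apply: (@le_trans _ _ (Phi k)).
    have h1 : normc (a k) <= Phi k by apply: adm.
    have h2 : (k%:R)^-1 <= 1 :> R by rewrite invf_le1 ?ler1n ?ltr0n prime_gt0.
    have i0 : 0 <= (k%:R : R)^-1 by rewrite invr_ge0.
    by have := ler_pM (normc_ge0 (a k)) i0 h1 h2; rewrite mulr1.
  rewrite /B (bigD1 (Ordinal kN))//= addrCA lerDl addr_ge0// sumr_ge0//.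
  by move=> p /andP[/Phi0/ltW].
move=> k l kN lN.
have Lk m : (m < N.+1)%N -> lnn m <= L.
  case: m => [|m] mN; first by rewrite lnn0.
  by rewrite /L /lnn ler_ln ?posrE ?ltr0n// ler_nat ltnW.
have d1 : `|lnn k - lnn l| <= L.
  rewrite ler_norml; have := Lk k kN; have := Lk l lN; have := lnn_ge0 k; have := lnn_ge0 l; lra.
have Hn : H / n%:R *+ n = H by rewrite -mulr_natr mulfVK// gt_eqF.
have tau0 : 0 <= H / n%:R by rewrite divr_ge0// ltW.
have fin (G g : R -> R) : (forall x : R, is_derive x 1 G (g x)) -> G 0 = 0 ->
   (forall x y, `|g x - g y| <= `|lnn k - lnn l| * `|x - y|) ->
   `|G H - H / n%:R * \sum_(j < n) g (H / n%:R *+ j)| <= L * H ^+ 2 / n%:R.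
  move=> dG G0 lip; have := riemann_error n dG tau0 L0 _.
  rewrite Hn G0 subr0 => /(_ _)/le_trans; apply.
    move=> x y; apply: le_trans (lip x y) _; exact: ler_wpM2r.
  by apply: le_of_eq; field; rewrite gt_eqF.
split.
  by apply: (fin _ _ (is_derive_icos _)); [exact: icos0 | exact: lip_cos].
by apply: (fin _ _ (is_derive_isin _)); [exact: isin0 | exact: lip_sin].
Qed.

End Dirichlet.

(** * First-order conditions at the minimiser *)

Section Dual.
Variable R : realType.
Implicit Types (a b c : nat -> R[i]) (Phi : nat -> R) (H : R).

Lemma normc_sqr_comb (z w : R[i]) (e : R) :
  normc (z + e%:C * w) ^+ 2 = normc z ^+ 2 + e * (2 * complex.Re (w * z^*)) + e ^+ 2 * normc w ^+ 2.
Proof.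
rewrite !normcE_sqr; case: z => x y; case: w => u v; simpc => /=; ring.
Qed.

Lemma quad_first_order (X Y : R) : 0 <= Y ->
  (forall e, 0 < e <= 1 -> 0 <= e * X + e ^+ 2 * Y) -> 0 <= X.
Proof.
move=> Y0 h; rewrite leNgt; apply/negP => X0.
pose e := - X / (Y - X + 1).
have D0 : 0 < Y - X + 1 by lra.
have e0 : 0 < e by rewrite divr_gt0//; lra.
have e1 : e <= 1 by rewrite ler_pdivrMr//; lra.
have := h e; rewrite e0 e1 => /(_ isT).
rewrite expr2 -mulrA -mulrDr pmulr_rge0// => h1.
have : e * Y < - X.
  rewrite /e mulrAC ltr_pdivrMr// ltr_pM2l; lra.
lra.
Qed.

(* c is H / n times the conjugate of the minimal sum at the nodes j H / n, and
   the last inequality is first-order optimality tested against the phases of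
   a that align the sum over the primes. *)
Lemma dual_certificate H N Phi n : 0 < H -> (forall p, prime p -> 0 < Phi p) -> (0 < n)%N ->
  exists a c, [/\ admissible Phi N a,
    \sum_(j < n) normc (c j) <= H &
    riemann_norm H n N a + \sum_(p < N.+1 | prime p)
       Phi p / p%:R * normc (expsum n c (fun j => H / n%:R *+ j) (lnn R p))
     <= normc (expsum n c (fun j => H / n%:R *+ j) 0)].
Proof.
move=> H0 Phi0 n0; have nR : (0 : R) < n%:R by rewrite ltr0n.
pose tau := H / n%:R; have tau0 : 0 <= tau by rewrite divr_ge0// ltW.
have tn : tau *+ n = H by rewrite -mulr_natr mulfVK// gt_eqF.
have [a adm amin] := @gram_min R N
  (fun k l => tau * \sum_(j < n) cos ((lnn R k - lnn R l) * (tau *+ j)))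
  (fun k l => tau * \sum_(j < n) sin ((lnn R k - lnn R l) * (tau *+ j))) Phi Phi0.
have {}amin a' : admissible Phi N a' -> riemann_norm H n N a <= riemann_norm H n N a'.
  by move=> /amin; rewrite !riemann_normE.
pose F b j := expsum N.+1 (coef b) (@lnn R) (tau *+ j).
pose c j : R[i] := tau%:C * (F a j)^*.
pose f := expsum n c (fun j => tau *+ j).
(* Comparison with a = 0. This bound on the minimum yields the bound on the total mass of c. *)
have Da0 : riemann_norm H n N a <= H.
  have adm0 : admissible Phi N (fun=> 0) by move=> p pp _; rewrite normc0 ltW// Phi0.
  apply: le_trans (amin _ adm0) _; rewrite /riemann_norm -/tau.
  rewrite (eq_bigr (fun=> 1)) ?sumr_const ?card_ord ?mulr_natr ?tn// => j _.
  rewrite /expsum big_ord_recl /= lnn0 mul0r cis0 mulr1 big1 ?addr0 ?normc1 ?expr1n// => i _.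
  by rewrite /coef /=; case: ifP; rewrite ?mul0r.
(* Optimality on a convex set: moving from a towards b by e keeps admissibility and changes the
   value by e X + e^2 Y, whence X >= 0. *)
have first b : admissible Phi N b ->
    riemann_norm H n N a <= tau * \sum_(j < n) complex.Re (F b j * (F a j)^*).
  move=> admb.
  pose X := tau * \sum_(j < n) (2 * complex.Re ((F b j - F a j) * (F a j)^*)).
  pose Y := tau * \sum_(j < n) normc (F b j - F a j) ^+ 2.
  have Y0 : 0 <= Y by rewrite mulr_ge0// sumr_ge0// => j _; rewrite exprn_ge0// normc_ge0.
  have X0 : 0 <= X.
    apply: (quad_first_order Y0) => e /andP[e0 e1].
    pose a' k := a k + e%:C * (b k - a k).
    have adm' : admissible Phi N a'.
      move=> p pp pN; have -> : a' p = (1 - e)%:C * a p + e%:C * b p.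
        by rewrite /a' rmorphB rmorph1; ring.
      apply: le_trans (le_normcD _ _) _; rewrite !normcM !normc_real !ger0_norm; [|lra|lra].
      have := adm p pp pN; have := admb p pp pN => h1 h2.
      have e1' : 0 <= 1 - e by lra.
      have := ler_wpM2l (ltW e0) h1; have := ler_wpM2l e1' h2; lra.
    have FE j : F a' j = F a j + e%:C * (F b j - F a j).
      rewrite /F /expsum -sumrB mulr_sumr -big_split /=; apply: eq_bigr => k _.
      rewrite /coef /a'; case: ifP => _; first by ring.
      by case: ifP => _; ring.
    have := amin _ adm'; rewrite /riemann_norm -/tau.
    have -> : \sum_(j < n) normc (expsum N.+1 (coef a') (@lnn R) (tau *+ j)) ^+ 2 =
      \sum_(j < n) (normc (F a j) ^+ 2 + e * (2 * complex.Re ((F b j - F a j) * (F a j)^*)) + e ^+ 2 * normc (F b j - F a j) ^+ 2).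
      by apply: eq_bigr => j _; rewrite -/(F a' j) FE normc_sqr_comb.
    rewrite !big_split /= -!mulr_sumr /X /Y -!mulr_sumr.
    set s1 := \sum_(j < n) _; set s2 := \sum_(j < n) _; set s3 := \sum_(j < n) _.
    rewrite /s1 /F; lra.
  move: X0; rewrite /X -mulr_sumr.
  have -> : \sum_(j < n) complex.Re ((F b j - F a j) * (F a j)^*) =
     \sum_(j < n) complex.Re (F b j * (F a j)^*) - \sum_(j < n) normc (F a j) ^+ 2.
    rewrite -sumrB; apply: eq_bigr => j _.
    rewrite normcE_sqr; case: (F a j) => x y; case: (F b j) => u v; simpc => /=; ring.
  rewrite /riemann_norm -/tau /F; lra.
exists a, c; split => //.
  (* By |F| <= (1 + |F|^2) / 2 the mass is at most (H + minimum) / 2 <= H. *)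
  apply: (@le_trans _ _ (\sum_(j < n) (tau * (1 + normc (F a j) ^+ 2) / 2))).
    apply: ler_sum => j _; rewrite normcM normc_real normc_conj ger0_norm// -mulrA.
    apply: ler_wpM2l => //; have := sqr_ge0 (normc (F a j) - 1); rewrite sqrrB; lra.
  rewrite -mulr_suml -mulr_sumr big_split /= sumr_const card_ord mulrDr mulr_natr tn.
  move: Da0; rewrite /riemann_norm -/tau /F; lra.
have /choice [w wP] : forall p, exists w : R[i],
    normc w = 1 /\ w * f (lnn R p) = (normc (f (lnn R p)))%:C.
  by move=> p; have [w w1 w2] := normc_rotate (f (lnn R p)); exists w.
pose b p : R[i] := - (Phi p)%:C * w p.
have admb : admissible Phi N b.
  move=> p pp pN; rewrite /b normcM normcN normc_real (wP p).1 mulr1 ger0_norm//.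
  exact/ltW/Phi0.
have E : tau * \sum_(j < n) complex.Re (F b j * (F a j)^*) =
    complex.Re (f 0) - \sum_(p < N.+1 | prime p) Phi p / p%:R * normc (f (lnn R p)).
  have E1 : tau * \sum_(j < n) complex.Re (F b j * (F a j)^*) = complex.Re (\sum_(k < N.+1) coef b k * f (lnn R k)).
    rewrite mulr_sumr; under eq_bigr do rewrite -ReM_real mulrCA.
    rewrite -Re_sum; congr complex.Re.
    rewrite /f /expsum; under [RHS]eq_bigr do rewrite mulr_sumr.
    rewrite exchange_big; apply: eq_bigr => j _.
    rewrite -/(c j) /F /expsum mulr_suml; apply: eq_bigr => k _.
    rewrite mulrAC -mulrA; congr (_ * (_ * _)).
    by congr cis; rewrite mulrC.
  rewrite E1 big_ord_recl ReD {1}/coef /= mul1r lnn0.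
  congr (_ + _); rewrite [in RHS]big_mkcond /= [in RHS]big_ord_recl /= add0r -sumrN Re_sum.
  apply: eq_bigr => i _; rewrite /bump /= add1n /coef /=; case: ifP => pp; last by rewrite mul0r oppr0.
  rewrite /b.
  have -> : - (Phi i.+1)%:C * w i.+1 * (i.+1%:R^-1)%:C * f (lnn R i.+1) =
    (- (Phi i.+1 / i.+1%:R))%:C * (w i.+1 * f (lnn R i.+1)).
    by rewrite rmorphN rmorphM; ring.
  by rewrite (wP i.+1).2 -rmorphM /= mulNr.
have := first b admb; rewrite E -/tau => h.
have := Re_le_normc (f 0); rewrite /f; rewrite /f in h; lra.
Qed.

End Dual.

(** * Divergence forces a vanishing minimum *)

Section Blocks.
Variable R : realType.

Lemma cos_half (t : R) : 2 - 2 * cos t = 4 * sin (t / 2) ^+ 2.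
Proof.
have tt : t = (t / 2) *+ 2 by rewrite mulr2n; field.
rewrite {1}tt cos_mulr2n cos2sin2 mulr2n; ring.
Qed.

Lemma sin_le_id (y : R) : 0 <= y -> `|sin y| <= y.
Proof.
move=> y0; have := lip_sin 1 y 0; rewrite !mul1r sin0 !subr0 normr1 mul1r.
by rewrite [in X in _ <= X -> _]ger0_norm.
Qed.

Lemma cos_dist_le (t : R) : 0 <= t -> 2 - 2 * cos t <= t ^+ 2.
Proof.
move=> t0; rewrite cos_half.
have t20 : 0 <= t / 2 by lra.
have h := sin_le_id t20.
have : `|sin (t / 2)| ^+ 2 <= (t / 2) ^+ 2.
  by apply: lerXn2r; rewrite ?nnegrE ?normr_ge0 ?h//; lra.
rewrite real_normK ?num_real// expr_div_n; lra.
Qed.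

(** A weak Jordan inequality: y / 2 on [0, 1] from the derivative, and beyond 1 the value sin 1 >=
    1/2 suffices, as y < 2. *)
Lemma sin_ge_quarter (y : R) : 0 <= y <= pi / 2 -> y / 4 <= sin y.
Proof.
move=> /andP[y0 yp].
have small (x : R) : 0 <= x <= 1 -> x / 2 <= sin x.
  move=> /andP[x0 x1].
  have d (s : R) : is_derive s 1 (fun s : R => 2^-1 * s - sin (1 * s)) (2^-1 * 1 - 1 * cos (1 * s)).
    apply: (@is_deriveB R R R (fun s => 2^-1 * s) (fun s => sin (1 * s))).
    exact: is_derive_sin_scale.
  have := mvt_le d x0; rewrite !mul1r mulr0 sin0 subr0.
  have h : forall s : R, 0 <= s <= x -> 2^-1 * 1 - 1 * cos (1 * s) <= 0.
    move=> s /andP[s0 sx]; rewrite !mul1r mulr1.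
    have := cos_dist_le s0; have : s ^+ 2 <= 1 by rewrite expr_le1//; lra.
    lra.
  by move=> /(_ h); lra.
have [y1|y1] := leP y 1; first by have := small y; rewrite y0 y1 => /(_ isT); lra.
have s1 : 1 / 2 <= sin 1 :> R by apply: small; rewrite ler01 lexx.
have : sin 1 <= sin y.
  apply: ltW; rewrite ltr_sin//; rewrite in_itv /=.
    by have := @pihalf_ge1 R; have := @pi_gt0 R; lra.
  by have := @pi_gt0 R; lra.
have := @pihalf_lt2 R; lra.
Qed.

Lemma cos_dist_ge (t : R) : 0 <= t <= pi -> t ^+ 2 / 16 <= 2 - 2 * cos t.
Proof.
move=> /andP[t0 tp]; rewrite cos_half.
have h : t / 2 / 4 <= sin (t / 2) by apply: sin_ge_quarter; lra.
have : (t / 2 / 4) ^+ 2 <= sin (t / 2) ^+ 2.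
  by apply: lerXn2r; rewrite ?nnegrE; lra.
rewrite !expr_div_n; lra.
Qed.

Lemma prod1D_ge (I : Type) (r : seq I) (x : I -> R) : (forall i, 0 <= x i) ->
  1 + \sum_(i <- r) x i <= \prod_(i <- r) (1 + x i).
Proof.
move=> x0; elim: r => [|i r IH]; first by rewrite !big_nil addr0.
rewrite !big_cons; have xi := x0 i.
have s0 : 0 <= \sum_(j <- r) x j by exact: sumr_ge0.
apply: (@le_trans _ _ ((1 + x i) * (1 + \sum_(j <- r) x j))).
  have := mulr_ge0 xi s0; lra.
by apply: ler_wpM2l => //; lra.
Qed.

Definition expsum_poly n (c : nat -> R[i]) : {poly R[i]} := \sum_(j < n) c j *: 'X^j.

Lemma expsum_polyE n c (u : R[i]) : (expsum_poly n c).[u] = \sum_(j < n) c j * u ^+ j.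
Proof. by rewrite horner_sum; apply: eq_bigr => j _; rewrite hornerZ hornerXn. Qed.

Lemma normc_conjc (z : R[i]) : normc (conjc z) = normc z.
Proof. exact: normc_conj. Qed.

Lemma expsum_poly_cis n c tau (x : R) :
  (expsum_poly n c).[cis (tau * x)] = expsum n c (fun j => tau *+ j) x.
Proof.
rewrite expsum_polyE; apply: eq_bigr => j _; rewrite cisX; congr (_ * cis _).
by rewrite -mulr_natl; ring.
Qed.

Lemma expsum_poly_conj n c (u : R[i]) :
  (expsum_poly n (fun j => conjc (c j))).[u] = conjc ((expsum_poly n c).[conjc u]).
Proof.
rewrite !expsum_polyE (rmorph_sum (@conjc R)); apply: eq_bigr => j _.
rewrite (rmorphM (@conjc R)) (rmorphXn (@conjc R)); congr (_ * _ ^+ _).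
by rewrite /= conjcK.
Qed.

Lemma tmul_even (k t t' : R) : cos t = cos t' -> 0 <= k -> tmul k t = tmul k t'.
Proof.
move=> ct k0.
have e (a : R) : 0 <= a -> normc (mfac a (cis t)) = normc (mfac a (cis t')).
  move=> a0; apply: (@pexpIrn _ 2) => //; rewrite ?nnegrE ?normc_ge0//.
  by rewrite !normc_mfac ct.
by rewrite /tmul !e// mulr_ge0.
Qed.

Lemma pow256_le n (v : R) : n%:R <= v / 8 -> 256 ^+ n <= expR v.
Proof.
move=> h; have -> : (256 : R) = 2 ^+ 8 by ring.
rewrite -exprM -[X in X ^+ _]lnK ?posrE// -expRM_natl ler_expR natrM.
have l2 : ln (2 : R) <= 1 by have := @ln_le_sub1 R 2 ltac:(lra); lra.
have n8 : 0 <= 8 * n%:R :> R by rewrite mulr_ge0.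
have := ler_wpM2l n8 l2; lra.
Qed.

Variables (A : nat) (A_big : (70 * 70 : R) <= A%:R).
Let L := L64 R.

(** Scale of the weight attached to block m. With k = 1 / (tau c) the quantity P of [bump_ineq] lies
    between (x / c)^2 / 16 and (12 / 11) (x / c)^2. Below the block x <= c / 23 gives P <= 1 / 256;
    above it x >= 4900 c / 23 gives P >= 2048. Hence 23 and A >= 70^2. *)
Definition block_center m : R := 23 * (A%:R ^+ m * L).

Lemma block_center_gt0 m : 0 < block_center m.
Proof.
have Ab := A_big; have L0 : 0 < L by exact: L64_gt0.
have A0 : (0 : R) < A%:R by lra.
by rewrite mulr_gt0// mulr_gt0// exprn_gt0.
Qed.

Lemma tmul_outside tau m (x : R) : 0 < tau -> tau * block_center m <= 1 / 11 ->
  0 <= tau * x <= pi ->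
  ~~ (A%:R ^+ m * L < x < A%:R ^+ m.+1 * L) ->
  tmul (tau * block_center m)^-1 (tau * x) <= 1.
Proof.
move=> tau0 small tx out; have Ab := A_big; have c0 := block_center_gt0 m; set c := block_center m in c0 small *.
have tc0 : 0 < tau * c by exact: mulr_gt0.
have /andP[tx0 _] := tx.
have x0 : 0 <= x by rewrite -(pmulr_rge0 _ tau0).
have k11 : 11 <= (tau * c)^-1 by rewrite -(ler_pM2r tc0) mulVf ?gt_eqF//; lra.
apply: tmul_le1 => //; set P := _ * _ * _.
have S2 := cos_dist_le tx0; have S1 := cos_dist_ge tx.
have E : P = (1 + tau * c) * ((2 - 2 * cos (tau * x)) / (tau * c) ^+ 2).
  by rewrite /P; field; rewrite ?gt_eqF.
have tc2 : 0 < (tau * c) ^+ 2 by rewrite exprn_gt0.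
have X1 : (2 - 2 * cos (tau * x)) / (tau * c) ^+ 2 <= x ^+ 2 / c ^+ 2.
  rewrite ler_pdivrMr//; apply: le_trans S2 _; apply: le_of_eq; field; rewrite ?gt_eqF//.
have X2 : x ^+ 2 / c ^+ 2 / 16 <= (2 - 2 * cos (tau * x)) / (tau * c) ^+ 2.
  rewrite ler_pdivlMr//; apply: le_trans S1; apply: le_of_eq; field; rewrite ?gt_eqF//.
have q0 : 0 <= x ^+ 2 / c ^+ 2 by rewrite divr_ge0 ?exprn_ge0// ltW.
set S := _ / (tau * c) ^+ 2 in E X1 X2.
have c2 : 0 < c ^+ 2 by rewrite exprn_gt0.
have aL0 : 0 < A%:R ^+ m * L by move: c0; rewrite /c /block_center pmulr_rgt0.
move: out; rewrite negb_and -!leNgt => /orP[xl|xh]; apply/orP; [left|right].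
  have : x ^+ 2 / c ^+ 2 <= 1 / 529.
    rewrite ler_pdivrMr// /c /block_center.
    have : x ^+ 2 <= (A%:R ^+ m * L) ^+ 2 by apply: lerXn2r; rewrite ?nnegrE// ltW.
    by rewrite !exprMn; lra.
  have : (1 + tau * c) * S <= (12 / 11) * (x ^+ 2 / c ^+ 2).
    apply: ler_pM => //; [lra | | lra].
    by apply: le_trans X2; rewrite divr_ge0.
  rewrite E; lra.
have : 450 * 100 <= x ^+ 2 / c ^+ 2.
  rewrite ler_pdivlMr// /c /block_center.
  have xx : 70 * 70 * (A%:R ^+ m * L) <= x.
    apply: le_trans xh; rewrite exprS -[leRHS]mulrA; apply: ler_wpM2r => //; exact: ltW.
  move: aL0 xx; set Y := A%:R ^+ m * L => aL0 xx.
  have Y0 : 0 <= 70 * 70 * Y by lra.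
  have := ler_pM Y0 Y0 xx xx; have := mulr_ge0 (ltW aL0) (ltW aL0); clear; lra.
have S0 : 0 <= S by apply: le_trans X2; rewrite divr_ge0.
have := mulr_ge0 (ltW tc0) S0; rewrite E; lra.
Qed.

(** Weights in number about v m / 8 are attached to block m, and the maximum principle is applied at
    1 - tau y. There the polynomial is still at least d / 2, while the gains multiply to at least 1
    plus a multiple of the sum to be bounded. K depends neither on m1 nor on n. *)
Lemma blocks_bound (H d : R) : 0 < H -> 0 < d ->
  exists (K : R) (M0 : nat), forall m0 m1, (M0 <= m0)%N ->
  exists n0 : nat, forall n, (n0 <= n)%N -> (0 < n)%N ->
  forall (c : nat -> R[i]) (v : nat -> R),
  \sum_(j < n) normc (c j) <= H ->
  d <= normc (expsum n c (fun j => H / n%:R *+ j) 0) ->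
  (forall m x, (m0 <= m < m1)%N -> A%:R ^+ m * L <= x <= A%:R ^+ m.+1 * L ->
     normc (expsum n c (fun j => H / n%:R *+ j) x) <= expR (- v m)) ->
  \sum_(m0 <= m < m1) (Num.truncn (v m / 8))%:R / A%:R ^+ m <= K.
Proof.
move=> H0 d0; have Ab := A_big.
have L0 : 0 < L by exact: L64_gt0.
(* Moving from 1 to 1 - tau y changes the polynomial by at most H (n tau y) = H^2 y, and this y
   makes it d / 2. *)
pose y := d / (2 * H ^+ 2); have y0 : 0 < y by rewrite divr_gt0// mulr_gt0// exprn_gt0.
pose K := (H ^+ 2 + H) / (d / 2) ^+ 2 * (92 * L / y).
(* Makes c_m >= 8 y from block M0 on, so that k eta = y / c_m <= 1 / 8 as the gain requires. *)
pose M0 := Num.truncn (8 * y / L).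
exists K, M0 => m0 m1 mM.
pose cmax := \sum_(m0 <= m < m1) block_center m.
pose n0 := (Num.truncn (11 * H * cmax) + Num.truncn (H * y))%N.+1.
exists n0 => n nn0 n1 c v cH dc fv.
have nR : (0 : R) < n%:R by rewrite ltr0n.
pose tau := H / n%:R; have tau0 : 0 < tau by exact: divr_gt0.
have cle m : (m0 <= m < m1)%N -> block_center m <= cmax.
  move=> mm; rewrite /cmax (big_rem m) ?mem_index_iota//= lerDl big_seq sumr_ge0// => i _.
  exact/ltW/block_center_gt0.
have nbig1 : 11 * H * cmax <= n%:R.
  apply: le_trans (ltW (truncnS_gt _)) _; rewrite ler_nat; apply: leq_trans nn0.
  by rewrite ltnS leq_addr.
have nbig2 : H * y <= n%:R.
  apply: le_trans (ltW (truncnS_gt _)) _; rewrite ler_nat; apply: leq_trans nn0.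
  by rewrite ltnS leq_addl.
have tc m : (m0 <= m < m1)%N -> tau * block_center m <= 1 / 11.
  move=> mm; rewrite /tau mulrAC ler_pdivrMr//.
  have := ler_wpM2l (ltW H0) (cle m mm); lra.
have Amb m : (m0 <= m)%N -> 8 * y <= block_center m.
  move=> mm; have h : 8 * y / L <= A%:R ^+ m.
    apply: le_trans (ltW (truncnS_gt _)) _; rewrite -natrX ler_nat.
    apply: leq_ltn_trans (leq_trans mM mm) _; apply: ltn_expl.
    by rewrite -(ltr_nat R); lra.
  move: h; rewrite ler_pdivrMr// /block_center => h.
  have : 0 < A%:R ^+ m * L by rewrite mulr_gt0// exprn_gt0//; lra.
  lra.
pose f := expsum n c (fun j => tau *+ j).
(* On the circle Q Q' has modulus |Q(cis t)| |Q(cis (- t))|, which is even in t, so smallness of f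
   for x > 0 alone can be used; on the real axis its modulus is |Q|^2. *)
pose Q := expsum_poly n c; pose Q' := expsum_poly n (fun j => conjc (c j)).
have fH x : normc (f x) <= H.
  apply: le_trans (normc_sum _ _ _) _; apply: le_trans cH; apply: ler_sum => j _.
  by rewrite normcM normc_cis mulr1.
have QH (t : R) : normc Q.[cis t] <= H.
  have -> : t = tau * (t / tau) by field; rewrite ?gt_eqF//.
  by rewrite /Q expsum_poly_cis.
have PE t : normc (Q * Q').[cis t] = normc Q.[cis t] * normc Q.[cis (- t)].
  by rewrite hornerM normcM /Q' expsum_poly_conj normc_conjc conj_cis.
(* As 256^(v / 8) <= exp v, the growth of these weights inside block m is paid for by |f| <= exp (-
   v m) there; a negative v m contributes no weight. *)
pose nm m := Num.truncn (v m / 8).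
pose kap m := (tau * block_center m)^-1.
pose ks := flatten [seq nseq (nm m) (kap m) | m <- index_iota m0 m1].
have ksE (g : R -> R) : \prod_(k <- ks) g k = \prod_(m0 <= m < m1) g (kap m) ^+ nm m.
  rewrite /ks big_flatten big_map; apply: eq_bigr => m _.
  by rewrite big_nseq; elim: (nm m) => //= q ->; rewrite exprS.
have ksin k : k \in ks -> exists2 m, (m0 <= m < m1)%N & k = kap m.
  move=> /flattenP[s /mapP[m]]; rewrite mem_index_iota => mm ->.
  by rewrite mem_nseq => /andP[_ /eqP ->]; exists m.
have kap11 m : (m0 <= m < m1)%N -> 11 <= kap m.
  move=> mm; have tc0 : 0 < tau * block_center m by rewrite mulr_gt0// block_center_gt0.
  by rewrite /kap -(ler_pM2r tc0) mulVf ?gt_eqF//; have := tc m mm; lra.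
have kapeta m : kap m * (tau * y) = y / block_center m.
  by rewrite /kap; field; rewrite !gt_eqF ?block_center_gt0.
have main := @multiplier_principle R (Q * Q') ks (H ^+ 2 + H) (tau * y).
have {main} : normc (Q * Q').[(1 - tau * y)%:C] * \prod_(k <- ks) (1 + k * (tau * y) / 4) <= H ^+ 2 + H.
  apply: main.
  - rewrite mulr_gt0//= /tau mulrAC ler_pdivrMr// mul1r; exact: nbig2.
  - move=> k /ksin[m mm ->]; split; first exact: kap11.
    rewrite kapeta ler_pdivrMr ?block_center_gt0//.
    by have /andP[m0m _] := mm; have := Amb m m0m; lra.
  (* Everything depends on t0 through its cosine only, so t0 may be replaced by a point of [0, pi],
     where x = t / tau is nonnegative and in at most one open block. *)
  move=> t0; pose t := acos (cos t0).
  have ct0 : -1 <= cos t0 <= 1 by rewrite cos_geN1 cos_le1.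
  have ct : cos t = cos t0 by rewrite /t acosK// in_itv.
  have tpi : 0 <= t <= pi by rewrite /t acos_ge0 ?acos_lepi.
  have -> : normc (Q * Q').[cis t0] = normc (Q * Q').[cis t].
    rewrite !PE; have : sin t ^+ 2 = sin t0 ^+ 2 by rewrite !sin2cos2 ct.
    move=> /eqP; rewrite eqf_sqr => /orP[]/eqP st.
      by rewrite /cis !cosN !sinN ct st.
    by rewrite mulrC /cis !cosN !sinN ct st opprK.
  rewrite ksE.
  have -> : \prod_(m0 <= m < m1) tmul (kap m) t0 ^+ nm m = \prod_(m0 <= m < m1) tmul (kap m) t ^+ nm m.
    rewrite big_nat [RHS]big_nat; apply: eq_bigr => m mm.
    by rewrite (@tmul_even _ t0 t)//; have := kap11 m mm; lra.
  rewrite PE; pose x := t / tau.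
  have tE : t = tau * x by rewrite /x; field; rewrite ?gt_eqF//.
  have txpi : 0 <= tau * x <= pi by rewrite -tE.
  have Qf : normc Q.[cis t] = normc (f x) by rewrite tE /Q expsum_poly_cis.
  have pr0 (P : pred nat) : 0 <= \prod_(m0 <= m < m1 | P m) tmul (kap m) t ^+ nm m.
    by apply: prodr_ge0 => m _; rewrite exprn_ge0// tmul_ge0.
  have out1 m : (m0 <= m < m1)%N -> ~~ (A%:R ^+ m * L < x < A%:R ^+ m.+1 * L) -> tmul (kap m) t ^+ nm m <= 1.
    move=> mm out; apply: exprn_ile1; first exact: tmul_ge0.
    by rewrite tE; apply: tmul_outside => //; exact: tc.
  have QQ : normc Q.[cis t] * normc Q.[cis (- t)] <= normc (f x) * H.
    by rewrite Qf; apply: ler_wpM2l; rewrite ?normc_ge0.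
  apply: le_trans (ler_wpM2r (pr0 _) QQ) _.
  have [/hasP [m]|/hasPn none] := boolP (has (fun m => A%:R ^+ m * L < x < A%:R ^+ m.+1 * L) (index_iota m0 m1)).
    rewrite mem_index_iota => mm /andP[xm xm1].
    rewrite (bigD1_seq m) ?mem_index_iota ?iota_uniq//=.
    have rest : \prod_(m0 <= i < m1 | i != m) tmul (kap i) t ^+ nm i <= 1.
      rewrite big_nat_cond; apply: prodr_ile1 => i /andP[im ne].
      rewrite exprn_ge0 ?tmul_ge0//=; apply: out1 => //; apply/negP => /andP[xi xi1].
      have A1 : 1 <= A%:R :> R by lra.
      move: ne; rewrite neq_ltn => /orP[lt|lt].
        have : A%:R ^+ i.+1 * L <= A%:R ^+ m * L :> R.
          by apply: ler_wpM2r; [exact: ltW | exact: ler_weXn2l].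
        lra.
      have : A%:R ^+ m.+1 * L <= A%:R ^+ i * L :> R.
        by apply: ler_wpM2r; [exact: ltW | exact: ler_weXn2l].
      lra.
    have fx : normc (f x) <= expR (- v m).
      by apply: (fv m x mm); rewrite !ltW.
    have T : tmul (kap m) t ^+ nm m <= expR (`|v m|).
      apply: (@le_trans _ _ (256 ^+ nm m)).
        by apply: lerXn2r; rewrite ?nnegrE ?ler0n ?tmul_ge0 ?tmul_le ?kap11.
      apply: pow256_le; have [v8|v8] := leP 0 (v m / 8).
        rewrite ger0_norm; last lra.
        by rewrite truncn_le.
      have -> : nm m = 0%N by apply/truncn0Pn; rewrite -ltNge; lra.
      by rewrite divr_ge0.
    have v1 : normc (f x) * tmul (kap m) t ^+ nm m <= 1 + H.
      have [v0|v0] := leP 0 (v m).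
        have := ler_pM (normc_ge0 _) (exprn_ge0 (nm m) (tmul_ge0 (kap m) t)) fx T.
        rewrite ger0_norm// -expRD addNr expR0; lra.
      have -> : nm m = 0%N by apply/truncn0Pn; rewrite -ltNge; lra.
      rewrite expr0 mulr1; have := fH x; lra.
    have n0' := normc_ge0 (f x); have T0 := exprn_ge0 (nm m) (tmul_ge0 (kap m) t).
    have := ler_pM (mulr_ge0 n0' T0) (pr0 (fun i => i != m)) v1 rest.
    rewrite mulr1 => h; have := ler_wpM2r (ltW H0) h.
    set u := normc _; set w := tmul _ _ ^+ _; set z := \prod_(_ <= _ < _ | _) _ => h2.
    have -> : u * H * (w * z) = u * w * z * H by ring.
    apply: le_trans h2 _; lra.
  have : \prod_(m0 <= m < m1) tmul (kap m) t ^+ nm m <= 1.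
    rewrite big_nat; apply: prodr_ile1 => m mm; rewrite exprn_ge0 ?tmul_ge0//=.
    by apply: out1 => //; apply: none; rewrite mem_index_iota.
  move=> h; have hh : normc (f x) * H <= H * H by apply: ler_wpM2r; [exact: ltW | exact: fH].
  have := ler_pM (mulr_ge0 (normc_ge0 (f x)) (ltW H0)) (pr0 predT) hh h; lra.
have Qr : (Q * Q').[(1 - tau * y)%:C] = Q.[(1 - tau * y)%:C] * conjc (Q.[(1 - tau * y)%:C]).
  by rewrite hornerM /Q' expsum_poly_conj conjc_real.
rewrite Qr normcM normc_conjc -expr2 ksE => main.
have Qd : d / 2 <= normc Q.[(1 - tau * y)%:C].
  have Q1 : Q.[1] = f 0.
    have -> : (1 : R[i]) = cis (tau * 0) by rewrite mulr0 cis0.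
    by rewrite /Q expsum_poly_cis.
  have ty0 : 0 <= tau * y := mulr_ge0 (ltW tau0) (ltW y0).
  have tyH : 0 <= 1 - tau * y <= 1.
    have : tau * y <= 1 by rewrite /tau mulrAC ler_pdivrMr// mul1r.
    have := mulr_gt0 tau0 y0; lra.
  have diff : normc (Q.[1] - Q.[(1 - tau * y)%:C]) <= H * (H * y).
    rewrite /Q !expsum_polyE -sumrB; apply: le_trans (normc_sum _ _ _) _.
    have Hy : 0 <= H * y := mulr_ge0 (ltW H0) (ltW y0).
    apply: le_trans (ler_wpM2r Hy cH); rewrite mulr_suml; apply: ler_sum => j _.
    rewrite -mulrBr normcM; apply: ler_wpM2l; first exact: normc_ge0.
    rewrite expr1n -rmorphXn -(rmorph1 (real_complex R)) -rmorphB normc_real ger0_norm; last first.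
      by rewrite subr_ge0 exprn_ile1//; lra.
    have bern : 1 - j%:R * (tau * y) <= (1 - tau * y) ^+ j.
      elim: (j : nat) => [|i IH]; first by rewrite mul0r subr0 expr0.
      have /andP[t1 t2] := tyH; rewrite exprS.
      have := ler_wpM2l t1 IH; rewrite -natr1.
      have := mulr_ge0 (mulr_ge0 (ler0n R i) ty0) ty0.
      lra.
    have : j%:R * (tau * y) <= n%:R * (tau * y).
      by apply: ler_wpM2r => //; rewrite ler_nat ltnW.
    have -> : n%:R * (tau * y) = H * y by rewrite /tau; field; rewrite ?gt_eqF//.
    lra.
  have HHy : H * (H * y) = d / 2 by rewrite /y; field; rewrite ?gt_eqF//.
  have := le_normcB Q.[1] (Q.[1] - Q.[(1 - tau * y)%:C]).
  rewrite (_ : Q.[1] - (Q.[1] - _) = Q.[(1 - tau * y)%:C]); last by ring.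
  by move: diff dc; rewrite HHy Q1 -/f; lra.
have q0 m : 0 <= y / (4 * block_center m).
  by apply: divr_ge0; [exact: ltW | rewrite mulr_ge0// ltW// block_center_gt0].
have pge : 1 + \sum_(m0 <= m < m1) (nm m)%:R * (y / (4 * block_center m)) <=
   \prod_(m0 <= m < m1) (1 + kap m * (tau * y) / 4) ^+ nm m.
  apply: le_trans (prod1D_ge _ _) _.
    by move=> m; apply: mulr_ge0 => //; exact: q0.
  apply: ler_prod => m _; have b0 := block_center_gt0 m.
  rewrite addr_ge0 ?(mulr_ge0 _ (q0 m))//=.
  have -> : kap m * (tau * y) / 4 = y / (4 * block_center m).
    by rewrite kapeta; field; rewrite ?gt_eqF//.
  exact: bernoulli_le.
have d20 : 0 < (d / 2) ^+ 2 by rewrite exprn_gt0// divr_gt0.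
have sge : 0 <= \sum_(m0 <= m < m1) (nm m)%:R * (y / (4 * block_center m)).
  by apply: sumr_ge0 => m _; exact: mulr_ge0 (q0 m).
have fin : (d / 2) ^+ 2 * \sum_(m0 <= m < m1) (nm m)%:R * (y / (4 * block_center m)) <= H ^+ 2 + H.
  apply: le_trans main; apply: ler_pM => //; first exact: ltW.
    by apply: lerXn2r => //; rewrite nnegrE ?normc_ge0// divr_ge0// ltW.
  lra.
have sE : \sum_(m0 <= m < m1) (nm m)%:R * (y / (4 * block_center m)) =
   (\sum_(m0 <= m < m1) (nm m)%:R / A%:R ^+ m) * (y / (92 * L)).
  rewrite mulr_suml; apply: eq_bigr => m _; rewrite /block_center; field.
  by rewrite !gt_eqF// exprn_gt0//; lra.
move: fin; rewrite sE -/nm mulrA => fin.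
have yL0 : 0 < y / (92 * L) by rewrite divr_gt0// mulr_gt0.
rewrite /K -[leLHS](mulfK (lt0r_neq0 yL0)) -[92 * L / y]invf_div.
apply: ler_wpM2r; first by rewrite invr_ge0 ltW.
by rewrite ler_pdivlMr// mulrC mulrA.
Qed.

End Blocks.

(** * Block averages of log+ Phi *)

Section BlockAverages.
Variable R : realType.
Implicit Types (Phi : nat -> R).

Definition lnp (x : R) : R := Num.max 0 (ln x).

Lemma lnp_ge0 x : 0 <= lnp x. Proof. by rewrite /lnp le_max lexx. Qed.
Lemma ln_le_lnp x : ln x <= lnp x. Proof. by rewrite /lnp le_max lexx orbT. Qed.

Lemma lnp_le x y : 0 < x -> x <= y -> lnp x <= lnp y.
Proof.
move=> x0 xy; have y0 : 0 < y by exact: lt_le_trans xy.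
by rewrite /lnp ge_max lnp_ge0/= le_max ler_ln ?posrE// xy orbT.
Qed.

Definition wsum Phi (a b : nat) : R :=
  \sum_(a.+1 <= p < b.+1 | prime p) lnp (Phi p) * (p%:R * ln (p%:R : R))^-1.

Lemma pln_ge0 (p : nat) : prime p -> 0 <= (p%:R * ln (p%:R : R))^-1.
Proof.
by move=> /prime_gt0 p0; rewrite invr_ge0 mulr_ge0// ln_ge0// ler1n.
Qed.

Lemma wsum_ge0 Phi a b : 0 <= wsum Phi a b.
Proof. by apply: sumr_ge0 => p pp; rewrite mulr_ge0 ?lnp_ge0 ?pln_ge0. Qed.

Lemma wsum_cat Phi a b c : (a <= b <= c)%N -> wsum Phi a c = wsum Phi a b + wsum Phi b c.
Proof. by move=> /andP[ab bc]; rewrite /wsum -big_cat_nat// ltnS. Qed.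

Lemma wsum_blocks Phi A m0 m1 : (0 < A)%N -> (m0 <= m1)%N ->
  wsum Phi (64 ^ (A ^ m0)) (64 ^ (A ^ m1)) =
  \sum_(m0 <= m < m1) wsum Phi (64 ^ (A ^ m)) (64 ^ (A ^ m.+1)).
Proof.
move=> A0; have mono i j : (i <= j)%N -> (64 ^ (A ^ i) <= 64 ^ (A ^ j))%N.
  by move=> ij; rewrite leq_exp2l// leq_pexp2l.
elim: m1 => [|m1 IH]; first by rewrite leqn0 => /eqP ->; rewrite /wsum !big_geq.
rewrite leq_eqVlt => /predU1P[->|]; first by rewrite /wsum !big_geq.
rewrite ltnS => mm; rewrite big_nat_recr//= -IH// -wsum_cat// !mono//.
Qed.

Definition wavg Phi A m : R :=
  wsum Phi (64 ^ (A ^ m)) (64 ^ (A ^ m.+1)) / psum R (64 ^ (A ^ m)) (64 ^ (A ^ m.+1)).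

Section MonotoneWeights.
Variables (Phi : nat -> R) (A : nat).
Hypotheses (Phi_gt0 : forall p, prime p -> 0 < Phi p)
  (Phi_incr : forall p q, prime p -> prime q -> (p <= q)%N -> Phi p <= Phi q).

Lemma wavg_ge0 m : 0 <= wavg Phi A m.
Proof. by rewrite divr_ge0 ?wsum_ge0 ?psum_ge0. Qed.

(** Monotonicity puts the average over a block below all values of log+ Phi beyond it. Together with
    [wavg_ge] this lets averages stand in for Phi at the price of a shift by one block. *)
Lemma wavg_le m p : prime p -> (64 ^ (A ^ m.+1) < p)%N -> wavg Phi A m <= lnp (Phi p).
Proof.
move=> pp mp; rewrite /wavg; set a := (64 ^ (A ^ m))%N; set b := (64 ^ (A ^ m.+1))%N in mp *.
have [->|L0] := eqVneq (psum R a b) 0; first by rewrite invr0 mulr0 lnp_ge0.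
have Lp : 0 < psum R a b by rewrite lt_def L0 psum_ge0.
rewrite ler_pdivrMr// /psum mulr_sumr /wsum big_nat_cond [leRHS]big_nat_cond.
apply: ler_sum => q /andP[/andP[q1 q2] pq]; apply: ler_wpM2r; first exact: pln_ge0.
by apply: lnp_le; rewrite ?Phi_gt0// Phi_incr// ltnW// (leq_trans _ mp).
Qed.

Lemma wavg_ge m p : prime p -> (p <= 64 ^ (A ^ m))%N ->
  0 < psum R (64 ^ (A ^ m)) (64 ^ (A ^ m.+1)) -> lnp (Phi p) <= wavg Phi A m.
Proof.
move=> pp pm Lp; rewrite /wavg ler_pdivlMr// /psum mulr_sumr /wsum big_nat_cond [leRHS]big_nat_cond.
apply: ler_sum => q /andP[/andP[q1 q2] pq]; apply: ler_wpM2r; first exact: pln_ge0.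
by apply: lnp_le; rewrite ?Phi_gt0// Phi_incr// (leq_trans pm)// ltnW.
Qed.

End MonotoneWeights.

(** Infinitely many terms >= 1 would make the truncated sums unbounded, so from some rank on the
    truncation is inactive. It undoes the cap on the averages. *)
Lemma sum_min1_bounded (t : nat -> R) (B : R) : (forall m, 0 <= t m) ->
  (forall n, \sum_(0 <= m < n) Num.min (t m) 1 <= B) ->
  exists B', forall n, \sum_(0 <= m < n) t m <= B'.
Proof.
move=> t0 uB.
have u0 m : 0 <= Num.min (t m) 1 by rewrite le_min t0 ler01.
have [J HJ] : exists J, forall m, (J <= m)%N -> t m < 1.
  apply: contrapT => /forallNP H.
  have H' J : exists2 m, (J <= m)%N & 1 <= t m.
    have := H J => /existsNP[m /not_implyP[Jm tm]]; exists m => //.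
    by rewrite leNgt; apply/negP.
  have big k : exists n, k%:R <= \sum_(0 <= m < n) Num.min (t m) 1.
    elim: k => [|k [n hn]]; first by exists 0%N; rewrite big_geq.
    have [m nm tm] := H' n; exists m.+1; rewrite big_nat_recr//= (@big_cat_nat _ _ _ n)//=.
    rewrite -natr1 -addrA; apply: lerD => //.
    have -> : Num.min (t m) 1 = 1 by apply/min_idPr.
    by rewrite lerDr sumr_ge0.
  have [n hn] := big (Num.truncn B).+1.
  by have := truncnS_gt B; have := uB n; lra.
exists (\sum_(0 <= m < J) t m + B) => n.
have S0 a b : 0 <= \sum_(a <= m < b) t m by exact: sumr_ge0.
have B0 : 0 <= B by have := uB 0%N; rewrite big_geq.
have [nJ|Jn] := leqP n J.
  rewrite [X in _ <= X + _](@big_cat_nat _ _ _ n)//=; have := S0 n J; lra.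
rewrite (@big_cat_nat _ _ _ J)//=; last exact: ltnW.
rewrite lerD2l; apply: le_trans (uB n).
rewrite [leRHS](@big_cat_nat _ _ _ J)//=; last exact: ltnW.
apply: (@le_trans _ _ (\sum_(J <= m < n) Num.min (t m) 1)); last first.
  by rewrite lerDr sumr_ge0.
rewrite big_nat_cond [leRHS]big_nat_cond; apply: ler_sum => m /andP[/andP[Jm _] _].
by rewrite le_min lexx ltW// HJ.
Qed.

End BlockAverages.

(** * A positive limit makes the series of log+ Phi converge *)

Section Converse.
Variable R : realType.

Lemma sum_pow_bound (A : nat) n : (4 <= A)%N ->
  \sum_(0 <= m < n) (m + 3)%:R / A%:R ^+ m <= 8 :> R.
Proof.
move=> A4.
have term m : (m + 3)%:R / A%:R ^+ m <= 4 * (1 / 2) ^+ m :> R.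
  rewrite ler_pdivrMr ?exprn_gt0 ?ltr0n//; last by rewrite (leq_trans _ A4).
  rewrite -mulrA -exprMn; apply: (@le_trans _ _ (4 * 2 ^+ m)).
    rewrite -natrX -natrM ler_nat; elim: m => // m IH; rewrite expnS; move: IH; clear; lia.
  apply: ler_wpM2l => //; apply: lerXn2r; rewrite ?nnegrE//.
  have : (4 : R) <= A%:R by rewrite ler_nat.
  lra.
apply: (@le_trans _ _ (8 - 8 * (1 / 2) ^+ n)); last first.
  by rewrite gerBl mulr_ge0// exprn_ge0// divr_ge0.
elim: n => [|n IH]; first by rewrite big_geq// expr0; lra.
rewrite big_nat_recr//=; have := term n; rewrite exprS; lra.
Qed.

Lemma le_truncated_weight (c l M T W : R) : 0 < c -> l <= l * M -> 1 <= M -> 0 <= l -> W / c / 8 < T + 1 ->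
  W <= c * 8 * T + (c * 8 + 4 * l) * M.
Proof.
move=> c0 lM M1 l0; rewrite -mulrA -invfM ltr_pdivrMr; last by rewrite mulr_gt0.
move=> hT; have := ler_wpM2l (ltW c0) M1; nra.
Qed.

Lemma converse_direction (Phi : nat -> R) (H d : R) :
  (forall p, prime p -> 0 < Phi p) ->
  (forall p q, prime p -> prime q -> (p <= q)%N -> Phi p <= Phi q) ->
  0 < H -> 0 < d ->
  (forall N a, admissible Phi N a -> d <= sqnorm H a N) ->
  exists B, forall n, \sum_(0 <= p < n | prime p) lnp (Phi p) * (p%:R * ln (p%:R : R))^-1 <= B.
Proof.
move=> Phi0 Phi_incr H0 d0 lower.
have [A A4 A_big] : exists2 A : nat, (4 <= A)%N & (70 * 70 : R) <= A%:R.
  by exists (70 * 70)%N => //; rewrite natrM.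
have A0 : (0 < A)%N by rewrite (leq_trans _ A4).
have A1 : (1 < A)%N by rewrite (leq_trans _ A4).
have AR : (0 : R) < A%:R by rewrite ltr0n.
have AR1 : (1 : R) <= A%:R by rewrite ler1n.
pose w m := wavg Phi A m; have w0 m : 0 <= w m by exact: wavg_ge0.
have d20 : 0 < d / 2 by rewrite divr_gt0.
have [K [M0 blocks]] := blocks_bound A_big H0 d20.
have [k0] := window_bound (ltW H0) H0.
have [e e0 <-] : exists2 e : R, 0 < e & e = 1024 by exact: (ex_intro2 _ _ 1024 (ltr0Sn _ _) erefl).
move=> win.
have lA0 : 0 <= ln (A%:R : R) by apply: ln_ge0.
(* [window_bound] wants a weight between 4 ln (k + 1) and k. The cap A^m secures the upper bound on
   the next block, where k >= A^(m+1), and [OK] the lower one, as k + 1 <= A^(m+3) there. *)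
pose W m := Num.min (w m) (A%:R ^+ m).
have W0 m : 0 <= W m by rewrite le_min w0 exprn_ge0.
pose OK m := 4 * ((m + 3)%:R * ln (A%:R : R)) <= W m.
(* The average over block m - 1 is a lower bound for log+ Phi on block m. Where [OK] fails, the
   value - H stands for the trivial bound |f| <= H <= exp H. *)
pose v m := if OK m.-1 then W m.-1 / e else - H.
pose m0 := (M0 + k0).+1.
have main m1 : \sum_(m0 <= m < m1) (Num.truncn (v m / 8))%:R / A%:R ^+ m <= K.
  have [n0 blk] := blocks m0 m1 (leq_trans (leq_addr _ _) (leqnSn _)).
  (* A point x may be the right end of the last block; then k = A^m1, and its window must still lie
     below N. *)
  pose N := (64 ^ (A ^ m1).+1)%N.
  have [Kr Kr0 riem] := riemann_norm_cvg N H0 Phi0.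
  pose n := (n0 + Num.truncn (2 * Kr / d)).+1.
  have nR : (0 : R) < n%:R by rewrite ltr0n.
  have Krn : Kr / n%:R <= d / 2.
    have h : 2 * Kr / d <= n%:R.
      apply: le_trans (ltW (truncnS_gt _)) _; rewrite ler_nat ltnS; exact: leq_addl.
    move: h; rewrite !ler_pdivrMr//; lra.
  have [a [c [adm cH cert]]] := @dual_certificate R H N Phi n H0 Phi0 isT.
  set f := expsum n c _ in cert.
  have f0H : normc (f 0) <= H.
    apply: le_trans (normc_sum _ _ _) _; apply: le_trans cH; apply: ler_sum => j _.
    by rewrite normcM normc_cis mulr1.
  have fH x : normc (f x) <= H.
    apply: le_trans (normc_sum _ _ _) _; apply: le_trans cH; apply: ler_sum => j _.
    by rewrite normcM normc_cis mulr1.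
  have D2 : d / 2 <= riemann_norm H n N a.
    have := riem n a isT adm; have := lower N a adm; rewrite ler_norml; lra.
  have T0 p : prime p -> 0 <= Phi p / p%:R * normc (f (lnn R p)).
    by move=> pp; rewrite mulr_ge0 ?normc_ge0// divr_ge0// ltW// Phi0.
  have D0 : 0 <= riemann_norm H n N a by lra.
  have sumH : \sum_(p < N.+1 | prime p) Phi p / p%:R * normc (f (lnn R p)) <= H by lra.
  have sum0 : 0 <= \sum_(p < N.+1 | prime p) Phi p / p%:R * normc (f (lnn R p)).
    by apply: sumr_ge0 => p; exact: T0.
  apply: (blk n _ isT c v cH).
  - by rewrite ltnW// ltnS leq_addr.
  - by rewrite -/f; lra.
  move=> m x /andP[mm0 mm1] /andP[x1 x2]; rewrite -/f /v; case: ifPn => ok; last first.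
    by rewrite opprK; apply: le_trans (fH x) _; have := expR_ge1Dx H; lra.
  have m0' : (0 < m)%N by rewrite (leq_trans _ mm0).
  have mE : m.-1.+1 = m by rewrite prednK.
  have L0 := L64_gt0 R.
  pose k := Num.truncn (x / L64 R).
  have xL0 : 0 <= x / L64 R.
    by apply: divr_ge0 (ltW L0); apply: le_trans x1; rewrite mulr_ge0 ?exprn_ge0// ltW.
  have kx : k%:R <= x / L64 R by rewrite truncn_le.
  have xk : x / L64 R < k.+1%:R by exact: truncnS_gt.
  have kA : (A ^ m <= k)%N.
    by rewrite truncn_ge_nat// natrX ler_pdivlMr.
  have kA' : (k <= A ^ m1)%N.
    rewrite -(ler_nat R) natrX; apply: le_trans kx _; rewrite ler_pdivrMr//.
    apply: le_trans x2 _; apply: ler_wpM2r; first exact: ltW.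
    exact: ler_weXn2l.
  have kA'' : (k <= A ^ m.+1)%N.
    by rewrite -(ler_nat R) natrX; apply: le_trans kx _; rewrite ler_pdivrMr.
  have mA : (m < A ^ m)%N by exact: ltn_expl.
  have k0k : (k0 <= k)%N.
    apply: leq_trans kA; apply: leq_trans (ltnW mA); apply: leq_trans mm0.
    by rewrite /m0 ltnW// ltnS leq_addl.
  have Amm : (A ^ m.-1 <= A ^ m)%N by rewrite leq_pexp2l// leq_pred.
  have Wk : W m.-1 <= k%:R.
    apply: (@le_trans _ _ (A%:R ^+ m.-1)); first by rewrite /W ge_min lexx orbT.
    by rewrite -natrX ler_nat (leq_trans Amm).
  have lk : 4 * ln k.+1%:R <= W m.-1.
    apply: le_trans ok; apply: ler_wpM2l => //.
    rewrite mulr_natl -lnXn// ler_ln ?posrE ?ltr0n ?exprn_gt0//.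
    rewrite -natrX ler_nat.
    have -> : (m.-1 + 3 = m.+2)%N by rewrite addn3 mE.
    apply: (@leq_trans (2 * A ^ m.+1)); last by rewrite (expnS A m.+1) leq_mul2r A1 orbT.
    rewrite mul2n -addnn -addn1; apply: leq_add => //; by rewrite expn_gt0 A0.
  have Wpos : 0 < W m.-1.
    apply: lt_le_trans lk; rewrite mulr_gt0// ln_gt0// ltr1n.
    by rewrite ltnS (leq_trans _ kA)// expn_gt0 A0.
  have := win k (W m.-1) k0k lk Wk n c (fun j => H / n%:R *+ j) Phi cH.
  rewrite -/f; apply.
  - move=> j jn; have tau0 : 0 <= H / n%:R by rewrite divr_ge0// ltW.
    rewrite mulrn_wge0//= -mulr_natr mulrAC ler_pdivrMr//; apply: ler_wpM2l; first exact: ltW.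
    by rewrite ler_nat ltnW.
  - move=> p pp /andP[kp _].
    have wp : w m.-1 <= lnp (Phi p).
      apply: wavg_le => //; rewrite mE; apply: leq_ltn_trans kp; by rewrite leq_exp2l.
    have Wp : W m.-1 <= lnp (Phi p) by apply: le_trans wp; rewrite /W ge_min lexx.
    have lp : lnp (Phi p) = ln (Phi p).
      rewrite /lnp; apply/max_idPr; rewrite leNgt; apply/negP => neg.
      by move: Wp; rewrite /lnp (max_idPl (ltW neg)) leNgt Wpos.
    by rewrite -[leRHS]lnK ?posrE ?Phi0// ler_expR -lp.
  - apply: le_trans sumH.
    have kN : (64 ^ k.+1 <= N)%N by rewrite /N leq_exp2l.
    have kk : (64 ^ k <= 64 ^ k.+1)%N by rewrite leq_exp2l.
    rewrite -(big_mkord prime (fun p => Phi p / p%:R * normc (f (lnn R p)))).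
    rewrite [leRHS](@big_cat_nat _ _ _ (64 ^ k).+1)//=; last by rewrite ltnS (leq_trans kk).
    rewrite [X in _ <= _ + X](@big_cat_nat _ _ _ (64 ^ k.+1).+1)//=.
    have a0 : 0 <= \sum_(0 <= p < (64 ^ k).+1 | prime p) Phi p / p%:R * normc (f (lnn R p)).
      by apply: sumr_ge0 => p; exact: T0.
    have b0 : 0 <= \sum_((64 ^ k.+1).+1 <= p < N.+1 | prime p) Phi p / p%:R * normc (f (lnn R p)).
      by apply: sumr_ge0 => p; exact: T0.
    by rewrite -[leLHS]add0r; apply: lerD => //; rewrite -[leLHS]addr0; apply: lerD.
  - by apply/andP; split; [rewrite -ler_pdivlMr | rewrite -ler_pdivrMr// ltW].
have K0 : 0 <= K by have := main m0; rewrite big_geq.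
(* Rounding, and the blocks where [OK] fails, cost at most a multiple of (m + 3) / A^m, which is
   summable. *)
have lin m : Num.min (w m / A%:R ^+ m) 1 <=
    e * 8 * A%:R * ((Num.truncn (v m.+1 / 8))%:R / A%:R ^+ m.+1)
    + (e * 8 + 4 * ln A%:R) * ((m + 3)%:R / A%:R ^+ m).
  have Am0 : (0 : R) < A%:R ^+ m by exact: exprn_gt0.
  have -> : Num.min (w m / A%:R ^+ m) 1 = W m / A%:R ^+ m.
    rewrite /W; have [h|h] := leP (w m) (A%:R ^+ m).
      by rewrite (min_idPl _)// ler_pdivrMr// mul1r.
    by rewrite (min_idPr _) ?mulfV ?gt_eqF// ler_pdivlMr// mul1r ltW.
  rewrite -(ler_pM2r Am0) mulfVK ?gt_eqF//.
  have -> : (e * 8 * A%:R * ((Num.truncn (v m.+1 / 8))%:R / A%:R ^+ m.+1)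
    + (e * 8 + 4 * ln A%:R) * ((m + 3)%:R / A%:R ^+ m)) * A%:R ^+ m =
    e * 8 * (Num.truncn (v m.+1 / 8))%:R + (e * 8 + 4 * ln A%:R) * (m + 3)%:R :> R.
    have -> : A%:R ^+ m.+1 = A%:R * A%:R ^+ m :> R by exact: exprS.
    by field; rewrite !gt_eqF.
  have m3 : (1 : R) <= (m + 3)%:R by rewrite ler1n addn3.
  have e2 : ln A%:R <= ln A%:R * (m + 3)%:R :> R by rewrite ler_peMr.
  have t0 : (0 : R) <= (Num.truncn (v m.+1 / 8))%:R by [].
  rewrite /v /=; case: ifPn => [ok|]; last first.
    rewrite -ltNge => nok; apply: le_trans (ltW nok) _.
    have tH : 0 <= (Num.truncn (- H / 8))%:R :> R by [].
    move: tH; set T := (Num.truncn _)%:R => tH.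
    have -> : e * 8 * T + (e * 8 + 4 * ln A%:R) * (m + 3)%:R = e * 8 * T + e * 8 * (m + 3)%:R + 4 * ((m + 3)%:R * ln A%:R) :> R by ring.
    have e00 := ltW e0; by rewrite lerDr addr_ge0 ?mulr_ge0.
  have hT : W m / e / 8 < (Num.truncn (W m / e / 8))%:R + 1 by rewrite natr1 truncnS_gt.
  exact: (le_truncated_weight e0 e2 m3 lA0 hT).
have [B1 HB1] : exists B', forall n, \sum_(0 <= m < n) w m / A%:R ^+ m <= B'.
  pose Kx := e * 8 * A%:R * K + (e * 8 + 4 * ln A%:R) * 8.
  apply: (@sum_min1_bounded R _ (m0%:R + Kx)).
    by move=> m; rewrite divr_ge0 ?exprn_ge0.
  have e00 := ltW e0.
  have cge : 0 <= e * 8 + 4 * ln (A%:R : R) by rewrite addr_ge0 ?mulr_ge0.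
  have Kx0 : 0 <= Kx by rewrite addr_ge0 ?mulr_ge0.
  have part n : \sum_(m0 <= m < n) Num.min (w m / A%:R ^+ m) 1 <= Kx.
    apply: le_trans (ler_sum _ (fun m _ => lin m)) _.
    rewrite big_split /= -!mulr_sumr /Kx; apply: lerD.
      apply: ler_wpM2l; first by rewrite !mulr_ge0// ltW.
      have [nm|mn] := leqP n m0; first by rewrite big_geq.
      have := main n.+1; rewrite big_ltn; last by rewrite ltnS ltnW.
      rewrite big_add1 /=; apply: le_trans; rewrite lerDr divr_ge0// exprn_ge0//.
    apply: ler_wpM2l => //; apply: le_trans (sum_pow_bound n A4).
    have [nm|mn] := leqP n m0.
      by rewrite big_geq// sumr_ge0// => m _; rewrite divr_ge0// exprn_ge0.
    rewrite [leRHS](@big_cat_nat _ _ _ m0)//=; last exact: ltnW.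
    by rewrite lerDr sumr_ge0// => m _; rewrite divr_ge0// exprn_ge0.
  have init n : \sum_(0 <= m < n) Num.min (w m / A%:R ^+ m) 1 <= n%:R.
    elim: n => [|n IH]; first by rewrite big_geq.
    by rewrite big_nat_recr//= -natr1 lerD// ge_min lexx orbT.
  move=> n; have [nm|mn] := leqP n m0.
    apply: le_trans (init n) _; have : (n%:R : R) <= m0%:R by rewrite ler_nat.
    lra.
  rewrite (@big_cat_nat _ _ _ m0)//=; last exact: ltnW.
  exact: lerD.
have [cc [C [cc0 C0 bnd]]] := psum_block_bounds R A1.
(* The primes up to 64^(A^2) are split off because [psum_block_bounds] starts at m = 2. *)
exists (wsum Phi 0 (64 ^ (A ^ 2)) + C * B1) => n.
pose T a b := \sum_(a <= p < b | prime p) lnp (Phi p) * (p%:R * ln (p%:R : R))^-1.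
have TT a b : 0 <= T a b.
  by apply: sumr_ge0 => p pp; rewrite mulr_ge0 ?lnp_ge0 ?pln_ge0.
have nbig : (n <= (64 ^ (A ^ (n + 2))).+1)%N.
  have h1 : (n < A ^ n)%N by exact: ltn_expl.
  have h2 : (A ^ n <= A ^ (n + 2))%N by rewrite leq_pexp2l// leq_addr.
  have h3 : (A ^ (n + 2) < 64 ^ (A ^ (n + 2)))%N by exact: ltn_expl.
  by rewrite ltnW// ltnS ltnW// (leq_trans h1)// (leq_trans h2)// ltnW.
apply: (@le_trans _ _ (wsum Phi 0 (64 ^ (A ^ (n + 2))))).
  have -> : wsum Phi 0 (64 ^ (A ^ (n + 2))) = T 0%N (64 ^ (A ^ (n + 2))).+1.
    by rewrite /T [RHS]big_mkcond big_ltn//= add0r -big_mkcond.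
  by rewrite -/(T 0%N n) /T [leRHS](@big_cat_nat _ _ _ n)//= lerDl; exact: TT.
rewrite (@wsum_cat _ _ 0 (64 ^ (A ^ 2)))//; last first.
  by rewrite leq0n leq_exp2l// leq_pexp2l// leq_addl.
rewrite lerD2l wsum_blocks// ?leq_addl//.
apply: (@le_trans _ _ (\sum_(2 <= m < n + 2) C * (w m / A%:R ^+ m))).
  rewrite big_nat_cond [leRHS]big_nat_cond; apply: ler_sum => m /andP[/andP[m2 _] _].
  have /andP[b1 b2] := bnd m m2.
  have Lp : 0 < psum R (64 ^ (A ^ m)) (64 ^ (A ^ m.+1)).
    by apply: lt_le_trans b1; rewrite divr_gt0// exprn_gt0.
  have -> : wsum Phi (64 ^ (A ^ m)) (64 ^ (A ^ m.+1)) = w m * psum R (64 ^ (A ^ m)) (64 ^ (A ^ m.+1)).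
    by rewrite /w /wavg mulfVK// gt_eqF.
  rewrite mulrCA; exact: ler_wpM2l.
rewrite -mulr_sumr; apply: ler_wpM2l; first exact: ltW.
apply: le_trans (HB1 (n + 2)%N); rewrite [leRHS](@big_cat_nat _ _ _ 2)//=; last exact: leq_addl.
by rewrite lerDr sumr_ge0// => m _; rewrite divr_ge0// exprn_ge0.
Qed.

End Converse.

(** * Convergence keeps the minimum positive *)

Section Multipliers.
Variable R : realType.
Implicit Types (m : R -> R) (b : nat -> R[i]) (lam : nat -> R).

(* Satisfied by the Fourier transform of a measure on [- h, h] of mass C. *)
Definition multiplier m (C h : R) : Prop :=
  forall n b lam (t0 rho K : R), 0 <= rho ->
  (forall t, `|t - t0| <= rho + h -> normc (expsum n b lam t) <= K) ->
  forall t, `|t - t0| <= rho ->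
    normc (expsum n (fun k => b k * (m (lam k))%:C) lam t) <= C * K.

Lemma multiplier_ext m m' C h : (forall x, m x = m' x) -> multiplier m C h -> multiplier m' C h.
Proof. by move=> E; have -> : m' = m by apply/funext => x; rewrite E. Qed.

Lemma multiplier_weaken m C h h' : h <= h' -> multiplier m C h -> multiplier m C h'.
Proof.
move=> hh M n b lam t0 rho K rho0 fK; apply: M => // t ht; apply: fK.
by apply: le_trans ht _; rewrite lerD2l.
Qed.

Lemma multiplier1 : multiplier (fun=> 1) 1 0.
Proof.
move=> n b lam t0 rho K rho0 fK t ht; rewrite mul1r.
have -> : (fun k => b k * 1%:C) = b by apply/funext => k; rewrite mulr1.
by apply: fK; rewrite addr0.
Qed.

(** Convolution of the underlying measures: masses multiply and supports add. *)
Lemma multiplierM m1 m2 C1 C2 h1 h2 : 0 <= h2 -> multiplier m1 C1 h1 -> multiplier m2 C2 h2 ->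
  multiplier (fun x => m1 x * m2 x) (C2 * C1) (h1 + h2).
Proof.
move=> h20 M1 M2 n b lam t0 rho K rho0 fK t ht.
have -> : (fun k => b k * (m1 (lam k) * m2 (lam k))%:C) =
    (fun k => b k * (m1 (lam k))%:C * (m2 (lam k))%:C).
  by apply/funext => k; rewrite rmorphM mulrA.
rewrite -mulrA.
apply: (M2 n (fun k => b k * (m1 (lam k))%:C) lam t0 rho _ rho0 _ t ht) => s hs.
apply: (M1 n b lam t0 (rho + h2) K _ _ s hs); first exact: addr_ge0.
by move=> u hu; apply: fK; have -> : rho + (h1 + h2) = rho + h2 + h1 by ring.
Qed.

Lemma multiplierX m C h k : 0 <= h -> multiplier m C h ->
  multiplier (fun x => m x ^+ k) (C ^+ k) (h *+ k).
Proof.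
move=> h0 M; elim: k => [|k IH].
  by apply: multiplier_ext multiplier1 => x; rewrite expr0.
rewrite exprS mulrSr; apply: multiplier_ext (multiplierM h0 IH M) => x.
by rewrite exprSr.
Qed.

Lemma multiplier_bigprod (m : nat -> R -> R) (h : nat -> R) a c :
  (forall i, 0 <= h i) -> (forall i, multiplier (m i) 1 (h i)) ->
  multiplier (fun x => \prod_(a <= i < c) m i x) 1 (\sum_(a <= i < c) h i).
Proof.
move=> h0 M; elim: c => [|c IH].
  rewrite big_geq//; apply: multiplier_ext multiplier1 => x; by rewrite big_geq.
have [ac|ca] := leqP a c; last first.
  rewrite big_geq//; apply: multiplier_ext multiplier1 => x; by rewrite big_geq.
rewrite big_nat_recr//= -[X in multiplier _ X]mulr1.
by apply: multiplier_ext (multiplierM (h0 c) IH (M c)) => x; rewrite big_nat_recr.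
Qed.

Lemma multiplier_bigsum d (q C : nat -> R) (m : nat -> R -> R) h : 0 <= h ->
  (forall i, (i < d)%N -> multiplier (m i) (C i) h) ->
  multiplier (fun x => \sum_(i < d) q i * m i x) (\sum_(i < d) `|q i| * C i) h.
Proof.
move=> h0 M n b lam t0 rho K rho0 fK t ht.
have -> : expsum n (fun k => b k * (\sum_(i < d) q i * m i (lam k))%:C) lam t =
    \sum_(i < d) (q i)%:C * expsum n (fun k => b k * (m i (lam k))%:C) lam t.
  rewrite /expsum; under [RHS]eq_bigr do rewrite mulr_sumr.
  rewrite [RHS]exchange_big; apply: eq_bigr => k _.
  rewrite (rmorph_sum (real_complex R)) mulr_sumr mulr_suml; apply: eq_bigr => i _.
  by rewrite rmorphM mulrCA !mulrA.
apply: le_trans (normc_sum _ _ _) _; rewrite mulr_suml; apply: ler_sum => i _.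
rewrite normcM normc_real -mulrA; apply: ler_wpM2l => //.
exact: (M i (ltn_ord i) n b lam t0 rho K rho0 fK t ht).
Qed.

Lemma expsum_mul_cis n b lam s t :
  expsum n (fun k => b k * cis (lam k * s)) lam t = expsum n b lam (t + s).
Proof.
by apply: eq_bigr => k _; rewrite -mulrA -cisD mulrDr addrC.
Qed.

(** Two point masses at h and - h, each of modulus 1 / (2h). Since sin (h x) / h = x sinc (h x),
    this is how a monomial becomes a multiplier once a sinc factor is sacrificed. *)
Lemma multiplier_sin (h : R) : 0 < h -> multiplier (fun x => sin (h * x) / h) h^-1 h.
Proof.
move=> h0 n b lam t0 rho K rho0 fK t ht.
have E : expsum n (fun k => b k * (sin (h * lam k) / h)%:C) lam t =
   (0 +i* (- (2 * h)^-1)) * (expsum n b lam (t + h) - expsum n b lam (t - h)).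
  rewrite -!expsum_mul_cis /expsum -sumrB mulr_sumr; apply: eq_bigr => k _.
  have -> : (sin (h * lam k) / h)%:C =
      (0 +i* (- (2 * h)^-1)) * (cis (lam k * h) - cis (lam k * - h)).
    rewrite mulrN /cis cosN sinN (mulrC h).
    by apply/eqP; rewrite eq_complex /=; apply/andP; split; apply/eqP; field; exact: lt0r_neq0.
  set i := (0 +i* _); ring.
rewrite E normcM.
have -> : normc (0 +i* (- (2 * h)^-1)) = (2 * h)^-1.
  by rewrite /= expr0n /= add0r sqrtr_sqr normrN ger0_norm// invr_ge0 mulr_ge0// ltW.
have b1 : normc (expsum n b lam (t + h)) <= K.
  apply: fK; have -> : t + h - t0 = (t - t0) + h by ring.
  by apply: le_trans (ler_normD _ _) _; rewrite (gtr0_norm h0) lerD2r.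
have b2 : normc (expsum n b lam (t - h)) <= K.
  apply: fK; have -> : t - h - t0 = (t - t0) - h by ring.
  by apply: le_trans (ler_normB _ _) _; rewrite (gtr0_norm h0) lerD2r.
have : normc (expsum n b lam (t + h) - expsum n b lam (t - h)) <= 2 * K.
  apply: le_trans (le_normcD _ _) _; rewrite normcN; lra.
move=> h2; apply: (@le_trans _ _ ((2 * h)^-1 * (2 * K))).
  by apply: ler_wpM2l => //; rewrite invr_ge0 mulr_ge0// ltW.
by rewrite invfM mulrACA mulVf// mul1r.
Qed.

Definition sinc (x : R) : R := if x == 0 then 1 else sin x / x.

Lemma sinc0 : sinc 0 = 1. Proof. by rewrite /sinc eqxx. Qed.

Lemma sinE x : sin x = x * sinc x.
Proof. by rewrite /sinc; case: eqVneq => [->|x0]; rewrite ?sin0 ?mul0r// mulrC divfK. Qed.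

Lemma icos_sinc (mu h : R) : icos mu h = h * sinc (h * mu).
Proof.
rewrite /icos /sinc mulf_eq0; have [->|m0] := eqVneq mu 0; first by rewrite orbT mulr1.
have [->|h0] := eqVneq h 0; first by rewrite mulr0 sin0 !mul0r.
by rewrite /= [mu * h]mulrC; field; rewrite m0 h0.
Qed.

Lemma icosN (mu h : R) : icos mu (- h) = - icos mu h.
Proof. by rewrite /icos; case: eqP => // _; rewrite mulrN sinN mulNr. Qed.

Lemma isinN (mu h : R) : isin mu (- h) = isin mu h.
Proof. by rewrite /isin; case: eqP => // _; rewrite mulrN cosN. Qed.

(* Multiplication by sinc (h x) replaces an exponential sum by its average over [t - h, t + h]. *)
Lemma average_antiderivative (n : nat) b lam (h t : R) : exists (w : R[i]) (G : R -> R),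
  [/\ normc w = 1,
      forall s : R, is_derive s 1 G (complex.Re (w * expsum n b lam (t + s)))
    & G h - G (- h) = 2 * h * normc (expsum n (fun k => b k * (sinc (h * lam k))%:C) lam t)].
Proof.
set z := expsum n (fun k => b k * (sinc (h * lam k))%:C) lam t.
have [w w1 wz] := normc_rotate z; exists w.
pose d k := w * (b k * cis (lam k * t)).
exists (fun s => \sum_(k < n) (complex.Re (d k) * icos (lam k) s - complex.Im (d k) * isin (lam k) s)).
split => // [s|].
  have -> : complex.Re (w * expsum n b lam (t + s)) =
     \sum_(k < n) (complex.Re (d k) * cos (lam k * s) - complex.Im (d k) * sin (lam k * s)).
    rewrite addrC -expsum_mul_cis /expsum mulr_sumr Re_sum; apply: eq_bigr => k _.
    by rewrite mulrA -/(d k) /cis; case: (d k).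
  apply: is_derive_bigsum => k.
  apply: (@is_deriveB R R R (fun s => complex.Re (d k) * icos (lam k) s)
     (fun s => complex.Im (d k) * isin (lam k) s)).
    by apply: is_derive_mulc; exact: is_derive_icos.
  by apply: is_derive_mulc; exact: is_derive_isin.
rewrite -sumrB.
have -> : normc z = complex.Re (w * z) by rewrite wz.
rewrite /z /expsum mulr_sumr Re_sum mulr_sumr; apply: eq_bigr => k _.
rewrite icosN isinN icos_sinc.
have -> : w * (b k * (sinc (h * lam k))%:C * cis (lam k * t)) = d k * (sinc (h * lam k))%:C.
  by rewrite /d -!mulrA; congr (_ * (_ * _)); rewrite mulrC.
rewrite [d k * _]mulrC ReM_real; ring.
Qed.

Lemma multiplier_sinc (h : R) : 0 < h -> multiplier (fun x => sinc (h * x)) 1 h.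
Proof.
move=> h0 n b lam t0 rho K rho0 fK t ht; rewrite mul1r.
have [w [G [w1 dG E]]] := average_antiderivative n b lam h t.
have hh : - h <= h by lra.
have dG' (s : R) : is_derive s 1 (fun s => G s - K * s) (complex.Re (w * expsum n b lam (t + s)) - K).
  have dK : is_derive s 1 (fun s : R => K * s) (K * 1) by apply: is_derive_mulc; exact: is_derive_id.
  have := @is_deriveB R R R G (fun s => K * s) s 1 _ _ (dG s) dK; by rewrite mulr1.
have bnd := mvt_le dG' hh.
have h20 : 0 < 2 * h by rewrite mulr_gt0.
rewrite -(ler_pM2l h20) -E.
have : G h - K * h <= G (- h) - K * - h.
  apply: bnd => s /andP[s1 s2]; rewrite subr_le0; apply: le_trans (Re_le_normc _) _.
  rewrite normcM w1 mul1r; apply: fK.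
  have -> : t + s - t0 = (t - t0) + s by ring.
  apply: le_trans (ler_normD _ _) _; apply: lerD => //; by rewrite ler_norml s1 s2.
lra.
Qed.

(** Passage from the L2 norm to pointwise bounds: averaging over [t - h, t + h] and 2 |f| <= |f|^2 /
    K + K, with K left free in place of Cauchy-Schwarz. *)
Lemma sqnorm_sinc_bound H a N (h t K : R) : 0 < H -> 0 < h -> 0 < K -> h <= t <= H - h ->
  normc (expsum N.+1 (fun k => coef a k * (sinc (h * @lnn R k))%:C) (@lnn R) t) <=
    (sqnorm H a N / K + 2 * h * K) / (4 * h).
Proof.
move=> H0 h0 K0 /andP[t1 t2].
have [w [G [w1 dG E]]] := average_antiderivative N.+1 (coef a) (@lnn R) h t.
pose V s := gram N.+1 (icos_mx s) (isin_mx s) (coef a).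
have dV (s : R) : is_derive s 1 V (normc (expsum N.+1 (coef a) (@lnn R) s) ^+ 2).
  exact: is_derive_gram.
have dVN (s : R) : is_derive s 1 (fun s => - V s) (- normc (expsum N.+1 (coef a) (@lnn R) s) ^+ 2).
  exact: (@is_deriveN R R R V).
have V0 : V 0 = 0 by exact: gram0.
have VH : sqnorm H a N = V H by exact: sqnormE.
have Vmono x y : x <= y -> V x <= V y.
  move=> xy; rewrite -lerN2; apply: (mvt_le dVN xy) => s _.
  by rewrite oppr_le0 sqr_ge0.
have dVt (s : R) : is_derive s 1 (fun s => V (t + s)) (normc (expsum N.+1 (coef a) (@lnn R) (t + s)) ^+ 2).
  have dt : is_derive s 1 (fun s : R => t + s) 1.
    have := @is_deriveD R R R (cst t) id s 1 _ _ (is_derive_cst _ _ _) (is_derive_id _ _).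
    by rewrite add0r.
  by apply: is_derive_eq (@is_derive1_comp R V (fun s => t + s) s _ _ (dV (t + s)) dt) _; rewrite mulr1.
pose F s := 2 * G s - (K^-1 * V (t + s) + K * s).
have dF (s : R) : is_derive s 1 F (2 * complex.Re (w * expsum N.+1 (coef a) (@lnn R) (t + s)) -
   (K^-1 * normc (expsum N.+1 (coef a) (@lnn R) (t + s)) ^+ 2 + K)).
  have dK : is_derive s 1 (fun s : R => K * s) (K * 1) by apply: is_derive_mulc; exact: is_derive_id.
  rewrite mulr1 in dK.
  have d1 := is_derive_mulc 2 (dG s).
  have d2 := is_derive_mulc K^-1 (dVt s).
  exact: (@is_deriveB R R R (fun s => 2 * G s) (fun s => K^-1 * V (t + s) + K * s) s 1 _ _ d1
    (@is_deriveD R R R (fun s => K^-1 * V (t + s)) (fun s => K * s) s 1 _ _ d2 dK)).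
have hh : - h <= h by lra.
have : F h <= F (- h).
  apply: (mvt_le dF hh) => s _; set f := expsum _ _ _ _.
  have r : complex.Re (w * f) <= normc f.
    by apply: le_trans (Re_le_normc _) _; rewrite normcM w1 mul1r.
  rewrite subr_le0; apply: (@le_trans _ _ (2 * normc f)); first by apply: ler_wpM2l.
  rewrite -(ler_pM2l K0); have -> : K * (K^-1 * normc f ^+ 2 + K) = normc f ^+ 2 + K ^+ 2.
    by field; exact: lt0r_neq0.
  have := sqr_ge0 (normc f - K); rewrite sqrrB; nra.
rewrite /F => Fh.
have VV : V (t + h) - V (t - h) <= V H.
  have := Vmono (t + h) H; have := Vmono 0 (t - h); rewrite V0 subr_ge0 => /(_ t1) v1.
  have th : t + h <= H by lra.
  move=> /(_ th); lra.
have h40 : 0 < 4 * h by rewrite mulr_gt0.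
rewrite ler_pdivlMr//.
have -> : normc (expsum N.+1 (fun k => coef a k * (sinc (h * @lnn R k))%:C) (@lnn R) t) * (4 * h)
  = 2 * (G h - G (- h)) by rewrite E; ring.
have KV : K^-1 * (V (t + h) - V (t - h)) <= K^-1 * V H.
  by apply: ler_wpM2l => //; rewrite invr_ge0 ltW.
rewrite VH [V H / K]mulrC; move: KV Fh; rewrite mulrBr; lra.
Qed.

End Multipliers.

(** * Polynomials close to 1 at 0 and small in a weighted sum over the primes *)

Section WeightedPolynomials.
Variable R : realType.

Lemma tail_small (t : nat -> R) (B e : R) : (forall m, 0 <= t m) ->
  (forall n, \sum_(0 <= m < n) t m <= B) -> 0 < e ->
  exists m0, forall n, \sum_(m0 <= m < n) t m <= e.
Proof.
move=> t0 tB e0; pose S : set R := [set x | exists n, x = \sum_(0 <= m < n) t m].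
have hS : has_sup S.
  split; first by exists (\sum_(0 <= m < 0) t m), 0%N.
  by exists B => _ [n ->].
have [_ [m0 ->] h] := sup_adherent e0 hS; exists m0 => n.
have [nm|/ltnW mn] := leqP n m0; first by rewrite big_geq// ltW.
have : \sum_(0 <= m < n) t m <= sup S by apply: ub_le_sup; [exact: (proj2 hS)|exists n].
rewrite (@big_cat_nat _ _ _ m0)//=; move: h; lra.
Qed.

Lemma small_pow (q e : R) : 0 <= q < 1 -> 0 < e -> exists k, q ^+ k <= e.
Proof.
move=> /andP[q0 q1] e0; apply: contrapT => /forallNP H.
have : 1 <= q; last by rewrite leNgt q1.
apply: (@le_of_pow_le _ _ _ e^-1) => // k; rewrite expr1n ler_pdivlMr// mul1r.
by have /negP := H k; rewrite -ltNge => /ltW.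
Qed.

Lemma poly_exp_bound (Q : {poly R}) : exists2 C : R, 0 <= C &
  forall u : R, 0 <= u -> `|Q.[u ^+ 2]| <= C * expR (u / 2).
Proof.
exists (\sum_(i < size Q) `|Q`_i| * (2 ^+ (2 * i) * ((2 * i)`!)%:R)).
  by apply: sumr_ge0 => i _; rewrite !mulr_ge0// exprn_ge0.
move=> u u0; rewrite horner_coef mulr_suml; apply: le_trans (ler_norm_sum _ _ _) _.
apply: ler_sum => i _; rewrite normrM -mulrA; apply: ler_wpM2l => //.
have u20 : 0 <= u / 2 by rewrite divr_ge0.
rewrite -exprM ger0_norm ?exprn_ge0//; set j := (2 * i)%N.
have h : (u / 2) ^+ j / j`!%:R <= expR (u / 2).
  apply: le_trans (exp_series_le j.+1 u20); rewrite big_ord_recr /= lerDr.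
  by apply: sumr_ge0 => l _; rewrite divr_ge0// exprn_ge0.
rewrite -mulrA; apply: (@le_trans _ _ (2 ^+ j * (j`!%:R * ((u / 2) ^+ j / j`!%:R)))).
  rewrite [j`!%:R * _]mulrC divfK ?pnatr_eq0 -?lt0n ?fact_gt0// -exprMn.
  by rewrite mulrC divfK.
apply: ler_wpM2l; first exact: exprn_ge0.
by apply: ler_wpM2l.
Qed.

(** Odd Taylor coefficients of the cosine vanish, so its Taylor polynomials are polynomials in u^2.
    The Taylor bound with r = 2 and s <= 1 / 4 produces exp (2 s u) <= exp (u / 2). *)
Lemma cos_taylor_poly (s : R) K : 0 < s -> s <= 1 / 4 -> exists T : {poly R},
  forall u : R, 0 <= u -> `|cos (s * u) - T.[u ^+ 2]| <= expR (u / 2) / 2 ^+ K.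
Proof.
move=> s0 s4; exists (\sum_(j < K) (complex.Re (cis_coeff R j) * s ^+ j) *: 'X^(j./2)) => u u0.
have E : (\sum_(j < K) (complex.Re (cis_coeff R j) * s ^+ j) *: 'X^(j./2)).[u ^+ 2] =
   complex.Re (\sum_(j < K) cis_coeff R j * ((s * u) ^+ j)%:C).
  rewrite horner_sum Re_sum; apply: eq_bigr => j _.
  rewrite hornerZ hornerXn -exprM [_ * (_)%:C]mulrC ReM_real.
  have [od|ev] := boolP (odd j); first by rewrite /cis_coeff /= od /= !mul0r mulr0.
  have -> : (2 * j./2 = j)%N by rewrite mul2n; have := odd_double_half j; rewrite (negbTE ev).
  by rewrite exprMn; ring.
rewrite E -[cos _]/(complex.Re (cis (s * u))).
set z := cis _; set y := \sum_(_ < _) _.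
have -> : complex.Re z - complex.Re y = complex.Re (z - y) by case: z => ? ?; case: y.
have r2 : 1 <= 2 :> R by rewrite ler1n.
have := cis_taylor (s * u) K r2; rewrite -/z -/y => h.
apply: (@le_trans _ _ (normc (z - y))).
  by rewrite ler_norml Re_le_normc andbT lerNl; have := Re_le_normc (- (z - y)); rewrite normcN; case: (z - y).
apply: le_trans h _; apply: ler_wpM2r; first by rewrite invr_ge0 exprn_ge0.
rewrite ler_expR ger0_norm ?mulr_ge0// ?(ltW s0)// mulrA [u / 2]mulrC.
by apply: ler_wpM2r => //; lra.
Qed.

(* One cosine at a time: a polynomial in u ^ 2 is at most C exp (u / 2), so
   whatever C is, it may be multiplied by a good Taylor polynomial of cos (s u). *)
Lemma cos_pow_poly (s e : R) k : 0 < s -> s <= 1 / 4 -> 0 < e -> exists Q : {poly R},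
  forall u : R, 0 <= u -> `|Q.[u ^+ 2] - cos (s * u) ^+ k| <= e * expR u.
Proof.
move=> s0 s4; elim: k e => [|k IH] e e0.
  exists 1 => u u0; rewrite hornerC expr0 subrr normr0; apply: mulr_ge0 (ltW e0) (expR_ge0 _).
have e20 : 0 < e / 2 by rewrite divr_gt0.
have [Q HQ] := IH _ e20; have [C C0 HC] := poly_exp_bound Q.
have [K HK] : exists K, (1 / 2) ^+ K <= e / 2 / (C + 1).
  by apply: small_pow; [apply/andP; split; lra | rewrite divr_gt0//; lra].
have [T HT] := cos_taylor_poly K s0 s4.
exists (Q * T) => u u0; rewrite hornerM [cos _ ^+ _]exprS.
set q := Q.[_]; set t := T.[_]; set c := cos _.
have -> : q * t - c * c ^+ k = - (q * (c - t)) + c * (q - c ^+ k) by ring.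
apply: le_trans (ler_normD _ _) _; rewrite normrN !normrM.
have eu : expR u = expR (u / 2) * expR (u / 2) by rewrite -expRD; congr expR; lra.
have -> : e * expR u = e / 2 * expR u + e / 2 * expR u by lra.
apply: lerD; last first.
  rewrite -[leRHS]mul1r; apply: ler_pM => //; last exact: HQ.
  by rewrite ler_norml cos_le1 cos_geN1.
apply: (@le_trans _ _ (C * expR (u / 2) * (expR (u / 2) / 2 ^+ K))).
  by apply: ler_pM => //; [exact: HC|exact: HT].
rewrite -exprVn; have -> : C * expR (u / 2) * (expR (u / 2) * 2^-1 ^+ K) = C * 2^-1 ^+ K * expR u.
  by rewrite eu; ring.
apply: ler_wpM2r; first exact: expR_ge0.
have C1 : 0 < C + 1 by lra.
move: HK; rewrite ler_pdivlMr// mul1r; have : 0 <= 2^-1 ^+ K :> R by rewrite exprn_ge0// invr_ge0.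
nra.
Qed.

(** The model is cos (s u)^k with u = sqrt (ln p): equal to 1 at u = 0, at most 1 everywhere, and
    tiny for large k on the primes below n1, where u is bounded away from 0 because p >= 2. Primes
    from n1 on form a small tail, and a polynomial replaces the model at small cost in the weight
    exp u. *)
Lemma weighted_poly (beta : nat -> R) (B : R) : (forall p, prime p -> 0 <= beta p) ->
  (forall n, \sum_(0 <= p < n | prime p) beta p * expR (Num.sqrt (ln p%:R)) <= B) ->
  exists2 Q : {poly R}, `|Q.[0] - 1| <= 1 / 8 &
    forall n, \sum_(0 <= p < n | prime p) beta p * `|Q.[ln p%:R]| <= 1 / 4.
Proof.
move=> b0 bB; pose u p : R := Num.sqrt (ln p%:R).
have B0 : 0 <= B by have := bB 0%N; rewrite big_geq.
have u0 p : 0 <= u p by exact: sqrtr_ge0.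
pose t p := if prime p then beta p * expR (u p) else 0.
have t0 p : 0 <= t p by rewrite /t; case: ifP => // pp; rewrite mulr_ge0 ?expR_ge0 ?b0.
have tB n : \sum_(0 <= p < n) t p <= B by rewrite -big_mkcond.
have e16 : 0 < 1 / 16 :> R by rewrite divr_gt0.
have [n1 Hn1] := tail_small t0 tB e16.
(* Keeps s u p <= 1 for the primes below n1, where the cosine is decreasing, and s <= 1 / 4 as
   [cos_pow_poly] requires. *)
pose s : R := 1 / (4 + u n1).
have d0 : 0 < 4 + u n1 by have := u0 n1; lra.
have s0 : 0 < s by rewrite divr_gt0.
have s4 : s <= 1 / 4.
  by rewrite /s !mul1r lef_pV2 ?posrE// lerDl.
have u2 : 0 < u 2 by rewrite sqrtr_gt0 ln_gt0// ltr1n.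
have um p q : (0 < p)%N -> (p <= q)%N -> u p <= u q.
  move=> p0 pq; rewrite ler_wsqrtr// ler_ln ?posrE ?ltr0n ?ler_nat//; exact: leq_trans pq.
have cs p : prime p -> (p < n1)%N -> 0 <= cos (s * u p) <= cos (s * u 2).
  move=> pp pn; have h1 : s * u 2 <= s * u p.
    by rewrite ler_pM2l// um// prime_gt1.
  have h2 : s * u p <= 1.
    rewrite mulrC mulrA mulr1 ler_pdivrMr// mul1r; have := um p n1 (prime_gt0 pp) (ltnW pn); lra.
  have h3 : 0 <= s * u 2 by rewrite mulr_ge0// ltW.
  have p2 := pi_ge2 R.
  apply/andP; split.
    by apply: cos_ge0_pihalf; apply/andP; split; lra.
  have [->//|ne] := eqVneq (s * u p) (s * u 2).
  apply/ltW; rewrite ltr_cos ?in_itv /=.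
  - by rewrite lt_def ne.
  - by apply/andP; split; lra.
  - by apply/andP; split; lra.
have q01 : 0 <= `|cos (s * u 2)| < 1.
  have p2 := pi_ge2 R; have h3 : 0 < s * u 2 by rewrite mulr_gt0.
  have h4 : s * u 2 <= 1 / 2.
    have : u 2 <= 1.
      by rewrite -sqrtr1 ler_wsqrtr//; have := @ln_le_sub1 R 2 (ltr0Sn _ _); lra.
    move=> h5; apply: (@le_trans _ _ (s * 1)); first by rewrite ler_pM2l.
    lra.
  rewrite normr_ge0 /=; rewrite ger0_norm; last by apply: cos_ge0_pihalf; apply/andP; split; lra.
  rewrite -[ltRHS](cos0 R) ltr_cos ?in_itv /= ?lexx ?pi_ge0//.
  by apply/andP; split; lra.
have eB : 0 < 1 / (16 * (B + 1)) by rewrite divr_gt0// mulr_gt0//; lra.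
have [k Hk] := small_pow q01 eB.
have [Q HQ] := cos_pow_poly k s0 s4 eB.
have eB1 : 1 / (16 * (B + 1)) * B <= 1 / 16.
  rewrite mulrC mulrA mulr1 ler_pdivrMr; last by rewrite mulr_gt0//; lra.
  lra.
exists Q.
  have := HQ 0 (lexx _); rewrite mulr0 cos0 expr1n expR0 mulr1 expr0n /= => h.
  apply: le_trans h _; rewrite ler_pdivrMr; last by rewrite mulr_gt0//; lra.
  lra.
move=> n.
pose c p := if prime p then beta p * `|cos (s * u p) ^+ k| else 0.
have c0 p : 0 <= c p by rewrite /c; case: ifP => // pp; rewrite mulr_ge0 ?b0.
apply: (@le_trans _ _ (\sum_(0 <= p < n) (c p + 1 / (16 * (B + 1)) * t p))).
  rewrite big_mkcond; apply: ler_sum => p _; rewrite /c /t; case: ifP => [pp|_]; last by rewrite mulr0 addr0.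
  rewrite mulrCA -mulrDr; apply: ler_wpM2l; first exact: b0.
  have := HQ (u p) (u0 p); rewrite sqr_sqrtr; last by rewrite ln_ge0// ler1n prime_gt0.
  set x := Q.[_]; set y := cos _ ^+ k => h.
  have -> : x = y + (x - y) by ring.
  by apply: le_trans (ler_normD _ _) _; rewrite lerD2l.
rewrite big_split /= -mulr_sumr.
have h2 : 1 / (16 * (B + 1)) * \sum_(0 <= p < n) t p <= 1 / 16.
  by apply: le_trans eB1; apply: ler_wpM2l => //; exact: ltW.
suff : \sum_(0 <= p < n) c p <= 1 / 16 + 1 / 16 by lra.
have small p : (p < n1)%N -> c p <= 1 / (16 * (B + 1)) * t p.
  move=> pn; rewrite /c /t; case: ifP => [pp|_]; last by rewrite mulr0.
  rewrite mulrCA; apply: ler_wpM2l; first exact: b0.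
  apply: (@le_trans _ _ (`|cos (s * u 2)| ^+ k)).
    rewrite normrX; apply: lerXn2r; rewrite ?nnegrE//.
    by have /andP[h h'] := cs p pp pn; rewrite !ger0_norm//; exact: le_trans h'.
  apply: le_trans Hk _; rewrite -[leLHS]mulr1; apply: ler_wpM2l; first exact: ltW.
  by have := expR_ge1Dx (u p); have := u0 p; lra.
have large p : c p <= t p.
  rewrite /c /t; case: ifP => // pp; apply: ler_wpM2l; first exact: b0.
  apply: (@le_trans _ _ 1); last by have := expR_ge1Dx (u p); have := u0 p; lra.
  by rewrite normrX exprn_ile1// ler_norml cos_le1 cos_geN1.
have first_part m : (m <= n1)%N -> \sum_(0 <= p < m) c p <= 1 / 16.
  move=> mn; apply: (@le_trans _ _ (\sum_(0 <= p < m) (1 / (16 * (B + 1)) * t p))).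
    by apply: ler_sum_nat => p /andP[_ pm]; apply: small; exact: leq_trans pm mn.
  by rewrite -mulr_sumr; apply: le_trans eB1; apply: ler_wpM2l => //; exact: ltW.
have [nn|nn] := leqP n n1; first by have := first_part n nn; lra.
rewrite (@big_cat_nat _ _ _ n1)//=; last exact: ltnW.
apply: lerD; first exact: first_part.
by apply: le_trans (Hn1 n); apply: ler_sum => p _; exact: large.
Qed.

End WeightedPolynomials.

(** * Convergence of the series of log+ Phi bounds the norm from below *)

Section Direct.
Variable R : realType.

Lemma sinc_le1 (x : R) : `|sinc x| <= 1.
Proof.
rewrite /sinc; case: eqVneq => [_|x0]; first by rewrite normr1.
rewrite normrM normfV ler_pdivrMr ?normr_gt0// mul1r.
by have := lip_sin 1 x 0; rewrite !mul1r sin0 !subr0 normr1 mul1r.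
Qed.

Lemma sinc_leV (x y : R) : 0 < y -> y <= x -> `|sinc x| <= y^-1.
Proof.
move=> y0 yx; have x0 : 0 < x by exact: lt_le_trans yx.
rewrite /sinc gt_eqF// normrM normfV (gtr0_norm x0).
apply: (@le_trans _ _ (1 / x)).
  by apply: ler_wpM2r; rewrite ?invr_ge0 ?(ltW x0)// ler_norml sin_le1 sin_geN1.
by rewrite mul1r lef_pV2.
Qed.

(** Evaluate the multiplied sum at the midpoint H / 2. Its constant term is at least 7 / 8 and the
    primes contribute at most 1 / 4; on the other hand it is at most C times the averaged sum on H /
    2 +- H / 4, which the L2 norm controls. The bound is uniform in N because C is. *)
Lemma lower_bound_of_multiplier Phi (H C : R) : 0 < H -> 0 <= C ->
  (forall p, prime p -> 0 < Phi p) ->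
  (forall N, exists G : R -> R, [/\ multiplier G C (H / 4), 7 / 8 <= `|G 0| &
     \sum_(0 <= p < N.+1 | prime p) Phi p / p%:R * `|G (ln p%:R)| <= 1 / 4]) ->
  exists2 d : R, 0 < d & forall N a, admissible Phi N a -> d <= sqnorm H a N.
Proof.
move=> H0 C0 Phi0 HG.
(* Averaging over radius H / 8 around points within H / 4 of the midpoint stays inside [0, H]. With
   C K <= 1 / 2 the term in K of [sqnorm_sinc_bound] costs at most 1 / 4 of the available 5 / 8. *)
pose h := H / 8; pose K := 1 / (2 * (C + 1)).
have h0 : 0 < h by rewrite divr_gt0.
have C1 : 0 < C + 1 by lra.
have K0 : 0 < K by rewrite divr_gt0// mulr_gt0.
have CK : C * K <= 1 / 2.
  by rewrite /K mulrA mulr1 ler_pdivrMr ?mulr_gt0//; lra.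
exists (h * K / (C + 1)); first by rewrite divr_gt0// mulr_gt0.
move=> N a adm; have [G [MG G0 sG]] := HG N.
set s := sqnorm H a N.
pose b k := coef a k * (sinc (h * @lnn R k))%:C.
pose K1 := (s / K + 2 * h * K) / (4 * h).
have bK t : `|t - H / 2| <= 0 + H / 4 -> normc (expsum N.+1 b (@lnn R) t) <= K1.
  rewrite add0r ler_norml => /andP[t1 t2]; apply: sqnorm_sinc_bound => //.
  by apply/andP; split; rewrite /h; lra.
have := MG N.+1 b (@lnn R) (H / 2) 0 K1 (lexx _) bK (H / 2).
rewrite subrr normr0 lexx => /(_ isT) up.
have low : 5 / 8 <= normc (expsum N.+1 (fun k => b k * (G (@lnn R k))%:C) (@lnn R) (H / 2)).
  rewrite /expsum big_ord_recl /= {1}/b /coef /= lnn0 !mul0r !mulr0 sinc0 cis0 !mulr1 mul1r.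
  have S : normc (\sum_(i < N) b (lift ord0 i) * (G (@lnn R (lift ord0 i)))%:C * cis (@lnn R (lift ord0 i) * (H / 2))) <= 1 / 4.
    apply: le_trans sG; apply: le_trans (normc_sum _ _ _) _.
    rewrite [leRHS]big_mkcond big_mkord [leRHS]big_ord_recl /= add0r; apply: ler_sum => i _.
    rewrite /bump leq0n add1n !normcM normc_real normc_cis mulr1 /b.
    have -> : coef a i.+1 = if prime i.+1 then a i.+1 * (i.+1%:R^-1)%:C else 0 by [].
    case: ifPn => pp; last by rewrite normc0 !mul0r.
    rewrite !normcM !normc_real; apply: ler_wpM2r => //.
    rewrite -[leRHS]mulr1; apply: ler_pM; rewrite ?mulr_ge0 ?normc_ge0 ?sinc_le1//.
    rewrite ger0_norm ?invr_ge0//; apply: ler_wpM2r; first by rewrite invr_ge0.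
    by apply: adm.
  move: S; set z := \sum_(i < N) _ => S.
  have := le_normcB (G 0)%:C (- z); rewrite opprK normcN normc_real; lra.
have h4 : 0 < 4 * h by rewrite mulr_gt0.
have := le_trans low up; rewrite /K1 mulrA ler_pdivlMr// mulrDr => e1.
have e2 : C * (2 * h * K) <= h by rewrite -mulrA mulrCA mulrA mulrCA; nra.
have e3 : h <= C * (s / K) by lra.
have s0 : 0 <= s.
  have : 0 < C * (s / K) by lra.
  move: C0; rewrite le_eqVlt => /predU1P[<-|Cp]; first by rewrite mul0r ltxx.
  by rewrite pmulr_rgt0// pmulr_lgt0 ?invr_gt0// => /ltW.
rewrite ler_pdivrMr//; move: e3; rewrite mulrA ler_pdivlMr//; nra.
Qed.

Lemma block_find (f : nat -> nat) p m0 J : {homo f : i j / (i <= j)%N} ->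
  (f m0 < p)%N -> (p <= f J)%N -> exists2 m, (m0 <= m < J)%N & (f m < p <= f m.+1)%N.
Proof.
move=> mf m0p; elim: J => [|J IH] pJ.
  by have := leq_trans m0p (leq_trans pJ (mf 0%N m0 isT)); rewrite ltnn.
have [pj|jp] := leqP p (f J).
  by have [m /andP[h1 h2] h3] := IH pj; exists m => //; rewrite h1 ltnW.
exists J; last by rewrite jp.
rewrite ltnSn andbT leqNgt; apply/negP => Jm.
by have := leq_trans m0p (leq_trans pJ (mf _ _ Jm)); rewrite ltnn.
Qed.

Lemma geo_half n : \sum_(0 <= m < n) (1 / 2) ^+ m <= 2 :> R.
Proof.
apply: (@le_trans _ _ (2 - 2 * (1 / 2) ^+ n)); last first.
  by rewrite gerBl mulr_ge0// exprn_ge0// divr_ge0.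
elim: n => [|n IH]; first by rewrite big_geq// expr0; lra.
rewrite big_nat_recr//= [_ ^+ n.+1]exprS; lra.
Qed.

Lemma sqrt_ln_le (x : R) : 0 < x -> Num.sqrt x + 2 * ln x <= 5 * Num.sqrt x.
Proof.
move=> x0; have s0 : 0 < Num.sqrt x by rewrite sqrtr_gt0.
have -> : ln x = 2 * ln (Num.sqrt x).
  by rewrite -{1}(sqr_sqrtr (ltW x0)) lnXn// mulr_natl.
have := ln_le_sub1 s0; lra.
Qed.

(* Each of the n_m factors sinc (h_m x), h_m = e / (4 ^ m ln 64), gains 1 / e on
   the m-th block. *)
Lemma decay_factor (Phi : nat -> R) (B h : R) :
  (forall p, prime p -> 0 < Phi p) ->
  (forall p q, prime p -> prime q -> (p <= q)%N -> Phi p <= Phi q) ->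
  (forall n, \sum_(0 <= p < n | prime p) lnp (Phi p) * (p%:R * ln (p%:R : R))^-1 <= B) ->
  0 < h ->
  exists2 P0 : nat, (1 < P0)%N & forall N, exists D : R -> R,
    [/\ multiplier D 1 h, D 0 = 1, (forall x, `|D x| <= 1) &
     forall p, prime p -> (P0 < p <= N)%N ->
       Phi p * `|D (ln p%:R)| * expR (Num.sqrt (ln p%:R)) <= (ln p%:R ^+ 2)^-1].
Proof.
move=> Phi0 Phi_incr HB h0.
have [c [C [c0 C0 bnd]]] := @psum_block_bounds R 4 isT.
pose f m := (64 ^ (4 ^ m))%N.
have mf : {homo f : i j / (i <= j)%N}.
  by move=> i j ij; rewrite /f leq_exp2l// leq_pexp2l.
pose w m := wavg Phi 4 m; have w0 m : 0 <= w m by exact: wavg_ge0.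
have L0 := L64_gt0 R; set L := L64 R in L0.
pose e : R := expR 1; have e0 : 0 < e by exact: expR_gt0.
pose hh m : R := e / (4 ^+ m * L).
have hh0 m : 0 < hh m by rewrite divr_gt0// mulr_gt0// exprn_gt0.
(* Absorbs exp (sqrt x) and x^2, which together cost sqrt x + 2 ln x <= 5 sqrt x in the exponent,
   where sqrt x <= 2^(m+1) sqrt L on block m. This grows like 2^m against h_m of order 4^-m, hence
   is summable. *)
pose r m : R := 5 * (2 ^+ m.+1 * Num.sqrt L).
have r0 m : 0 <= r m by rewrite !mulr_ge0// ?exprn_ge0// sqrtr_ge0.
(* On block m, ln Phi is at most the average over the following block, whence w m.+1. *)
pose nn m := (Num.truncn (w m.+1 + r m)).+1.
have wr m : 0 <= w m.+1 + r m by exact: addr_ge0.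
pose T m := hh m *+ nn m.
have T0 m : 0 <= T m by rewrite mulrn_wge0// ltW.
pose S m := wsum Phi (f m) (f m.+1).
have Lp m : (2 <= m)%N -> 0 < psum R (f m) (f m.+1).
  move=> m2; have /andP[b1 _] := bnd m m2; apply: lt_le_trans b1.
  by rewrite divr_gt0// exprn_gt0.
have wS m : (2 <= m)%N -> w m / 4 ^+ m <= c^-1 * S m.
  move=> m2; have /andP[b1 _] := bnd m m2.
  have -> : S m = w m * psum R (f m) (f m.+1) by rewrite /w /wavg mulfVK// gt_eqF// Lp.
  rewrite mulrCA; apply: ler_wpM2l => //; rewrite -(ler_pM2l c0) mulVKf ?gt_eqF//.
have TB m : (1 <= m)%N -> T m <= e / L * (4 * (c^-1 * S m.+1) + (10 * Num.sqrt L + 1) * (1 / 2) ^+ m).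
  move=> m1; have m4 : 0 < 4 ^+ m :> R by exact: exprn_gt0.
  have -> : T m = e / L * ((nn m)%:R / 4 ^+ m).
    by rewrite /T /hh -mulr_natr; field; rewrite !gt_eqF.
  apply: ler_wpM2l; first by rewrite divr_ge0// ltW.
  have n1 : (nn m)%:R <= w m.+1 + r m + 1.
    by rewrite /nn -natr1 lerD2r truncn_le.
  apply: (@le_trans _ _ ((w m.+1 + r m + 1) / 4 ^+ m)).
    by apply: ler_wpM2r => //; rewrite invr_ge0 ltW.
  have e1 : w m.+1 / 4 ^+ m = 4 * (w m.+1 / 4 ^+ m.+1).
    by rewrite [4 ^+ m.+1]exprS; field; rewrite gt_eqF.
  have e2 : r m / 4 ^+ m = 10 * Num.sqrt L * (1 / 2) ^+ m.
    have -> : 4 ^+ m = 2 ^+ m * 2 ^+ m :> R by rewrite -exprMn; congr (_ ^+ _); ring.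
    rewrite /r [2 ^+ m.+1]exprS expr_div_n expr1n; field.
    by rewrite gt_eqF// exprn_gt0.
  have e3 : 1 / 4 ^+ m <= (1 / 2) ^+ m :> R.
    rewrite expr_div_n expr1n !mul1r lef_pV2 ?posrE ?exprn_gt0//.
    by apply: lerXn2r; rewrite ?nnegrE// ler_nat.
  have -> : (w m.+1 + r m + 1) / 4 ^+ m = w m.+1 / 4 ^+ m + r m / 4 ^+ m + 1 / 4 ^+ m by ring.
  have -> : (10 * Num.sqrt L + 1) * (1 / 2) ^+ m = 10 * Num.sqrt L * (1 / 2) ^+ m + (1 / 2) ^+ m by ring.
  rewrite e1 e2 -[leLHS]addrA; apply: lerD; last by rewrite lerD2l.
  by apply: ler_wpM2l => //; exact: wS.
have Ssum n : \sum_(0 <= m < n) S m.+2 <= B.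
  have -> : \sum_(0 <= m < n) S m.+2 = wsum Phi (f 2) (f n.+2).
    rewrite wsum_blocks// (big_addn 0 n.+2 2) /= subn2 /=.
    by apply: eq_bigr => m _; rewrite addn2.
  apply: le_trans (HB (f n.+2).+1); rewrite [leRHS](@big_cat_nat _ _ _ (f 2).+1)//=; last first.
    by rewrite ltnS mf.
  by rewrite lerDr sumr_ge0// => p pp; rewrite mulr_ge0 ?lnp_ge0 ?pln_ge0.
have Tsum n : \sum_(0 <= m < n) T m.+1 <= e / L * (4 * (c^-1 * B) + (10 * Num.sqrt L + 1) * 2).
  apply: (@le_trans _ _ (\sum_(0 <= m < n) (e / L * (4 * (c^-1 * S m.+2) + (10 * Num.sqrt L + 1) * (1 / 2) ^+ m)))).
    apply: ler_sum => m _; apply: le_trans (TB m.+1 isT) _.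
    apply: ler_wpM2l; first by rewrite divr_ge0// ltW.
    rewrite lerD2l; apply: ler_wpM2l; first by rewrite addr_ge0// mulr_ge0// sqrtr_ge0.
    by rewrite [_ ^+ m.+1]exprS ler_piMl// ?exprn_ge0// ?divr_ge0//; lra.
  rewrite -mulr_sumr big_split /= -!mulr_sumr; apply: ler_wpM2l; first by rewrite divr_ge0// ltW.
  apply: lerD.
    by apply: ler_wpM2l => //; apply: ler_wpM2l; [rewrite invr_ge0 ltW | exact: Ssum].
  by apply: ler_wpM2l; [rewrite addr_ge0// mulr_ge0// sqrtr_ge0 | exact: geo_half].
(* Dropping initial blocks brings the total support below h. The cut, and with it P0, is chosen
   before N. *)
have [m1 tail] := tail_small (fun m => T0 m.+1) Tsum h0.
pose m0 := m1.+1; exists (f m0).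
  by rewrite /f -[X in (X < _)%N](expn0 64) ltn_exp2l// expn_gt0.
move=> N; pose J := (m0 + N)%N.
pose D x := \prod_(m0 <= m < J) sinc (hh m * x) ^+ nn m.
have fac m x : `|sinc (hh m * x) ^+ nn m| <= 1 by rewrite normrX exprn_ile1// sinc_le1.
have prod1 i j x : `|\prod_(i <= m < j) sinc (hh m * x) ^+ nn m| <= 1.
  by rewrite normr_prod; apply: prodr_ile1 => m _; rewrite normr_ge0 fac.
exists D; split.
- apply: (@multiplier_weaken _ _ _ (\sum_(m0 <= m < J) T m)).
    by rewrite /J /m0 big_add1; exact: tail.
  apply: multiplier_bigprod => // m.
  rewrite -[X in multiplier _ X](expr1n _ (nn m)).
  by apply: multiplierX; [exact: ltW | exact: multiplier_sinc].
- by rewrite /D big1// => m _; rewrite mulr0 sinc0 expr1n.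
- by move=> x; exact: prod1.
move=> p pp /andP[pm pN].
have pJ : (p <= f J)%N.
  apply: leq_trans pN _; apply: leq_trans (leq_addl m0 N) _.
  apply: leq_trans (ltnW (ltn_expl J (isT : (1 < 4)%N))) _.
  exact: ltnW (ltn_expl _ _).
have [m /andP[mm mJ] /andP[fm pfm]] := block_find mf pm pJ.
set x := ln p%:R; have p0 : (0 < p)%N by exact: prime_gt0.
have x1 : 4 ^+ m * L <= x.
  rewrite -natrX -ln_pow64 /x ler_ln ?posrE ?ltr0n ?expn_gt0//.
  by rewrite ler_nat ltnW.
have x2 : x <= 4 ^+ m.+1 * L.
  rewrite -natrX -ln_pow64 /x ler_ln ?posrE ?ltr0n ?expn_gt0//.
  by rewrite ler_nat.
have x0 : 0 < x by apply: lt_le_trans x1; rewrite mulr_gt0// exprn_gt0.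
have Dx : `|D x| <= expR (- (nn m)%:R).
  have -> : D x = \prod_(m0 <= i < m) sinc (hh i * x) ^+ nn i *
     (sinc (hh m * x) ^+ nn m * \prod_(m.+1 <= i < J) sinc (hh i * x) ^+ nn i).
    rewrite /D (@big_cat_nat _ _ _ m)//=; last exact: ltnW.
    by rewrite [X in _ * X = _]big_ltn.
  rewrite !normrM; apply: (@le_trans _ _ (1 * (`|sinc (hh m * x) ^+ nn m| * 1))).
    by apply: ler_pM; rewrite ?mulr_ge0//; apply: ler_wpM2l.
  have -> : expR (- (nn m)%:R) = expR (- 1) ^+ nn m :> R by rewrite -expRM_natr mulN1r.
  rewrite mul1r mulr1 normrX.
  apply: lerXn2r; rewrite ?nnegrE ?expR_ge0// expRN; apply: sinc_leV => //.
  rewrite /hh mulrAC ler_pdivlMr ?mulr_gt0 ?exprn_gt0//; apply: ler_wpM2l => //; exact: ltW.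
have sx : Num.sqrt x <= 2 ^+ m.+1 * Num.sqrt L.
  have -> : 2 ^+ m.+1 = Num.sqrt (4 ^+ m.+1) :> R.
    have -> : 4 = 2 ^+ 2 :> R by ring.
    by rewrite -exprM mulnC exprM sqrtr_sqr ger0_norm// exprn_ge0.
  by rewrite -sqrtrM ?exprn_ge0// ler_wsqrtr.
have wp : ln (Phi p) <= w m.+1.
  apply: le_trans (ln_le_lnp _) _; apply: wavg_ge => //; apply: Lp.
  by rewrite ltnS (leq_trans _ mm).
have nm : w m.+1 + r m <= (nn m)%:R by rewrite ltW// truncnS_gt.
have P0 := Phi0 p pp.
have -> : (x ^+ 2)^-1 = expR (- (2 * ln x)).
  by rewrite expRN [2 * _]mulrC expRM_natr lnK.
rewrite -[Phi p]lnK//.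
apply: (@le_trans _ _ (expR (ln (Phi p)) * expR (- (nn m)%:R) * expR (Num.sqrt x))).
  by apply: ler_wpM2r; [exact: expR_ge0 | apply: ler_wpM2l => //; exact: expR_ge0].
rewrite -!expRD ler_expR; have := sqrt_ln_le x0; move: nm wp sx; rewrite /r; lra.
Qed.

(** Telescoping: 1 / ln n - 1 / ln (n + 1) is at least 1 / ((n + 1) (ln (n + 1))^2), because ln (n +
    1) - ln n >= 1 / (n + 1). *)
Lemma sum_inv_ln2 (m k : nat) : (1 < m)%N ->
  \sum_(m.+1 <= n < k) (n%:R * ln (n%:R : R) ^+ 2)^-1 <= (ln m%:R)^-1.
Proof.
move=> m1.
have l0 n : (1 < n)%N -> 0 < ln (n%:R : R) by move=> n1; rewrite ln_gt0// ltr1n.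
have [km|mk] := leqP k m.+1.
  by rewrite big_geq// invr_ge0 ltW// l0.
have step n : (1 < n)%N -> (n.+1%:R * ln (n.+1%:R : R) ^+ 2)^-1 <= (ln n%:R)^-1 - (ln n.+1%:R)^-1.
  move=> n1; have a0 := l0 n n1; have b0 := l0 n.+1 (ltnW n1).
  have n0 : (0 : R) < n%:R by rewrite ltr0n ltnW.
  have s0 : (0 : R) < n.+1%:R by [].
  have ab : ln (n%:R : R) <= ln n.+1%:R by rewrite ler_ln ?posrE// ler_nat.
  have d : n.+1%:R^-1 <= ln (n.+1%:R : R) - ln n%:R.
    have := @ln_le_sub1 R (n%:R / n.+1%:R); rewrite divr_gt0// => /(_ isT).
    rewrite ln_div ?posrE//.
    have -> : n%:R / n.+1%:R - 1 = - n.+1%:R^-1 :> R.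
      by rewrite -natr1; field; rewrite natr1 gt_eqF.
    by rewrite lerNr opprB.
  have -> : (ln n%:R)^-1 - (ln n.+1%:R)^-1 = (ln (n.+1%:R : R) - ln n%:R) * (ln (n%:R : R) * ln n.+1%:R)^-1.
    by field; rewrite !gt_eqF.
  rewrite invfM; apply: ler_pM => //; rewrite ?invr_ge0 ?exprn_ge0 ?(ltW b0)//.
  rewrite lef_pV2 ?posrE ?mulr_gt0 ?exprn_gt0// expr2; apply: ler_wpM2r => //; exact: ltW.
case: k mk => // k; rewrite ltnS => /ltnW mk.
suff : \sum_(m.+1 <= n < k.+1) (n%:R * ln (n%:R : R) ^+ 2)^-1 <= (ln m%:R)^-1 - (ln k%:R)^-1.
  move=> h; apply: le_trans h _; rewrite gerBl invr_ge0 ltW// l0//.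
  exact: leq_trans m1 mk.
elim: k mk => [|k IH]; first by rewrite leqn0 => /eqP m0; rewrite m0 in m1.
rewrite leq_eqVlt => /predU1P[<-|mk]; first by rewrite big_geq// subrr.
rewrite big_nat_recr//=.
by apply: le_trans (lerD (IH mk) (step k (leq_trans m1 mk))) _; rewrite addrA subrK.
Qed.

Lemma direct_direction (Phi : nat -> R) (H B : R) :
  (forall p, prime p -> 0 < Phi p) ->
  (forall p q, prime p -> prime q -> (p <= q)%N -> Phi p <= Phi q) ->
  0 < H ->
  (forall n, \sum_(0 <= p < n | prime p) lnp (Phi p) * (p%:R * ln (p%:R : R))^-1 <= B) ->
  exists2 d : R, 0 < d & forall N a, admissible Phi N a -> d <= sqnorm H a N.
Proof.
move=> Phi0 Phi_incr H0 HB.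
have h8 : 0 < H / 8 by rewrite divr_gt0.
have [P0 P1 decay] := decay_factor Phi0 Phi_incr HB h8.
pose u p : R := Num.sqrt (ln p%:R).
(* Bounds what the sinc product leaves of Phi p / p: nothing is gained up to P0, and beyond it
   [decay] leaves room for the weight exp (u p). As beta does not depend on N, neither do Q and C,
   while the product D depends on N but has mass 1. *)
pose beta p : R := if (p <= P0)%N then Phi p / p%:R else (p%:R * ln p%:R ^+ 2)^-1 * expR (- u p).
have beta0 p : prime p -> 0 <= beta p.
  move=> pp; rewrite /beta; case: ifP => _; first by rewrite divr_ge0// ltW// Phi0.
  by rewrite mulr_ge0 ?expR_ge0// invr_ge0 mulr_ge0// sqr_ge0.
pose B1 := \sum_(0 <= p < P0.+1 | prime p) beta p * expR (u p).
have bterm p : prime p -> 0 <= beta p * expR (u p) by move=> pp; rewrite mulr_ge0 ?beta0 ?expR_ge0.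
have betaB n : \sum_(0 <= p < n | prime p) beta p * expR (u p) <= B1 + (ln P0%:R)^-1.
  have l0 : 0 <= (ln (P0%:R : R))^-1 by rewrite invr_ge0 ln_ge0// ler1n ltnW.
  have [nP|Pn] := leqP n P0.+1.
    rewrite /B1 [X in _ <= X + _](@big_cat_nat _ _ _ n)//= -addrA lerDl addr_ge0//.
    exact: sumr_ge0.
  rewrite (@big_cat_nat _ _ _ P0.+1)//=; last exact: ltnW.
  rewrite lerD2l; apply: le_trans (sum_inv_ln2 n P1).
  rewrite big_mkcond big_nat_cond [leRHS]big_nat_cond; apply: ler_sum => p /andP[/andP[Pp _] _].
  have t0 : 0 <= (p%:R * ln (p%:R : R) ^+ 2)^-1 by rewrite invr_ge0 mulr_ge0// sqr_ge0.
  case: ifP => // pp; rewrite /beta leqNgt Pp /= -mulrA -expRD addNr expR0 mulr1.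
  exact: lexx.
have [Q Q0 Qs] := weighted_poly beta0 betaB.
(* d sinc factors of this width have total support at most H / 8. *)
pose d := size Q; pose eta : R := H / 8 / d.+1%:R.
have eta0 : 0 < eta by rewrite divr_gt0.
have etad : eta *+ d <= H / 8.
  have -> : eta *+ d = H / 8 * (d%:R / d.+1%:R) by rewrite /eta -[LHS]mulr_natr; ring.
  by rewrite ler_piMr ?(ltW h8)// ler_pdivrMr// mul1r ler_nat.
pose C := \sum_(i < d) `|Q`_i| * eta^-1 ^+ i.
have C0 : 0 <= C.
  by apply: sumr_ge0 => i _; rewrite mulr_ge0// exprn_ge0// invr_ge0 ltW.
(* The monomial x^i uses up i of the d sinc factors, turning each into sin (eta x) / eta; the
   remaining d - i keep mass 1. *)
have MQ : multiplier (fun x => Q.[x] * sinc (eta * x) ^+ d) C (H / 8).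
  apply: (@multiplier_ext _ (fun x => \sum_(i < d) Q`_i * ((sin (eta * x) / eta) ^+ i * sinc (eta * x) ^+ (d - i)))).
    move=> x; rewrite horner_coef mulr_suml; apply: eq_bigr => i _.
    rewrite -mulrA; congr (_ * _); have -> : sin (eta * x) / eta = x * sinc (eta * x).
      by rewrite sinE; field; rewrite gt_eqF.
    by rewrite exprMn -mulrA -exprD subnKC// ltnW.
  apply: (@multiplier_weaken _ _ _ (eta *+ d)) => //.
  apply: (@multiplier_bigsum _ d (fun i => Q`_i) (fun i => eta^-1 ^+ i)
     (fun i x => (sin (eta * x) / eta) ^+ i * sinc (eta * x) ^+ (d - i))).
    by rewrite mulrn_wge0// ltW.
  move=> i id_; have -> : eta *+ d = eta *+ i + eta *+ (d - i) by rewrite -mulrnDr subnKC// ltnW.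
  have := @multiplierM R (fun x => (sin (eta * x) / eta) ^+ i) (fun x => sinc (eta * x) ^+ (d - i))
     (eta^-1 ^+ i) (1 ^+ (d - i)) (eta *+ i) (eta *+ (d - i)).
  rewrite expr1n mul1r; apply.
  - by rewrite mulrn_wge0// ltW.
  - by apply: multiplierX; [exact: ltW | exact: multiplier_sin].
  - by rewrite -(expr1n R (d - i)); apply: multiplierX; [exact: ltW | exact: multiplier_sinc].
apply: (@lower_bound_of_multiplier Phi H C) => // N.
have [D [MD D0 D1 Dp]] := decay N.
exists (fun x => Q.[x] * sinc (eta * x) ^+ d * D x); split.
- have -> : H / 4 = H / 8 + H / 8 by lra.
  rewrite -[C]mul1r; apply: multiplierM => //; exact: ltW.
- rewrite mulr0 sinc0 expr1n mulr1 D0 mulr1.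
  by move: Q0; rewrite ler_norml => /andP[q1 _]; rewrite ger0_norm; lra.
apply: le_trans (Qs N.+1); rewrite big_nat_cond [leRHS]big_nat_cond; apply: ler_sum => p /andP[/andP[_ pN] pp].
rewrite !normrM; set s := `|sinc _ ^+ _|; set q := `|Q.[_]|; set dx := `|D _|.
have s1 : s <= 1 by rewrite /s normrX exprn_ile1// sinc_le1.
have pos : 0 <= Phi p / p%:R by rewrite divr_ge0// ltW// Phi0.
have key : Phi p / p%:R * dx <= beta p.
  rewrite /beta; case: leqP => pP; first by rewrite ler_piMr// D1.
  have pp' : (P0 < p <= N)%N by rewrite pP -ltnS.
  have := Dp p pp pp'; rewrite -/dx -ler_pdivlMr ?expR_gt0// -expRN => h.
  have -> : Phi p / p%:R * dx = p%:R^-1 * (Phi p * dx) by ring.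
  by rewrite invfM -[leRHS]mulrA; apply: ler_wpM2l.
have -> : Phi p / p%:R * (q * s * dx) = (Phi p / p%:R * dx) * (q * s) by ring.
apply: ler_pM key _; first by apply: mulr_ge0 => //; exact: normr_ge0.
  by apply: mulr_ge0; exact: normr_ge0.
by rewrite ler_piMr// normr_ge0.
Qed.

End Direct.

(** * The limit and the series *)

Section PrimeSeries.
Variable R : realType.

Lemma sqnorm_ge0 (H : R) a N : 0 < H -> 0 <= sqnorm H a N.
Proof.
move=> H0; rewrite sqnormE//.
have dV (s : R) : is_derive s 1 (fun s => - gram N.+1 (icos_mx s) (isin_mx s) (coef a))
    (- normc (expsum N.+1 (coef a) (@lnn R) s) ^+ 2).
  exact: (@is_deriveN R R R (fun s => gram N.+1 (icos_mx s) (isin_mx s) (coef a)) s 1 _ (is_derive_gram _ _ _ s)).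
have := mvt_le dV (ltW H0); rewrite lerN2.
have -> : gram N.+1 (icos_mx (0 : R)) (isin_mx 0) (coef a) = 0 by exact: gram0.
by apply => x _; rewrite oppr_le0 sqr_ge0.
Qed.

(** Extension by 0 transports an admissible choice from N to N + 1, which makes the minimum
    nonincreasing in N. *)
Lemma sqnorm_extend (H : R) a N :
  sqnorm H (fun k => if (k <= N)%N then a k else 0) N.+1 = sqnorm H a N.
Proof.
rewrite /sqnorm; congr Rintegral; apply/funext => t; congr (normc _ ^+ 2).
rewrite /primeDirichlet; congr (_ + _); rewrite big_mkcond [RHS]big_mkcond big_ord_recr /=.
rewrite ltnn mul0r if_same addr0; apply: eq_bigr => i _.
by rewrite -ltnS ltn_ord.
Qed.

(** Primes with Phi p < 1 give negative terms, so the partial sums of the series may be monotone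
    only from some rank on. *)
Lemma eventually_nondecreasing_limn (u : (\bar R)^nat) n0 :
  (forall i j, (n0 <= i)%N -> (i <= j)%N -> (u i <= u j)%E) ->
  cvgn u /\ forall n, (n0 <= n)%N -> (u n <= limn u)%E.
Proof.
move=> mono; pose v n := u (n + n0)%N.
have vm : {homo v : n m / (n <= m)%N >-> (n <= m)%E}.
  by move=> n m nm; apply: mono; rewrite ?leq_addl ?leq_add2r.
have cv := ereal_nondecreasing_cvgn vm.
have cu : u n @[n --> \oo] --> ereal_sup (range v) by rewrite -(@cvg_shiftn n0 _ u).
split; first by apply/cvg_ex; exists (ereal_sup (range v)).
move=> n nn; rewrite (cvg_lim _ cu)//; apply: ereal_sup_ubound.
by exists (n - n0)%N => //; rewrite /v subnK.
Qed.

(** If Phi q > 1 for some prime q, then ln and log+ agree on Phi from q on and the two series differ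
    by a constant. Otherwise log+ Phi vanishes and the partial sums of the series are nonpositive
    and nonincreasing. *)
Lemma prime_series_lty (Phi : nat -> R) :
  (forall p, prime p -> 0 < Phi p) ->
  (forall p q, prime p -> prime q -> (p <= q)%N -> Phi p <= Phi q) ->
  (\sum_(p <oo | prime p) (ln (Phi p) / (p%:R * ln p%:R))%:E < +oo)%E <->
  exists B, forall n, \sum_(0 <= p < n | prime p) lnp (Phi p) * (p%:R * ln (p%:R : R))^-1 <= B.
Proof.
move=> Phi0 Phi_incr.
pose g p : R := ln (Phi p) / (p%:R * ln p%:R).
pose s n : R := \sum_(0 <= p < n | prime p) g p.
pose T n : R := \sum_(0 <= p < n | prime p) lnp (Phi p) * (p%:R * ln (p%:R : R))^-1.
have sE : (fun n => \sum_(0 <= p < n | prime p) (g p)%:E)%E = (fun n => (s n)%:E).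
  by apply/funext => n; rewrite sumEFin.
rewrite sE.
have sT n : s n <= T n.
  by apply: ler_sum => p pp; apply: ler_wpM2r; [exact: pln_ge0 | exact: ln_le_lnp].
have [[q pq q1]|none] := pselect (exists2 q, prime q & 1 < Phi q).
- have Phi1 p : prime p -> (q <= p)%N -> 1 < Phi p.
    by move=> pp qp; apply: lt_le_trans q1 _; exact: Phi_incr.
  have lnE p : prime p -> (q <= p)%N -> lnp (Phi p) = ln (Phi p).
    by move=> pp qp; rewrite /lnp; apply/max_idPr; rewrite ln_ge0// ltW// Phi1.
  have split_s i j : (q <= i)%N -> (i <= j)%N -> s j - s i = T j - T i.
    move=> qi ij.
    have -> : s j = s i + \sum_(i <= p < j | prime p) g p by rewrite /s (@big_cat_nat _ _ _ i).
    have -> : T j = T i + \sum_(i <= p < j | prime p) lnp (Phi p) * (p%:R * ln (p%:R : R))^-1.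
      by rewrite /T (@big_cat_nat _ _ _ i).
    rewrite addrAC subrr add0r [RHS]addrAC subrr add0r.
    rewrite big_nat_cond [RHS]big_nat_cond; apply: eq_bigr => p /andP[/andP[ip _] pp].
    by rewrite lnE// (leq_trans qi).
  have Tmono i j : (i <= j)%N -> T i <= T j.
    move=> ij; rewrite /T [leRHS](@big_cat_nat _ _ _ i)//= lerDl sumr_ge0// => p pp.
    by rewrite mulr_ge0 ?lnp_ge0 ?pln_ge0.
  have mono i j : (q <= i)%N -> (i <= j)%N -> ((s i)%:E <= (s j)%:E)%E.
    by move=> qi ij; rewrite lee_fin; have := split_s i j qi ij; have := Tmono i j ij; lra.
  have [cs les] := eventually_nondecreasing_limn mono.
  split => [fin|[B HB]].
    have := les q (leqnn q); move: fin les; case: (limn _) => [l| |]// _ les sq.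
    exists (T q + l - s q) => n; have [qn|nq] := leqP q n.
      have := les n qn; rewrite lee_fin => sn; rewrite -/(T n).
      by have := split_s q n (leqnn q) qn; lra.
    by have := Tmono n q (ltnW nq); rewrite -/(T n); move: sq; rewrite lee_fin; lra.
  apply: (@le_lt_trans _ _ B%:E); last exact: ltry.
  by apply: lime_le => //; apply: nearW => n; rewrite lee_fin; exact: le_trans (sT n) (HB n).
- have Phi1 p : prime p -> Phi p <= 1.
    by move=> pp; rewrite leNgt; apply/negP => h; apply: none; exists p.
  have T0 n : T n = 0.
    apply: big1 => p pp; rewrite /lnp (max_idPl _) ?mul0r//.
    by rewrite -ln1 ler_ln ?posrE ?Phi0 ?Phi1.
  split => [_|_]; first by exists 0 => n; rewrite -/(T n) T0.
  have mono : {homo (fun n => (s n)%:E) : n m / (n <= m)%N >-> (m <= n)%E}.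
    move=> i j ij; rewrite lee_fin /s [leLHS](@big_cat_nat _ _ _ i)//= gerDl.
    apply: sumr_le0 => p pp; rewrite mulr_le0_ge0 ?pln_ge0//.
    by rewrite -ln1 ler_ln ?posrE ?Phi0 ?Phi1.
  apply: (@le_lt_trans _ _ 0%:E); last exact: ltry.
  apply: lime_le; first exact: ereal_nonincreasing_is_cvgn.
  by apply: nearW => n; rewrite lee_fin -(T0 n).
Qed.

End PrimeSeries.

Theorem corollary1 (R : realType) (Phi : nat -> R) (H : R)
  (Phi_gt0 : forall p, prime p -> 0 < Phi p)
  (Phi_incr : forall p q, prime p -> prime q -> (p <= q)%N -> Phi p <= Phi q)
  (H_gt0 : 0 < H) :
  exists m : nat -> R,
    [/\ forall N, is_min [set sqnorm H a N | a in admissible Phi N] (m N),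
        cvgn m
      & 0 < limn m <->
        (\sum_(p <oo | prime p) (ln (Phi p) / (p%:R * ln p%:R))%:E < +oo)%E].
Proof.
have /choice[a aP] N : exists a, admissible Phi N a /\
    forall a', admissible Phi N a' -> sqnorm H a N <= sqnorm H a' N.
  have [a adm amin] := @gram_min R N (icos_mx H) (isin_mx H) Phi Phi_gt0.
  by exists a; split => // a' adm'; rewrite !sqnormE//; exact: amin.
pose m N := sqnorm H (a N) N; exists m.
have m_le N a' : admissible Phi N a' -> m N <= sqnorm H a' N.
  by move=> adm; exact: (proj2 (aP N)).
have m_noninc : {homo m : n k / (n <= k)%N >-> k <= n}.
  apply/nonincreasing_seqP => N; rewrite /m -(sqnorm_extend H (a N) N); apply: m_le.
  move=> p pp _ /=; case: ifP => pN; first exact: (proj1 (aP N)).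
  by rewrite Normc.normc0 ltW// Phi_gt0.
have m_cvg : cvgn m.
  apply: nonincreasing_is_cvgn => //; exists 0 => _ [N _ <-]; exact: sqnorm_ge0.
split => // [N|].
  split; first by exists (a N) => //; exact: (proj1 (aP N)).
  by move=> _ [a' adm <-]; exact: m_le.
rewrite (prime_series_lty Phi_gt0 Phi_incr); split => [lim0|[B HB]].
  apply: (converse_direction Phi_gt0 Phi_incr H_gt0 lim0) => N a' adm.
  by apply: le_trans (m_le N a' adm); exact: nonincreasing_cvgn_ge.
have [d d0 dP] := direct_direction Phi_gt0 Phi_incr H_gt0 HB.
apply: (lt_le_trans d0); apply: limr_ge => //; apply: nearW => N.
by apply: dP; exact: (proj1 (aP N)).
Qed.
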